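(* Let $\nu\in(-1,\infty)$ (dimension $n=1$) and let $\mathcal M_{\mathcal L_\nu}f(x)=\sup_{t>0}|e^{-t\mathcal L_\nu}f(x)|$. Then for every $p$ with $\big(\tfrac{1}{\gamma_\nu}\big)'<p<\tfrac{1}{\gamma_\nu}$ and every weight $w\in A_{p(1-\gamma_\nu)}(\mathbb R_+)\cap RH_{(\frac{1}{p\gamma_\nu})'}(\mathbb R_+)$, there is $C>0$ such that $\|\mathcal M_{\mathcal L_\nu}f\|_{L^p_w(\mathbb R_+)}\le C\|f\|_{L^p_w(\mathbb R_+)}$ for all $f\in L^p_w(\mathbb R_+)$. Here the convention $1/0=\infty$ is used (so for $\nu\ge -1/2$ the range is $1<p<\infty$, $w\in A_p$, with $RH_1$ meaning no condition), and $q'$ denotes the conjugate exponent $q/(q-1)$.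
   Context: For $\nu>-1$ and $k\in\mathbb N=\{0,1,\dots\}$, the one-dimensional Laguerre functions are $\varphi_k^\nu(x)=\big(\tfrac{2\Gamma(k+1)}{\Gamma(k+\nu+1)}\big)^{1/2}L_k^\nu(x^2)x^{\nu+1/2}e^{-x^2/2}$, $x>0$, where $L^\nu_k$ is the Laguerre polynomial of degree $k$ and order $\nu$; they form an orthonormal basis of $L^2(\mathbb R_+)$. $\mathcal L_\nu$ is the self-adjoint operator $\mathcal L_\nu f=\sum_{k}(4k+2\nu+2)\langle f,\varphi_k^\nu\rangle\varphi_k^\nu$ (a self-adjoint extension of $-\frac{d^2}{dx^2}+x^2+x^{-2}(\nu^2-\frac14)$ on $C_c^\infty(\mathbb R_+)$), and $e^{-t\mathcal L_\nu}$ is its heat semigroup. Define $\gamma_\nu=-1/2-\nu$ if $-1<\nu<-1/2$ and $\gamma_\nu=0$ if $\nu\ge-1/2$. Weights: for $1<q<\infty$, $w\in A_q$ if $\big(\fint_B w\big)\big(\fint_B w^{-1/(q-1)}\big)^{q-1}\le C$ for all balls $B$ (balls of $\mathbb R_+$ with the Euclidean metric); $w\in RH_r$ ($1<r<\infty$) if $\big(\fint_B w^r\big)^{1/r}\le C\fint_B w$ for all balls $B$; $w\in RH_\infty$ if $w(x)\le C\fint_B w$ for a.e. $x\in B$. $L^p_w$ is the $L^p$ space with respect to $w(x)dx$. *)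

(* Defs.v *)
From HB Require Import structures.
From mathcomp Require Import all_boot all_order all_algebra.
From mathcomp Require Import all_classical all_reals all_analysis.
Set Implicit Arguments. Unset Strict Implicit. Unset Printing Implicit Defensive.
Import Order.TTheory GRing.Theory Num.Theory.
Import numFieldNormedType.Exports.
Local Open Scope classical_set_scope.
Local Open Scope ring_scope.

Section Defs.
Context {R : realType}.
Local Notation mu := (@lebesgue_measure R).

Definition Rplus : set R := `]0, +oo[%classic.

Definition Gamma (s : R) : R :=
  fine (\int[mu]_(t in Rplus) (t `^ (s - 1) * expR (- t))%:E)%E.

(* generalized binomial coefficient binom(k+nu, k-j) = prod_{i=j+1}^k (nu+i) / (k-j)! *)
Definition gbinom (nu : R) (k j : nat) : R :=
  (\prod_(j.+1 <= i < k.+1) (nu + i%:R)) / ((k - j)`!)%:R.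

Definition laguerre (nu : R) (k : nat) (x : R) : R :=
  \sum_(j < k.+1) (-1) ^+ j * gbinom nu k j * x ^+ j / (j`!)%:R.

Definition laguerre_fn (nu : R) (k : nat) (x : R) : R :=
  Num.sqrt (2 * Gamma (k%:R + 1) / Gamma (k%:R + nu + 1))
  * laguerre nu k (x ^+ 2) * x `^ (nu + 2^-1) * expR (- (x ^+ 2) / 2).

Definition heat_kernel (nu t x y : R) : R :=
  limn (fun n : nat => \sum_(k < n)
     expR (- (t * (4 * k%:R + 2 * nu + 2))) * laguerre_fn nu k x * laguerre_fn nu k y).

Definition heat (nu t : R) (f : R -> R) (x : R) : \bar R :=
  (\int[mu]_(y in Rplus) (heat_kernel nu t x y * f y)%:E)%E.

Definition heat_max (nu : R) (f : R -> R) (x : R) : \bar R :=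
  ereal_sup [set `|heat nu t f x|%E | t in Rplus].

Definition Lpw_norm (p : R) (w : R -> R) (F : R -> \bar R) : \bar R :=
  ((\int[mu]_(x in Rplus) (poweR `|F x| p * (w x)%:E)) `^ p^-1)%E.

Definition ballRp (x r : R) : set R := [set y | 0 < y /\ `|y - x| < r].
Definition is_ballRp (B : set R) : Prop := exists x r, 0 < x /\ 0 < r /\ B = ballRp x r.

Definition avg (B : set R) (g : R -> R) : \bar R :=
  ((fine (mu B))^-1%:E * \int[mu]_(x in B) (g x)%:E)%E.

Definition is_weight (w : R -> R) : Prop :=
  measurable_fun Rplus w /\ (forall x, 0 < x -> 0 < w x).

Definition Ap_weight (q : R) (w : R -> R) : Prop :=
  exists C : R, forall B, is_ballRp B ->
    (avg B w * (avg B (fun x => (w x `^ (- (q - 1)^-1))%R)) `^ (q - 1) <= C%:E)%E.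

Definition RH_weight (r : \bar R) (w : R -> R) : Prop :=
  match r with
  | r'%:E => exists C : R, forall B, is_ballRp B ->
      ((avg B (fun x => (w x `^ r')%R)) `^ r'^-1 <= C%:E * avg B w)%E
  | +oo%E => exists C : R, forall B, is_ballRp B ->
      {ae mu, forall x, B x -> ((w x)%:E <= C%:E * avg B w)%E}
  | -oo%E => False
  end.

Definition gamma_nu (nu : R) : R := if nu < - 2^-1 then - 2^-1 - nu else 0.

Definition recip (x : R) : \bar R := if x == 0 then +oo%E else (x^-1)%:E.

Definition conj_exp (q : \bar R) : \bar R :=
  match q with
  | q'%:E => (q' / (q' - 1))%:E
  | +oo%E => 1%E
  | -oo%E => -oo%E
  end.

End Defs.

(* Main.v *)
Require Import Defs.
From HB Require Import structures.
From mathcomp Require Import all_boot all_order all_algebra.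
From mathcomp Require Import all_classical all_reals all_analysis.
From mathcomp Require Import measurable_realfun.
From mathcomp Require Import ring lra zify.
Import Order.TTheory GRing.Theory Num.Theory.
Import numFieldNormedType.Exports.
Local Open Scope classical_set_scope.
Local Open Scope ring_scope.
Set Implicit Arguments. Unset Strict Implicit. Unset Printing Implicit Defensive.

(* Bailey's product formula for Laguerre polynomials holds because both sides are polynomial solutions of the same Laguerre equation. It yields the Hille-Hardy formula for the heat kernel, and estimates of the modified Bessel function then bound the kernel by
     C T^(-1/2) (1 + T/(2xy))^g exp(-(x - y)^2/T),  T = 2 sinh(2t),  g = gamma_nu.
   Cutting the Gaussian into dyadic pieces gives M f(x) <= C x^(-g) sup b^(2g)/(b - a) int_a^b |f| y^(-g) dy, the supremum being over the intervals (a,b) with rational endpoints that contain x. As b^(-2g) (b - a) is at most the mass of (a,b) for the density x^(-2g), this is a maximal operator to which Lerner's proof of the Muckenhoupt theorem applies, with the densities V = w x^(-pg) and S = w^(-1/(p-1)) x^(-pg/(p-1)), for which V S^(p-1) = (x^(-2g))^p. The condition relating V and S follows from the hypotheses on w: they give a joint bound for w^r and w^(-1/(q-1)), r = 1/(1-pg), q = p(1-g); this bound forces geometric decay of both masses on (0, 2^(-k)), which controls the singular factors at 0. *)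

(** For nu < -1/2 the kernel is not dominated by a Gaussian near the origin, where it behaves like
    (x y)^(-g). This singularity is the source of the range p g < 1 < p (1 - g). The joint bound on
    w is, up to a power, the Muckenhoupt condition A_Q for w^r with Q = (p - 2pg)/(1 - pg). As V =
    (w^r)^(1 - pg) x^(-pg), and similarly for S, both densities mix an A_Q weight or its dual with
    x^(-1), which is not integrable at 0; the geometric decay compensates for this. The geometric
    fact behind the maximal theorem is that two of three intervals with a common point cover all
    three. It gives a weak type bound with constant 2 for every density, so Lerner's argument can
    take V and S as measures. Finitely many intervals are treated at a time, because the left side
    must be finite before a part of it is absorbed; rational endpoints make the family countable,
    and monotone convergence then reaches the supremum. The j-th Gaussian piece has weight 4^(-j)
    and loses 2^j to the length of its interval, which leaves a convergent series. *)

Section Pochhammer.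
Context {R : realFieldType}.
Implicit Types (b c : R) (n m k : nat).

Definition poch c n : R := \prod_(i < n) (c + i%:R).

Lemma poch0 c : poch c 0 = 1.
Proof. by rewrite /poch big_ord0. Qed.

Lemma pochSr c n : poch c n.+1 = poch c n * (c + n%:R).
Proof. by rewrite /poch big_ord_recr. Qed.

Lemma pochS c n : poch c n.+1 = c * poch (c + 1) n.
Proof.
rewrite /poch big_ord_recl /= addr0; congr (_ * _).
by apply: eq_bigr => i _; rewrite /= /bump add1n -natr1 -addrA (addrC 1).
Qed.

Lemma poch_gt0 c n : 0 < c -> 0 < poch c n.
Proof. by move=> c0; apply: prodr_gt0 => i _; rewrite ltr_pwDl// ler0n. Qed.

Lemma poch1 n : poch 1 n = (n`!)%:R.
Proof.
elim: n => [|n IH]; first by rewrite poch0.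
by rewrite pochSr IH factS mulnC natrM -natr1 addrC.
Qed.

End Pochhammer.

(** * Laguerre polynomials and Bailey's product formula *)

Section Laguerre.
Context {R : realFieldType}.
Implicit Types (b c : R) (n m k : nat).

(* The index is shifted by one: [lagP b 0 = 0] stands for the polynomial of degree -1, so that the recurrences hold for all indices. *)
Definition lag_coef b n k : R :=
  if (k < n)%N then (-1) ^+ k / (k`!)%:R * (poch (b + k.+1%:R) (n.-1 - k) / ((n.-1 - k)`!)%:R)
  else 0.

Definition lagP b n : {poly R} := \poly_(k < n) lag_coef b n k.

Lemma coef_lagP b n k : (lagP b n)`_k = lag_coef b n k.
Proof. by rewrite coef_poly /lag_coef; case: (k < n)%N. Qed.

Lemma lagP0 b : lagP b 0 = 0.
Proof. by apply/polyP => k; rewrite coef_lagP coef0. Qed.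

Lemma factr_neq0 n : (n`!)%:R != 0 :> R.
Proof. by rewrite pnatr_eq0 -lt0n fact_gt0. Qed.

Lemma natrS_neq0 n : n%:R + 1 != 0 :> R.
Proof. by rewrite natr1 pnatr_eq0. Qed.

Lemma deriv_lagP b n : (lagP b n.+1)^`() = - lagP (b + 1) n.
Proof.
apply/polyP => k; rewrite coef_deriv coefN !coef_lagP /lag_coef ltnS.
case: ifP => [kn|_]; last by rewrite mul0rn oppr0.
have -> : (n - k.+1 = n.-1 - k)%N by rewrite subnS; case: n kn => // n _; rewrite subSKn.
have -> : b + 1 + k.+1%:R = b + k.+2%:R by rewrite -(natr1 k.+1); ring.
rewrite -mulr_natr factS natrM exprS.
have /= := natrS_neq0 k; have := factr_neq0 k.
have := factr_neq0 (n.-1 - k); rewrite -natr1 => h1 h2 h3.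
by field; rewrite h1 h2 h3.
Qed.

Lemma lagP_succ b n : lagP (b + 1) n.+1 = lagP b n.+1 + lagP (b + 1) n.
Proof.
apply/polyP => k; rewrite coefD !coef_lagP /lag_coef ltnS /=.
case: (ltngtP k n) => [kn|kn|->]; last by rewrite subnn !poch0 addr0.
  have [m ->] : exists m, n = (k + m).+1.
    by exists (n - k.+1)%N; rewrite -addSn subnKC.
  rewrite /= -addnS !addKn pochSr pochS factS natrM -!(natr1 m) -!(natr1 k).
  have -> : b + (k%:R + 1) + 1 = b + 1 + (k%:R + 1) by ring.
  have := factr_neq0 k; have := factr_neq0 m; have /= := natrS_neq0 m => h1 h2 h3.
  by field; rewrite h1 h2 h3.
by rewrite addr0.
Qed.

Lemma lag_coef_rec b n k :
  lag_coef b n.+1 k.+1 * (k.+1%:R * (b + k.+1%:R)) = (k%:R - n%:R) * lag_coef b n.+1 k.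
Proof.
rewrite /lag_coef !ltnS /=; case: (ltngtP k n) => [kn|kn|->]; first last.
- by rewrite subrr !mul0r.
- by rewrite mul0r mulr0.
have [m ->] : exists m, n = (k + m).+1.
  by exists (n - k.+1)%N; rewrite -addSn subnKC.
rewrite subSS (_ : ((k + m).+1 - k = m.+1)%N) ?addKn; last by rewrite -addnS addKn.
rewrite pochS !factS !natrM exprS -!natr1 natrD.
have -> : b + (k%:R + 1) + 1 = b + (k%:R + 1 + 1) by ring.
have := factr_neq0 k; have := factr_neq0 m; have /= := natrS_neq0 m.
have /= := natrS_neq0 k => h1 h2 h3 h4.
by field; rewrite h1 h2 h3 h4.
Qed.

Definition lag_op b n (P : {poly R}) : {poly R} :=
  'X * P^`()^`() + (b%:P + 1 - 'X) * P^`() + n%:R * P.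

Lemma coef_lag_op b n P k :
  (lag_op b n P)`_k = (k.+1%:R * (b + k.+1%:R)) * P`_k.+1 - (k%:R - n%:R) * P`_k.
Proof.
rewrite /lag_op !mulrDl mulNr !coefD ?coefN mul1r coefCM !coefXM.
rewrite -polyC_natr coefCM !coef_deriv.
case: k => [|k] /=; rewrite mulNr coefN coefXM /= ?coef_deriv.
  by rewrite mulr1n !mul0r; ring.
by rewrite -[_ *+ k.+2]mulr_natr -[_ *+ k.+1]mulr_natr -!natr1; ring.
Qed.

Lemma lag_op_lagP b n : lag_op b n (lagP b n.+1) = 0.
Proof.
by apply/polyP => k; rewrite coef_lag_op !coef_lagP mulrC lag_coef_rec subrr coef0.
Qed.

(** Comparing coefficients turns the equation into a first order recursion whose leading factor (k +
    1)(b + k + 1) does not vanish for b > -1, so the constant term determines the solution. *)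
Lemma lag_op_inj b n (P Q : {poly R}) : -1 < b ->
  lag_op b n P = 0 -> lag_op b n Q = 0 -> P`_0 = Q`_0 -> P = Q.
Proof.
move=> b1 HP HQ H0; apply/polyP => k; elim: k => [//|k IH].
have c0 : k.+1%:R * (b + k.+1%:R) != 0 :> R.
  rewrite mulf_neq0// ?pnatr_eq0// gt_eqF// -natr1.
  by have := ler0n R k; lra.
apply: (mulfI c0); have := congr1 (fun p : {poly R} => p`_k) HP.
have := congr1 (fun p : {poly R} => p`_k) HQ.
by rewrite !coef_lag_op !coef0 IH => /eqP; rewrite subr_eq0 => /eqP -> /eqP; rewrite subr_eq0 => /eqP.
Qed.

Definition lag_shift b n y : {poly R} := lagP b n \Po ('X + y%:P).

Lemma deriv_shift (P : {poly R}) y : (P \Po ('X + y%:P))^`() = P^`() \Po ('X + y%:P).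
Proof. by rewrite deriv_comp derivD derivX derivC addr0 mulr1. Qed.

(** After the substitution X + y, the extra y in the coefficients of the equation leaves -y (P'' -
    P') for P = L_n^b; the derivative and order relations identify P'' - P' with L_(n-1)^(b+2). *)
Lemma lag_shift_op b n y : lag_op b n (lag_shift b n.+1 y) = - y%:P * lag_shift (b + 1 + 1) n y.
Proof.
have := congr1 (fun p => p \Po ('X + y%:P)) (lag_op_lagP b n).
rewrite /lag_op /lag_shift !deriv_shift comp_poly0.
rewrite !(comp_polyB,comp_polyD,comp_polyM,comp_polyX,comp_polyC) -!polyC_natr -!polyC1 !comp_polyC.
have -> : lagP (b + 1 + 1) n = (lagP b n.+1)^`()^`() - (lagP b n.+1)^`().
  rewrite deriv_lagP derivN opprK; case: n => [|n]; first by rewrite !lagP0 deriv0 oppr0 addr0.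
  by rewrite deriv_lagP opprK lagP_succ addrC.
rewrite comp_polyB => h.
apply/eqP; rewrite -subr_eq0; apply/eqP; rewrite -[RHS]h; ring.
Qed.

(** A factor X^m raises the order by 2m and lowers the degree by m; the remainder carries the
    indicial polynomial m (m + b) of the equation at 0. *)
Lemma lag_op_Xn_mul b n m (Q : {poly R}) : (m <= n)%N ->
  lag_op b n ('X^m * Q) = (m%:R * (m%:R + b)) *: ('X^(m.-1) * Q) + 'X^m * lag_op (b + 2 * m%:R) (n - m) Q.
Proof.
move=> mn; rewrite -mul_polyC /lag_op natrB//.
rewrite !derivM !derivD !derivM !derivXn !polyCM !polyCD !polyC_natr.
case: m mn => [|[|m]] mn /=.
- by rewrite !(expr0, mulr0n, deriv0); ring.
- by rewrite !(expr0, expr1, mulr1n, derivC); ring.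
- by rewrite derivMn derivXn /= -[_ *+ m.+1]mulr_natr -[_ *+ m.+2]mulr_natr -!natr1 !exprS; ring.
Qed.

Definition bailey_coef b y m : R := y ^+ m / ((m`!)%:R * poch (b + 1) m).

Lemma bailey_coefS b y m : -1 < b ->
  bailey_coef b y m.+1 * (m.+1%:R * (m.+1%:R + b)) = bailey_coef b y m * y.
Proof.
move=> b1; rewrite /bailey_coef factS natrM pochSr exprS -!(natr1 m).
have /= := natrS_neq0 m; have := factr_neq0 m => h1 h2.
have h3 : poch (b + 1) m != 0 by rewrite gt_eqF// poch_gt0//; lra.
have h4 : b + 1 + m%:R != 0 by rewrite gt_eqF//; have := ler0n R m; lra.
by field; rewrite h1 h2 h3 h4.
Qed.

Lemma lag_op_sum b n (I : Type) (r : seq I) (F : I -> {poly R}) :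
  lag_op b n (\sum_(i <- r) F i) = \sum_(i <- r) lag_op b n (F i).
Proof.
have lagD P Q : lag_op b n (P + Q) = lag_op b n P + lag_op b n Q.
  by rewrite /lag_op !derivD; ring.
have lag0 : lag_op b n 0 = 0 by rewrite /lag_op !deriv0 !mulr0 !addr0.
by apply: (big_morph _ lagD lag0).
Qed.

Lemma lag_opZ b n c (P : {poly R}) : lag_op b n (c *: P) = c *: lag_op b n P.
Proof. by rewrite /lag_op !derivZ -!mul_polyC; ring. Qed.

(** The right side of Bailey's formula as a polynomial in x, for fixed y. *)
Definition bailey_poly b n y : {poly R} :=
  \sum_(m < n.+1) bailey_coef b y m *: ('X^m * lag_shift (b + 2 * m%:R) (n.+1 - m) y).

(** Each summand produces one term with X^(m-1) and one with X^m; by [bailey_coefS] the latter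
    cancels the first term of the next summand. *)
Lemma lag_op_bailey_poly b n y : -1 < b -> lag_op b n (bailey_poly b n y) = 0.
Proof.
move=> b1; rewrite lag_op_sum.
(* [G m] is the term with X^(m-1). The sum telescopes to 0 because [G n.+1] contains [lagP] at index
   0. *)
pose G m : {poly R} := if m is m'.+1 then
  (bailey_coef b y m' * y) *: ('X^m' * lag_shift (b + 2 * m%:R) (n.+1 - m) y) else 0.
rewrite (eq_bigr (fun m : 'I_n.+1 => G m - G m.+1)); last first.
  move=> [m mn] _ /=; rewrite lag_opZ lag_op_Xn_mul// (subSn (mn : (m <= n)%N)) lag_shift_op subSS.
  have -> : b + 2 * m%:R + 1 + 1 = b + 2 * m.+1%:R by rewrite -natr1; ring.
  case: m mn => [|m] mn /=.
    rewrite expr0 !mul0r scale0r add0r !mul1r sub0r mulNr scalerN mul_polyC scalerA; congr (- (_ *: lag_shift (_ + 2 * _) _ _)).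
  rewrite -(subSn (mn : (m.+1 <= n)%N)) -(bailey_coefS y m b1) -!mul_polyC !polyCM; ring.
have -> : \sum_(i < n.+1) (G i - G i.+1) = - \sum_(0 <= i < n.+1) (G i.+1 - G i).
  by rewrite big_mkord -sumrN; apply: eq_bigr => i _; rewrite opprB.
by rewrite telescope_sumr//= subnn /lag_shift lagP0 comp_poly0 mulr0 scaler0 subrr oppr0.
Qed.

Lemma poch_neq0 b n : -1 < b -> poch (b + 1) n != 0.
Proof. by move=> b1; rewrite gt_eqF// poch_gt0//; lra. Qed.

(** By [lag_op_inj] only constant terms in x are compared: at x = 0 just m = 0 survives, and
    L_n^b(0) = (b + 1)_n / n!. *)
Lemma bailey b n x y : -1 < b ->
  (n`!)%:R / poch (b + 1) n * (lagP b n.+1).[x] * (lagP b n.+1).[y] =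
  \sum_(m < n.+1) (x * y) ^+ m / ((m`!)%:R * poch (b + 1) m)
     * (lagP (b + 2 * m%:R) (n.+1 - m)).[x + y].
Proof.
move=> b1.
have E : ((n`!)%:R / poch (b + 1) n * (lagP b n.+1).[y]) *: lagP b n.+1 = bailey_poly b n y.
  apply: (lag_op_inj b1 (n := n)).
  - by rewrite lag_opZ lag_op_lagP scaler0.
  - exact: lag_op_bailey_poly.
  rewrite coefZ coef_lagP -!horner_coef0 /bailey_poly horner_sum big_ord_recl big1 ?addr0.
    rewrite /lag_coef /= subn0 hornerZ hornerM expr0 hornerC /lag_shift horner_comp hornerD hornerX hornerC.
    rewrite /bailey_coef fact0 poch0 expr0 mulr0 addr0 add0r subn0.
    have h1 := factr_neq0 n; have h2 := poch_neq0 n b1.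
    by field; rewrite h1 h2.
  by move=> i _; rewrite hornerZ hornerM hornerXn exprS !mul0r mulr0.
have := congr1 (fun p : {poly R} => p.[x]) E.
rewrite /bailey_poly hornerZ horner_sum => H.
transitivity ((n`!)%:R / poch (b + 1) n * (lagP b n.+1).[y] * (lagP b n.+1).[x]); first by ring.
rewrite H; apply: eq_bigr => i _.
rewrite hornerZ hornerM hornerXn /lag_shift horner_comp hornerD hornerX hornerC /bailey_coef exprMn.
by ring.
Qed.

End Laguerre.

(** * Dominated convergence for triangular sums *)

Section Series.
Context {R : realType}.
Implicit Types (u v : R ^nat).

Lemma ge0_series_le_lim u n : (forall k, 0 <= u k) -> cvgn (series u) ->
  series u n <= limn (series u).
Proof.
move=> u0 cu; apply: nondecreasing_cvgn_le => //.
by apply/nondecreasing_seqP => k; rewrite seriesSr lerDl.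
Qed.

Lemma ge0_series_bounded_cvg u M : (forall k, 0 <= u k) -> (forall n, series u n <= M) ->
  cvgn (series u) /\ limn (series u) <= M.
Proof.
move=> u0 uM; have cu : cvgn (series u).
  apply: nondecreasing_is_cvgn; first by apply/nondecreasing_seqP => k; rewrite seriesSr lerDl.
  by exists M => _ [n _ <-].
by split => //; apply: limr_le => //; near=> n; exact: uM.
Unshelve. all: by end_near. Qed.

Lemma cvg_sum_ord K (f : nat -> R ^nat) (l : R ^nat) : (forall j, f j @ \oo --> l j) ->
  (fun n => \sum_(j < K) f j n) @ \oo --> \sum_(j < K) l j.
Proof.
move=> fl; elim: K => [|K IH].
  by rewrite big_ord0; under eq_fun do rewrite big_ord0; exact: cvg_cst.
by rewrite big_ord_recr; under eq_fun do rewrite big_ord_recr; exact: cvgD.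
Qed.

(** Dominated convergence for a convolution: in the n-th sum the j-th term has only reached index n
    - j, which still tends to infinity for fixed j. *)
Lemma tannery (F : nat -> nat -> R) (L M : R ^nat) :
  (forall j k, `|F j k| <= M j) -> cvgn (series M) ->
  (forall j, F j @ \oo --> L j) ->
  cvgn (series L) /\ (fun n => \sum_(j < n) F j (n - j)%N) @ \oo --> limn (series L).
Proof.
move=> FM cM FL.
have M0 j : 0 <= M j by apply: le_trans (FM j 0%N).
have LM j : `|L j| <= M j.
  have := FL j => /cvg_norm h; rewrite -(cvg_lim _ h)//; apply: limr_le; first by apply/cvg_ex; eexists; exact: h.
  by near=> k; exact: FM.
have cL : cvgn (series L).
  by apply: normed_cvg; apply: series_le_cvg cM => // n; rewrite normr_ge0.
split=> //.
set S := limn (series M).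
suff H : (fun n => \sum_(j < n) (F j (n - j)%N - L j)) @ \oo --> (0 : R).
  rewrite -[limn _]add0r; apply: cvg_trans (cvgD H (cL : series L @ \oo --> _)).
  apply: near_eq_cvg; near=> n.
  rewrite [RHS](_ : _ = \sum_(j < n) (F j (n - j)%N - L j) + series L n)// seriesEord /= -big_split/=.
  by apply: eq_bigr => i _; rewrite addrNK.
apply/cvgrPdist_le => e e0.
have e3 : 0 < e / 3 by rewrite divr_gt0.
(* The tail of [M] beyond [K] is at most e/3 and is counted twice, since [F] and [L] differ by at
   most twice [M]; the first [K] terms account for the remaining e/3. *)
have [K _ /(_ K (leqnn K))] : \forall n \near \oo, `|S - series M n| <= e / 3.
  by move/cvgrPdist_le : (cM : series M @ \oo --> S); exact.
rewrite ger0_norm ?subr_ge0 ?ge0_series_le_lim// => SK.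
have hK (j : nat) : (fun n => `|F j (n - j)%N - L j|) @ \oo --> (0 : R).
  have h : (fun n => F j (n - j)%N) @ \oo --> L j by rewrite (cvg_centern j (F j)).
  by have := cvg_norm (cvgB h (cvg_cst (L j))); rewrite subrr normr0; apply.
have := cvg_sum_ord (K := K) hK.
rewrite big1// => /cvgrPdist_le /(_ _ e3) HK.
near=> n.
have Kn : (K <= n)%N by near: n; exact: nbhs_infty_ge.
rewrite sub0r normrN (le_trans (ler_norm_sum _ _ _))//.
rewrite -(big_mkord xpredT (fun j => `|F j (n - j)%N - L j|)) (big_cat_nat _ (n := K))//=.
rewrite [e](_ : _ = e / 3 + (e / 3 + e / 3)); last by field.
apply: lerD.
  rewrite big_mkord; apply: le_trans (_ : `|0 - \sum_(j < K) `|F j (n - j)%N - L j| | <= _).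
    by rewrite sub0r normrN ler_norm.
  by near: n; exact: HK.
apply: (@le_trans _ _ (\sum_(K <= j < n) (M j + M j))).
  by apply: ler_sum => j _; rewrite (le_trans (ler_normB _ _))// lerD.
have : \sum_(K <= j < n) M j <= e / 3.
  rewrite -sub_series_geq//; apply: le_trans SK.
  by rewrite lerD2r ge0_series_le_lim.
by rewrite big_split/= => h; rewrite lerD.
Unshelve. all: by end_near. Qed.

End Series.

(** * The binomial series *)

Section BinomialSeries.
Context {R : realType}.
Implicit Types (c r : R).

Definition bin_coef c r (l : nat) : R := poch c l / (l`!)%:R * r ^+ l.

(** The expansion of (1 - r)^(-c). It enters through this value as an upper bound and through its
    ratio under c -> c + 1. *)
Definition bin_series c r : R := limn (series (bin_coef c r)).

Lemma bin_coef_ge0 c r l : 0 < c -> 0 <= r -> 0 <= bin_coef c r l.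
Proof.
by move=> c0 r0; rewrite /bin_coef mulr_ge0 ?exprn_ge0// divr_ge0// ltW// poch_gt0.
Qed.

Definition bin_poly c n : {poly R} := \poly_(l < n) (poch c l / (l`!)%:R).

Lemma horner_bin_poly c n r : (bin_poly c n).[r] = series (bin_coef c r) n.
Proof. by rewrite horner_poly seriesEord. Qed.

(** The full series solves (1 - r) u' = c u; for a truncation the defect is a single monomial with
    nonnegative coefficient. *)
Lemma deriv_bin_poly c n r : 0 < c -> 0 <= r ->
  (1 - r) * (bin_poly c n)^`().[r] <= c * (bin_poly c n).[r].
Proof.
move=> c0 r0.
have -> : (1 - r) * (bin_poly c n)^`().[r] = ((1 - 'X) * (bin_poly c n)^`()).[r].
  by rewrite hornerM hornerD hornerN hornerX hornerC.
rewrite -subr_ge0 -hornerZ -hornerN -hornerD.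
case: n => [|n].
  by rewrite /bin_poly poly_def big_ord0 deriv0 mulr0 scaler0 subrr hornerC.
suff -> : c *: bin_poly c n.+1 - (1 - 'X) * (bin_poly c n.+1)^`() =
   ((c + n%:R) * (poch c n / (n`!)%:R)) *: 'X^n.
  rewrite hornerZ hornerXn mulr_ge0 ?exprn_ge0// mulr_ge0 ?addr_ge0// ?(ltW c0)//.
  by rewrite divr_ge0// ltW// poch_gt0.
apply/polyP => k; rewrite coefD coefN !coefZ coefXn mulrBl mul1r coefB coefXM !coef_deriv !coef_poly.
rewrite !ltnS.
have H j : poch c j.+1 / (j.+1`!)%:R *+ j.+1 = (c + j%:R) * (poch c j / (j`!)%:R).
  rewrite pochSr factS natrM -mulr_natr.
  have h1 : (j`!)%:R != 0 :> R := factr_neq0 j; have h2 : j.+1%:R != 0 :> R by rewrite pnatr_eq0.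
  by move: h2; rewrite -natr1 => h2; field; rewrite h1 h2.
case: (ltngtP k n) => [kn|nk|->].
- rewrite H mulr0; case: k kn => [|k] kn /=; first by rewrite addr0; ring.
  by rewrite (ltnW kn) -[_ *+ k.+1]mulr_natr; ring.
- case: k nk => [//|k] nk /=; rewrite mul0rn.
  by rewrite leqNgt nk/= mul0rn mulr0; ring.
- rewrite mul0rn mulr1; case: n => [|n] /=; first by ring.
  by rewrite leqnn -[_ *+ n.+1]mulr_natr; ring.
Qed.

(** By [deriv_bin_poly], (1 - x)^c times the truncated series is nonincreasing on [0, r], and it is
    at most 1 at 0. *)
Lemma bin_series_bound c r n : 0 < c -> 0 <= r < 1 -> series (bin_coef c r) n <= (1 - r) `^ (- c).
Proof.
move=> c0 /andP[r0 r1].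
pose g (x : R) := (1 - x) `^ c * (bin_poly c n).[x].
have dg (x : R) : x < 1 -> is_derive x 1 g
   ((1 - x) `^ c * (bin_poly c n)^`().[x] + (bin_poly c n).[x] * (- (c * (1 - x) `^ (c - 1)))).
  move=> x1; rewrite /g.
  have h1 : is_derive x 1 (fun x : R => (1 - x) `^ c) (- (c * (1 - x) `^ (c - 1))).
    have -> : (fun x : R => (1 - x) `^ c) = ((@powR R) ^~ c) \o (fun x : R => 1 - x) by [].
    rewrite -[X in is_derive _ _ _ X]mulrN1; apply: (@is_derive1_comp R (fun z => z `^ c) (fun x => 1 - x) x _ (-1)).
      by apply: is_derive1_powR; rewrite subr_gt0.
  by rewrite -[-1]add0r; apply: is_deriveB.
  have := is_deriveM h1 (is_derive_poly (bin_poly c n) x).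
  by rewrite /GRing.scale /=; apply.
have g1 (x : R) : x < 1 -> 0 <= x -> (g^`()%classic) x <= 0.
  move=> x1 x0; rewrite derive1E; have [_ ->] := dg _ x1.
  have h := deriv_bin_poly n c0 x0.
  have x1' : 0 <= 1 - x by rewrite subr_ge0 ltW.
  rewrite -(mulr_powRB1 x1' c0).
  rewrite [leLHS](_ : _ = (1 - x) `^ (c - 1) * ((1 - x) * (bin_poly c n)^`().[x] - c * (bin_poly c n).[x])); last by ring.
  by apply: mulr_ge0_le0; rewrite ?powR_ge0// subr_le0.
have gr : g r <= g 0.
  apply: (@ler0_derive1_nincr R g 0 r) => //.
  - move=> x; rewrite in_itv/= => /andP[x0 xr].
    by have [] := dg x (lt_trans xr r1).
  - by move=> x; rewrite in_itv/= => /andP[x0 xr]; apply: g1; rewrite ?(ltW x0)// (lt_trans xr).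
  - apply: derivable_within_continuous => x; rewrite in_itv/= => /andP[x0 xr].
    by have [] := dg x (le_lt_trans xr r1).
have g0 : g 0 <= 1.
  rewrite /g subr0 powR1 mul1r horner_bin_poly; case: n {g dg g1 gr} => [|n].
    by rewrite seriesEord /= big_ord0.
  rewrite seriesEord /= big_ord_recl big1 => [|i _]; last by rewrite /bin_coef exprS mul0r mulr0.
  by rewrite /bin_coef poch0 fact0 expr0 divr1 mulr1 addr0.
rewrite powRN -[leRHS]mul1r ler_pdivlMr ?powR_gt0 ?subr_gt0//.
by rewrite -horner_bin_poly mulrC (le_trans gr).
Qed.

Lemma is_cvg_bin_series c r : 0 < c -> 0 <= r < 1 -> cvgn (series (bin_coef c r)).
Proof.
move=> c0 /[dup] r01 /andP[r0 r1].
by case: (ge0_series_bounded_cvg (fun k => bin_coef_ge0 k c0 r0) (fun n => bin_series_bound n c0 r01)).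
Qed.

Lemma bin_series_le c r : 0 < c -> 0 <= r < 1 -> bin_series c r <= (1 - r) `^ (- c).
Proof.
move=> c0 /[dup] r01 /andP[r0 r1].
by case: (ge0_series_bounded_cvg (fun k => bin_coef_ge0 k c0 r0) (fun n => bin_series_bound n c0 r01)).
Qed.

Lemma bin_series_ge0 c r : 0 < c -> 0 <= r < 1 -> 0 <= bin_series c r.
Proof.
move=> c0 /[dup] r01 /andP[r0 r1].
apply: le_trans (ge0_series_le_lim 0 (fun k => bin_coef_ge0 k c0 r0) (is_cvg_bin_series c0 r01)).
by rewrite seriesEord /= big_ord0.
Qed.

Lemma bin_coefB c r n :
  bin_coef (c + 1) r n.+1 - r * bin_coef (c + 1) r n = bin_coef c r n.+1.
Proof.
rewrite /bin_coef pochSr [poch c n.+1]pochS factS natrM exprS -natr1.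
have h1 : (n`!)%:R != 0 :> R := factr_neq0 n; have h2 : n%:R + 1 != 0 :> R := natrS_neq0 n.
by field; rewrite h1 h2.
Qed.

Lemma bin_series_telescope c r n :
  (1 - r) * series (bin_coef (c + 1) r) n.+1 =
  series (bin_coef c r) n.+1 - r * bin_coef (c + 1) r n.
Proof.
elim: n => [|n IH].
  by rewrite !seriesEord /= !big_ord_recl !big_ord0 /bin_coef !poch0 fact0 expr0; ring.
by rewrite seriesSr [in RHS]seriesSr mulrDr IH -(bin_coefB c); ring.
Qed.

Lemma bin_seriesD1 c r : 0 < c -> 0 <= r < 1 -> bin_series (c + 1) r = bin_series c r / (1 - r).
Proof.
move=> c0 /[dup] r01 /andP[r0 r1].
have c1 : 0 < c + 1 by rewrite addr_gt0.
have r1' : 1 - r != 0 by rewrite gt_eqF// subr_gt0.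
apply: (mulfI r1'); rewrite mulrC mulrC [RHS]mulrC mulfVK//.
have h1 := is_cvg_bin_series c1 r01; have h0 := is_cvg_bin_series c0 r01.
have A : (fun n => (1 - r) * series (bin_coef (c + 1) r) n.+1) @ \oo --> (1 - r) * bin_series (c + 1) r.
  by apply: cvgMr; rewrite (cvg_shiftS (series (bin_coef (c + 1) r))).
have B : (fun n => series (bin_coef c r) n.+1 - r * bin_coef (c + 1) r n) @ \oo --> bin_series c r - r * 0.
  apply: cvgB; first by rewrite (cvg_shiftS (series (bin_coef c r))).
  by apply: cvgMr; exact: cvg_series_cvg_0.
rewrite mulr0 subr0 in B; apply: cvg_unique B => //.
have <- : (fun n => (1 - r) * series (bin_coef (c + 1) r) n.+1) =
  (fun n => series (bin_coef c r) n.+1 - r * bin_coef (c + 1) r n).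
  by apply/funext => n; rewrite bin_series_telescope.
exact: A.
Qed.

Lemma bin_seriesDn c r n : 0 < c -> 0 <= r < 1 ->
  bin_series (c + n%:R) r = bin_series c r / (1 - r) ^+ n.
Proof.
move=> c0 r01; elim: n => [|n IH]; first by rewrite addr0 expr0 divr1.
have r1 : 1 - r != 0 by move/andP: r01 => [_ r1]; rewrite gt_eqF// subr_gt0.
by rewrite -natr1 addrA bin_seriesD1// ?IH ?ltr_pwDl// exprSr invfM mulrA.
Qed.

End BinomialSeries.

(** * The generating function and the Hille-Hardy formula *)

Section LaguerreSeries.
Context {R : realType}.
Implicit Types (b r x y nu q : R).

Lemma triangular_sum (G : nat -> nat -> R) n :
  \sum_(l < n) \sum_(j < l.+1) G j (l - j)%N = \sum_(j < n) \sum_(i < n - j) G j i.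
Proof.
elim: n => [|n IH]; first by rewrite !big_ord0.
rewrite big_ord_recr /= IH [RHS]big_ord_recr /= subSn// subnn [X in _ = _ + X]big_ord_recl big_ord0 addr0.
rewrite [X in _ + X]big_ord_recr /= subnn addrA; congr (_ + _).
rewrite -big_split/=; apply: eq_bigr => j _.
by rewrite subSn ?(ltnW (ltn_ord j))// big_ord_recr.
Qed.

Definition lag_term b x r (l : nat) : R := (lagP b l.+1).[x] * r ^+ l.

(** The double sum is reordered by powers of x: the j-th power meets a binomial series of order b +
    1 + j truncated at n - j, which is the shape that [tannery] treats. *)
Lemma series_lag_term b x r n : series (lag_term b x r) n =
  \sum_(j < n) exp_coeff (- (x * r)) j * series (bin_coef (b + 1 + j%:R) r) (n - j)%N.
Proof.
pose G j i := exp_coeff (- (x * r)) j * bin_coef (b + 1 + j%:R) r i.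
transitivity (\sum_(l < n) \sum_(j < l.+1) G j (l - j)%N).
  rewrite seriesEord /=; apply: eq_bigr => l _.
  rewrite /lag_term horner_poly mulr_suml; apply: eq_bigr => j _.
  rewrite /lag_coef ltn_ord /= /G /exp_coeff /bin_coef /=.
  have -> : b + 1 + j%:R = b + j.+1%:R by rewrite -natr1; ring.
  have jl : (j <= l)%N by rewrite -ltnS ltn_ord.
  have -> : r ^+ l = r ^+ j * r ^+ (l - j) by rewrite -exprD subnKC.
  by rewrite [(- (x * r)) ^+ j]exprNn exprMn; ring.
rewrite triangular_sum; apply: eq_bigr => j _.
by rewrite seriesEord /= mulr_sumr.
Qed.

Lemma cvg_seriesMl k (u : R ^nat) : cvgn (series u) ->
  series (fun n => k * u n) @ \oo --> k * limn (series u).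
Proof.
move=> cu; have -> : series (fun n => k * u n) = (fun n => k * series u n).
  by apply/funext => n; rewrite !seriesEord /= mulr_sumr.
exact: cvgMr.
Qed.

(** The generating function of the Laguerre polynomials. The bound on the partial sums is the
    domination for the next passage to the limit, in [hille_hardy]. *)
Lemma cvg_lag_series b x r : -1 < b -> 0 <= r < 1 ->
  series (lag_term b x r) @ \oo --> bin_series (b + 1) r * expR (- (x * r / (1 - r))) /\
  forall n, `|series (lag_term b x r) n| <= bin_series (b + 1) r * expR (`|x| * r / (1 - r)).
Proof.
move=> b1 /[dup] r01 /andP[r0 r1].
have c0 : 0 < b + 1 by lra.
have cj0 j : 0 < b + 1 + j%:R by rewrite ltr_pwDl.
have q0 : 0 < 1 - r by rewrite subr_gt0.
pose B := bin_series (b + 1) r.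
have B0 : 0 <= B := bin_series_ge0 c0 r01.
have EL z j : exp_coeff z j * bin_series (b + 1 + j%:R) r = B * exp_coeff (z / (1 - r)) j.
  by rewrite bin_seriesDn// /exp_coeff /= exprMn exprVn -/B; ring.
have FM j k : `|exp_coeff (- (x * r)) j * series (bin_coef (b + 1 + j%:R) r) k| <=
    B * exp_coeff (`|x| * r / (1 - r)) j.
  rewrite -EL normrM; apply: ler_pM => //.
    by rewrite /exp_coeff /= normrM normrX normrN normrM (ger0_norm r0) normfV normr_nat.
  rewrite ger0_norm; last by rewrite seriesEord sumr_ge0// => i _; exact: bin_coef_ge0.
  by apply: ge0_series_le_lim; [move=> i; exact: bin_coef_ge0|exact: is_cvg_bin_series].
have cE z := cvg_seriesMl (k := B) (is_cvg_series_exp_coeff z).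
have cM : cvgn (series (fun j => B * exp_coeff (`|x| * r / (1 - r)) j)).
  by apply/cvg_ex; eexists; exact: cE.
have FL j : (fun k => exp_coeff (- (x * r)) j * series (bin_coef (b + 1 + j%:R) r) k) @ \oo -->
    B * exp_coeff (- (x * r / (1 - r))) j.
  by rewrite -[- (x * r / _)]mulNr -EL; apply: cvgMr; exact: is_cvg_bin_series.
split.
  have [_] := tannery FM cM FL; rewrite (cvg_lim _ (cE _))// -/expR.
  by under eq_fun do rewrite -series_lag_term.
move=> n; rewrite series_lag_term (le_trans (ler_norm_sum _ _ _))//.
apply: (@le_trans _ _ (series (fun j => B * exp_coeff (`|x| * r / (1 - r)) j) n)).
  by rewrite seriesEord; apply: ler_sum => j _; exact: FM.
rewrite -/B [leRHS](_ : _ = limn (series (fun j => B * exp_coeff (`|x| * r / (1 - r)) j))); last by rewrite (cvg_lim _ (cE _)).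
apply: ge0_series_le_lim => // k.
by rewrite mulr_ge0// exp_coeff_ge0// divr_ge0// ?(ltW q0)// mulr_ge0.
Qed.

(* [bessel nu (z ^+ 2 / 4)] is [Gamma(nu+1) (z/2)^(-nu) I_nu(z)]. *)
Definition bes_coef nu q (m : nat) : R := q ^+ m / ((m`!)%:R * poch (nu + 1) m).

Definition bessel nu q : R := limn (series (bes_coef nu q)).

Lemma bes_coef_ge0 nu q m : -1 < nu -> 0 <= q -> 0 <= bes_coef nu q m.
Proof.
move=> nu1 q0; rewrite /bes_coef divr_ge0 ?exprn_ge0// mulr_ge0// ltW// poch_gt0//; lra.
Qed.

Lemma is_cvg_bessel nu q : -1 < nu -> 0 <= q -> cvgn (series (bes_coef nu q)).
Proof.
move=> nu1 q0; have c0 : 0 < nu + 1 by lra.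
have q1 : 0 <= q / (nu + 1) by rewrite divr_ge0// ltW.
apply: (series_le_cvg _ _ _ (is_cvg_series_exp_coeff (q / (nu + 1)))) => n.
- exact: bes_coef_ge0.
- exact: exp_coeff_ge0.
rewrite /bes_coef /exp_coeff /= exprMn exprVn invfM mulrAC mulrA ler_wpM2l ?mulr_ge0 ?exprn_ge0//.
rewrite lef_pV2 ?posrE ?poch_gt0 ?exprn_gt0//.
have -> : (nu + 1) ^+ n = \prod_(i < n) (nu + 1) by rewrite prodr_const card_ord.
by apply: ler_prod => i _; rewrite (ltW c0)/= lerDl.
Qed.

Lemma bessel_ge0 nu q : -1 < nu -> 0 <= q -> 0 <= bessel nu q.
Proof.
move=> nu1 q0.
apply: le_trans (ge0_series_le_lim 0 _ (is_cvg_bessel nu1 q0)).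
  by rewrite seriesEord /= big_ord0.
by move=> k; exact: bes_coef_ge0.
Qed.

(** Bailey's formula lets the sum be grouped by m. The inner sums belong to generating functions of
    order nu + 2m, and their factors (1 - r)^(-2m) build the argument of the Bessel series. *)
Lemma hille_hardy nu r x y : -1 < nu -> 0 <= r < 1 -> 0 <= x -> 0 <= y ->
  (fun n => \sum_(k < n) r ^+ k * ((k`!)%:R / poch (nu + 1) k * (lagP nu k.+1).[x] * (lagP nu k.+1).[y]))
    @ \oo --> bin_series (nu + 1) r * expR (- ((x + y) * r / (1 - r))) *
              bessel nu (x * y * r / (1 - r) ^+ 2).
Proof.
move=> nu1 /[dup] r01 /andP[r0 r1] x0 y0.
pose c m := (x * y * r) ^+ m / ((m`!)%:R * poch (nu + 1) m).
pose G m i := c m * lag_term (nu + 2 * m%:R) (x + y) r i.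
have c0 : 0 < nu + 1 by lra.
have num m : -1 < nu + 2 * m%:R by apply: lt_le_trans nu1 _; rewrite lerDl.
have q0 : 0 < 1 - r by rewrite subr_gt0.
have cm0 m : 0 <= c m by rewrite divr_ge0 ?exprn_ge0 ?mulr_ge0// ltW// poch_gt0.
pose B := bin_series (nu + 1) r.
pose q := x * y * r / (1 - r) ^+ 2.
have BE m z : c m * (bin_series (nu + 2 * m%:R + 1) r * z) = B * z * bes_coef nu q m.
  have -> : nu + 2 * m%:R + 1 = nu + 1 + (2 * m)%:R by rewrite natrM; ring.
  by rewrite bin_seriesDn// /bes_coef /c /q [(x * y * r / _) ^+ m]exprMn -/B exprVn -exprM; ring.
have -> : (fun n => \sum_(k < n) r ^+ k * ((k`!)%:R / poch (nu + 1) k * (lagP nu k.+1).[x] * (lagP nu k.+1).[y]))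
  = (fun n => \sum_(m < n) c m * series (lag_term (nu + 2 * m%:R) (x + y) r) (n - m)%N).
  apply/funext => n; transitivity (\sum_(k < n) \sum_(m < k.+1) G m (k - m)%N); last first.
    by rewrite triangular_sum; apply: eq_bigr => m _; rewrite seriesEord /= mulr_sumr.
  apply: eq_bigr => k _; rewrite bailey// mulr_sumr; apply: eq_bigr => m _.
  have mk : (m <= k)%N by rewrite -ltnS ltn_ord.
  by rewrite subSn// /G /c /lag_term -{1}(subnKC mk) exprD [(x * y * r) ^+ m]exprMn; ring.
have q0' : 0 <= q by rewrite /q divr_ge0 ?exprn_ge0 ?mulr_ge0// ltW.
have cB z := cvg_seriesMl (k := z) (is_cvg_bessel nu1 q0').
set E := expR (- _).
have FM m k : `|c m * series (lag_term (nu + 2 * m%:R) (x + y) r) k| <=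
   B * expR (`|x + y| * r / (1 - r)) * bes_coef nu q m.
  by rewrite normrM ger0_norm// -BE ler_wpM2l//; have [_] := cvg_lag_series (x + y) (num m) r01; exact.
have FL m : (fun k => c m * series (lag_term (nu + 2 * m%:R) (x + y) r) k) @ \oo -->
   B * E * bes_coef nu q m.
  by rewrite -BE; apply: cvgMr; have [] := cvg_lag_series (x + y) (num m) r01.
have cM : cvgn (series (fun m => B * expR (`|x + y| * r / (1 - r)) * bes_coef nu q m)).
  by apply/cvg_ex; eexists; exact: cB.
by have [_] := tannery FM cM FL; rewrite (cvg_lim _ (cB _)).
Qed.

End LaguerreSeries.

(** * Estimates of the modified Bessel function *)

Section BesselBound.
Context {R : realType}.
Implicit Types (nu q z t : R).

Lemma weighted_amgm t (a b : R) : 0 <= t <= 1 -> 0 <= a -> 0 <= b ->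
  a `^ (1 - t) * b `^ t <= (1 - t) * a + t * b.
Proof.
move=> /andP[]; rewrite le_eqVlt => /predU1P[<- _|t0].
  by move=> a0 b0; rewrite subr0 powRr1// powRr0 mulr1 mul0r addr0 mul1r.
rewrite le_eqVlt => /predU1P[->|t1] a0 b0.
  by rewrite subrr powRr0 powRr1// !mul1r mul0r add0r.
have t1' : 0 < 1 - t by rewrite subr_gt0.
have := @conjugate_powR R (a `^ (1 - t)) (b `^ t) (1 - t)^-1 t^-1 (powR_ge0 _ _) (powR_ge0 _ _).
rewrite !invr_gt0 t0 t1' !invrK -!powRrM !mulfV ?gt_eqF// !powRr1// => H.
by rewrite [(1 - t) * a]mulrC [t * b]mulrC; apply: H => //; rewrite subrK.
Qed.

(** This concerns order n - 1/2: the denominators of the Bessel series are at least a multiple of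
    (2m + n)!, with equality and c = 1 for n = 0, so z^n times the series is dominated termwise by
    the exponential series. *)
Lemma half_poch n : exists2 c : R, 0 < c &
  forall m, c * ((2 * m + n)`!)%:R <= 4 ^+ m * (m`!)%:R * poch (n%:R + 2^-1) m.
Proof.
elim: n => [|n [c c0 IH]].
  exists 1 => // m; rewrite mul1r addn0 add0r; elim: m => [|m IH].
    by rewrite muln0 fact0 poch0 expr0 !mulr1.
  rewrite (_ : (2 * m.+1 = (2 * m).+2)%N); last by rewrite mulnS.
  rewrite !factS !natrM exprS pochSr.
  rewrite [leRHS](_ : _ = ((2 * m).+2)%:R * ((2 * m).+1%:R * (4 ^+ m * (m`!)%:R * poch 2^-1 m))).
    by rewrite !ler_wpM2l.
  by rewrite -!(natr1 (2 * m).+1) -!(natr1 (2 * m)) -(natr1 m) natrM; field.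
exists (c / (2 * n%:R + 1)); first by rewrite divr_gt0// ltr_pwDr// mulr_ge0.
move=> m; rewrite addnS factS natrM.
have E : poch (n.+1%:R + 2^-1) m = poch (n%:R + 2^-1) m * (n%:R + 2^-1 + m%:R) / (n%:R + 2^-1) :> R.
  rewrite -pochSr pochS -natr1 addrAC mulrAC mulfV ?mul1r// gt_eqF// ltr_pwDr.
rewrite E [leRHS](_ : _ = (4 ^+ m * (m`!)%:R * poch (n%:R + 2^-1) m) * ((2 * n%:R + 1 + 2 * m%:R) / (2 * n%:R + 1))); last first.
  by field; rewrite gt_eqF// ltr_pwDr// mulr_ge0.
rewrite [leLHS](_ : _ = (c * ((2 * m + n)`!)%:R) * (((2 * m + n).+1)%:R / (2 * n%:R + 1))); last first.
  by field; rewrite gt_eqF// ltr_pwDr// mulr_ge0.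
apply: ler_pM => //.
  by rewrite mulr_ge0// ltW.
apply: ler_wpM2r; first by rewrite invr_ge0 addr_ge0// mulr_ge0.
rewrite -natr1 natrD natrM; have := ler0n R n; lra.
Qed.

(** Factor by factor this is the weighted arithmetic-geometric inequality for a + i and a + 1 + i,
    whose weighted mean is a + t + i. *)
Lemma poch_interpolation (a t : R) m : 0 < a -> 0 <= t <= 1 ->
  poch a m `^ (1 - t) * poch (a + 1) m `^ t <= poch (a + t) m.
Proof.
move=> a0 t01; have /andP[t0 t1] := t01; elim: m => [|m IH].
  by rewrite !poch0 !powR1 mulr1.
have p0 := poch_gt0 m a0; have p1 : 0 < poch (a + 1) m by apply: poch_gt0; rewrite addr_gt0.
have am0 : 0 <= a + m%:R by rewrite addr_ge0// ltW.
have am1 : 0 <= a + 1 + m%:R by rewrite !addr_ge0// ltW.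
rewrite !pochSr !powRM ?(ltW p0) ?(ltW p1)//.
rewrite mulrACA; apply: ler_pM => //; rewrite ?mulr_ge0 ?powR_ge0//.
apply: le_trans (weighted_amgm t01 am0 am1) _.
by rewrite le_eqVlt; apply/orP; left; apply/eqP; ring.
Qed.

Lemma sum_exp_coeff_le z n N : 0 <= z -> \sum_(m < N) exp_coeff z (2 * m + n)%N <= expR z.
Proof.
move=> z0; apply: (@le_trans _ _ (series (exp_coeff z) (2 * N + n)%N)); last first.
  apply: ge0_series_le_lim; last exact: is_cvg_series_exp_coeff.
  by move=> k; exact: exp_coeff_ge0.
elim: N => [|N IH].
  by rewrite big_ord0 seriesEord sumr_ge0// => i _; exact: exp_coeff_ge0.
have -> : (2 * N.+1 + n = (2 * N + n).+2)%N by rewrite mulnS.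
  rewrite big_ord_recr /= !seriesSr -addrA; apply: lerD => //.
by rewrite lerDl exp_coeff_ge0.
Qed.

Lemma bessel_le_of_sum nu q (M : R) : -1 < nu -> 0 <= q ->
  (forall N, \sum_(m < N) bes_coef nu q m <= M) -> bessel nu q <= M.
Proof.
move=> nu1 q0 H.
have [] := @ge0_series_bounded_cvg R (bes_coef nu q) M => //.
  by move=> k; exact: bes_coef_ge0.
by move=> n; rewrite seriesEord; exact: H.
Qed.

(** Comparison with order -1/2, where the series is that of cosh z. There is no power of z on the
    left, as small z in [bessel_bound] requires. *)
Lemma bessel_le_exp nu : - 2^-1 <= nu -> exists2 C, 0 <= C &
  forall z, 0 < z -> bessel nu (z ^+ 2 / 4) <= C * expR z.
Proof.
move=> nu2; have [c c0 Hc] := half_poch 0.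
exists c^-1; first by rewrite invr_ge0 ltW.
move=> z z0; have z0' := ltW z0; apply: bessel_le_of_sum.
- lra.
- by rewrite divr_ge0// exprn_ge0.
move=> N; apply: le_trans (_ : c^-1 * \sum_(m < N) exp_coeff z (2 * m + 0)%N <= _); last first.
  by rewrite ler_wpM2l ?invr_ge0 ?(ltW c0)// sum_exp_coeff_le.
rewrite mulr_sumr; apply: ler_sum => m _; rewrite addn0.
have p0 : 0 < poch (2^-1 : R) m by rewrite poch_gt0.
have p1 : poch 2^-1 m <= poch (nu + 1) m.
  by apply: ler_prod => i _; apply/andP; split; [rewrite addr_ge0|rewrite lerD2r; lra].
have h := Hc m; rewrite addn0 add0r in h.
rewrite /bes_coef /exp_coeff /= exprMn -exprM exprVn.
rewrite -mulrA -invfM [leRHS]mulrCA -invfM ler_wpM2l ?exprn_ge0//.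
rewrite lef_pV2 ?posrE; last 2 first.
- by rewrite !mulr_gt0// ?exprn_gt0// ?ltr0n ?fact_gt0// (lt_le_trans p0).
- by rewrite mulr_gt0// ltr0n fact_gt0.
by apply: le_trans h _; rewrite -mulrA !ler_wpM2l// exprn_ge0.
Qed.

(* Orders in 1/2 + Z are compared with the exponential series; the orders in between follow from the log-concavity of the Pochhammer symbol in its first argument. *)
Lemma bessel_bound_large nu : - 2^-1 <= nu -> exists2 C, 0 <= C &
  forall z, 0 < z -> z `^ (nu + 2^-1) * bessel nu (z ^+ 2 / 4) <= C * expR z.
Proof.
(* So nu = n - 1/2 + t lies between the orders n - 1/2 and n + 1/2. *)
move=> nu2; pose n := Num.trunc (nu + 2^-1); pose t := nu + 2^-1 - n%:R.
have s0 : 0 <= nu + 2^-1 by lra.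
have /andP[tn1 tn2] := truncn_itv s0.
have t01 : 0 <= t <= 1 by move: tn1 tn2; rewrite -/n -(natr1 n) /t => tn1 tn2; apply/andP; split; lra.
have [c0 c00 H0] := half_poch n; have [c1 c10 H1] := half_poch n.+1.
have /andP[t0 t1] := t01; have t1' : 0 <= 1 - t by rewrite subr_ge0.
exists ((1 - t) / c0 + t / c1).
  by rewrite addr_ge0// divr_ge0// ltW.
move=> z z0; have z0' := ltW z0; rewrite mulrC -ler_pdivlMr ?powR_gt0//.
apply: bessel_le_of_sum.
- lra.
- by rewrite divr_ge0// exprn_ge0.
move=> N; rewrite ler_pdivlMr ?powR_gt0// mulr_suml mulrDl.
have q0 : 0 <= z ^+ 2 / 4 by rewrite divr_ge0// exprn_ge0.
apply: (@le_trans _ _ (\sum_(m < N) ((1 - t) / c0 * exp_coeff z (2 * m + n)%N + t / c1 * exp_coeff z (2 * m + n.+1)%N))); last first.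
  rewrite big_split -!mulr_sumr /= lerD// ler_wpM2l ?sum_exp_coeff_le//.
    by rewrite divr_ge0// ltW.
  by rewrite divr_ge0// ltW.
apply: ler_sum => m _.
have n0 : 0 < n%:R + 2^-1 :> R by rewrite ltr_pwDr.
pose P0 : R := poch (n%:R + 2^-1) m; pose P1 : R := poch (n%:R + 2^-1 + 1) m.
have P00 : 0 < P0 := poch_gt0 m n0.
have P10 : 0 < P1 by apply: poch_gt0; rewrite addr_gt0.
have E : nu + 1 = n%:R + 2^-1 + t by rewrite /t; lra.
have PI := poch_interpolation m n0 t01; rewrite -E -/P0 -/P1 in PI.
pose K : R := 4 ^+ m * (m`!)%:R.
have K0 : 0 < K by rewrite mulr_gt0// ?exprn_gt0// ltr0n fact_gt0.
(* The m-th terms of the comparison series at the two neighbouring orders, with their powers z^n and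
   z^(n+1). *)
pose A := z ^+ (2 * m + n) / (K * P0); pose B := z ^+ (2 * m + n.+1) / (K * P1).
have A0 : 0 <= A by rewrite divr_ge0 ?exprn_ge0// mulr_ge0// ltW.
have B0 : 0 <= B by rewrite divr_ge0 ?exprn_ge0// mulr_ge0// ltW.
have AB : bes_coef nu (z ^+ 2 / 4) m * z `^ (nu + 2^-1) <= A `^ (1 - t) * B `^ t.
  rewrite /A /B !powRM ?exprn_ge0 ?invr_ge0 ?mulr_ge0 ?(ltW K0) ?(ltW P00) ?(ltW P10)//.
  have -> : z `^ (nu + 2^-1) = z ^+ n * z `^ t.
    rewrite -powR_mulrn// -powRD; last by rewrite (gt_eqF z0) implybT.
    by congr (_ `^ _); rewrite /t; lra.
  have -> : (z ^+ (2 * m + n)) `^ (1 - t) * ((K * P0)^-1) `^ (1 - t) * ((z ^+ (2 * m + n.+1)) `^ t * ((K * P1)^-1) `^ t)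
     = z ^+ (2 * m) * (z ^+ n * z `^ t) * (K * (P0 `^ (1 - t) * P1 `^ t))^-1.
    have zz k : (z ^+ k) = z `^ k%:R by rewrite powR_mulrn.
    have iv (x s : R) : 0 < x -> x^-1 `^ s = (x `^ s)^-1.
      by move=> x0; rewrite -powR_inv1 ?(ltW x0)// -powRrM mulN1r powRN.
    rewrite !iv ?mulr_gt0// (powRM _ (ltW K0) (ltW P00)) (powRM _ (ltW K0) (ltW P10)).
    rewrite mulrACA -invfM.
    have -> : K `^ (1 - t) * P0 `^ (1 - t) * (K `^ t * P1 `^ t) = K * (P0 `^ (1 - t) * P1 `^ t).
      by rewrite mulrACA -powRD ?subrK ?powRr1 ?(ltW K0)// (gt_eqF K0) implybT.
    congr (_ / _); rewrite addnS exprS powRM// ?exprn_ge0// mulrCA -powRD; last first.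
      by rewrite (_ : z ^+ (2 * m + n) == 0 = false) ?implybT// gt_eqF// exprn_gt0.
    by rewrite subrK powRr1 ?exprn_ge0// exprD; ring.
  rewrite /bes_coef exprMn -exprM exprVn.
  rewrite (_ : z ^+ (2 * m) / 4 ^+ m / ((m`!)%:R * poch (nu + 1) m) * (z ^+ n * z `^ t) =
      z ^+ (2 * m) * (z ^+ n * z `^ t) / (K * poch (nu + 1) m)); last first.
    rewrite /K; field; rewrite factr_neq0 !gt_eqF ?exprn_gt0//; apply: lt_le_trans PI; rewrite mulr_gt0// powR_gt0//.
  apply: ler_wpM2l; first by rewrite !mulr_ge0 ?exprn_ge0 ?powR_ge0.
  have P01 : 0 < P0 `^ (1 - t) * P1 `^ t by rewrite mulr_gt0// powR_gt0.
  have PN := lt_le_trans P01 PI.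
  rewrite lef_pV2 ?posrE; [|exact: mulr_gt0..].
  by rewrite ler_wpM2l// ltW.
apply: (le_trans AB); apply: (le_trans (weighted_amgm t01 A0 B0)).
have AE : A <= c0^-1 * exp_coeff z (2 * m + n)%N.
  rewrite /A /exp_coeff /= mulrCA -invfM ler_wpM2l ?exprn_ge0// lef_pV2 ?posrE ?mulr_gt0// ?ltr0n ?fact_gt0//.
have BE : B <= c1^-1 * exp_coeff z (2 * m + n.+1)%N.
  rewrite /B /exp_coeff /= mulrCA -invfM ler_wpM2l ?exprn_ge0// lef_pV2 ?posrE ?mulr_gt0// ?ltr0n ?fact_gt0//.
  by have := H1 m; rewrite -(natr1 n) addrAC.
by rewrite -!mulrA lerD// ler_wpM2l.
Qed.

(** Classically I_nu = (2 (nu + 1) / z) I_(nu+1) + I_(nu+2); this reduces orders between -1 and -1/2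
    to orders above -1/2. *)
Lemma bes_coef_rec nu q m : -1 < nu ->
  bes_coef nu q m.+1 = bes_coef (nu + 1) q m.+1 + q / ((nu + 1) * (nu + 2)) * bes_coef (nu + 2) q m.
Proof.
move=> nu1; rewrite /bes_coef.
have -> : nu + 2 + 1 = nu + 1 + 1 + 1 by ring.
have p0 : poch (nu + 1 + 1) m != 0 by rewrite gt_eqF// poch_gt0//; lra.
have a0 : nu + 1 != 0 by rewrite gt_eqF//; lra.
have a1 : nu + 2 != 0 by rewrite gt_eqF//; lra.
have m0 := ler0n R m.
have a2 : nu + 1 + 1 + m%:R != 0 by rewrite gt_eqF//; lra.
have Q : poch (nu + 1 + 1 + 1) m = poch (nu + 1 + 1) m * (nu + 1 + 1 + m%:R) / (nu + 2).
  by rewrite -pochSr pochS (_ : nu + 1 + 1 = nu + 2) ?[_ / _]mulrAC ?mulfV ?mul1r//; ring.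
rewrite Q pochS pochSr factS natrM -natr1 exprS.
have h1 : (m`!)%:R != 0 :> R := factr_neq0 m; have h2 : m%:R + 1 != 0 :> R := natrS_neq0 m.
by field; rewrite h1 h2 a0 a1 a2 p0.
Qed.

Lemma bessel_rec_le nu q : -1 < nu -> 0 <= q ->
  bessel nu q <= bessel (nu + 1) q + q / ((nu + 1) * (nu + 2)) * bessel (nu + 2) q.
Proof.
move=> nu1 q0; have nu2 : -1 < nu + 1 by lra.
have nu3 : -1 < nu + 2 by lra.
have k0 : 0 <= q / ((nu + 1) * (nu + 2)) by rewrite divr_ge0// mulr_ge0//; lra.
have b0 n : 0 <= bes_coef nu q n by exact: bes_coef_ge0.
have le1 n : \sum_(m < n) bes_coef (nu + 1) q m <= bessel (nu + 1) q.
  have := ge0_series_le_lim n (fun k => bes_coef_ge0 k nu2 q0) (is_cvg_bessel nu2 q0).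
  by rewrite {1}seriesEord; apply.
have le2 n : \sum_(m < n) bes_coef (nu + 2) q m <= bessel (nu + 2) q.
  have := ge0_series_le_lim n (fun k => bes_coef_ge0 k nu3 q0) (is_cvg_bessel nu3 q0).
  by rewrite {1}seriesEord; apply.
apply: bessel_le_of_sum => // -[|N].
  by rewrite big_ord0 addr_ge0// ?(mulr_ge0 k0)// ?bessel_ge0.
rewrite big_ord_recl (eq_bigr (fun m : 'I_N => bes_coef (nu + 1) q m.+1 + q / ((nu + 1) * (nu + 2)) * bes_coef (nu + 2) q m)); last first.
  by move=> m _; rewrite -bes_coef_rec.
rewrite big_split /= -mulr_sumr addrA; apply: lerD; last by rewrite ler_wpM2l//; exact: le2.
have := le1 N.+1; rewrite big_ord_recl.
by rewrite /bes_coef /= !poch0.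
Qed.

(** Below -1/2 the power z^(nu + 1/2) is z^(-g), whence the factor (1 + 1/z)^g. The recursion leaves
    a term of order nu + 1, bounded without a power of z, and one of order nu + 2 that brings its
    own z^2. *)
Lemma bessel_bound nu : -1 < nu -> exists2 C, 0 <= C &
  forall z, 0 < z -> z `^ (nu + 2^-1) * bessel nu (z ^+ 2 / 4) <=
    C * (1 + z^-1) `^ gamma_nu nu * expR z.
Proof.
move=> nu1; rewrite /gamma_nu; case: ltP => [nu2|nu2]; last first.
  have [C C0 HC] := bessel_bound_large nu2; exists C => // z z0.
  by rewrite powRr0 mulr1 HC.
have nu3 : - 2^-1 <= nu + 1 by lra.
have nu4 : - 2^-1 <= nu + 2 by lra.
have [C1 C10 H1] := bessel_le_exp nu3; have [C2 C20 H2] := bessel_bound_large nu4.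
pose k := (4 * ((nu + 1) * (nu + 2)))^-1.
have k0 : 0 <= k by rewrite invr_ge0 !mulr_ge0//; lra.
exists (C1 + k * C2); first by rewrite addr_ge0// mulr_ge0.
move=> z z0; have z0' := ltW z0.
have q0 : 0 <= z ^+ 2 / 4 by rewrite divr_ge0// exprn_ge0.
have g0 : 0 <= - 2^-1 - nu by lra.
have zi : 0 < z^-1 by rewrite invr_gt0.
have z1 : 1 <= (1 + z^-1) `^ (- 2^-1 - nu).
  have := @ge0_ler_powR R _ g0 1 (1 + z^-1); rewrite powR1; apply; rewrite ?nnegrE ?lerDl ?addr_ge0 ?(ltW zi)//.
have zg : z `^ (nu + 2^-1) <= (1 + z^-1) `^ (- 2^-1 - nu).
  have -> : z `^ (nu + 2^-1) = z^-1 `^ (- 2^-1 - nu).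
    by rewrite -[z^-1]powR_inv1// -powRrM; congr (_ `^ _); ring.
  by rewrite ge0_ler_powR// ?nnegrE ?addr_ge0 ?(ltW zi)// lerDr.
apply: le_trans (_ : z `^ (nu + 2^-1) * (bessel (nu + 1) (z ^+ 2 / 4) + z ^+ 2 * k * bessel (nu + 2) (z ^+ 2 / 4)) <= _).
  rewrite ler_wpM2l ?powR_ge0//; apply: le_trans (bessel_rec_le nu1 q0) _.
  by rewrite lerD2l (_ : z ^+ 2 / 4 / ((nu + 1) * (nu + 2)) = z ^+ 2 * k)// /k -mulrA -invfM.
rewrite mulrDr !mulrDl; apply: lerD.
  rewrite [C1 * _]mulrC -[_ * C1 * _]mulrA; have h := H1 _ z0; have nu5 : -1 < nu + 1 by lra.
  by apply: ler_pM => //; rewrite ?powR_ge0// bessel_ge0.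
have -> : z `^ (nu + 2^-1) * (z ^+ 2 * k * bessel (nu + 2) (z ^+ 2 / 4)) =
   k * (z `^ (nu + 2 + 2^-1) * bessel (nu + 2) (z ^+ 2 / 4)).
  rewrite (_ : nu + 2 + 2^-1 = nu + 2^-1 + 2%:R); last by ring.
  by rewrite (@powRD _ z (nu + 2^-1) 2%:R) ?(gt_eqF z0) ?implybT// powR_mulrn//; ring.
apply: le_trans (ler_wpM2l k0 (H2 _ z0)) _.
by rewrite mulrA ler_wpM2r ?expR_ge0// ler_peMr// mulr_ge0.
Qed.

End BesselBound.

(** * The functional equation of the Gamma function *)

Section Gamma.
Context {R : realType}.
Local Notation mu := (@lebesgue_measure R).
Implicit Types (s a b : R).

Definition gamma_density s (t : R) : R := t `^ (s - 1) * expR (- t).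

Lemma measurable_gamma_density s (D : set R) : measurable D ->
  measurable_fun D (gamma_density s).
Proof.
move=> mD; apply: (measurable_funS measurableT) => //.
apply: measurable_funM; first exact: measurable_powR.
by apply: measurableT_comp.
Qed.

Lemma gamma_density_ge0 s t : 0 <= gamma_density s t.
Proof. by rewrite mulr_ge0 ?powR_ge0 ?expR_ge0. Qed.

Lemma derivable_continuous_at (f : R -> R) (x df : R) : is_derive x 1 f df -> {for x, continuous f}.
Proof. by move=> [df1 _]; apply/differentiable_continuous/derivable1_diffP. Qed.

Lemma derivable_oo_LRcontinuous_pos (f df : R -> R) a b : 0 < a -> a < b ->
  (forall x : R, 0 < x -> is_derive x 1 f (df x)) -> derivable_oo_LRcontinuous f a b.
Proof.
move=> a0 ab fd; split.
- by move=> x; rewrite in_itv/= => /andP[ax _]; have [] := fd x (lt_trans a0 ax).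
- by apply: cvg_at_right_filter; exact: derivable_continuous_at (fd _ a0).
- by apply: cvg_at_left_filter; exact: derivable_continuous_at (fd _ (lt_trans a0 ab)).
Qed.

(** The interval stays away from 0, where the density is unbounded for s < 1; [GammaD1] lets it
    exhaust the half line. *)
Lemma gamma_parts s a b : 0 < s -> 0 < a -> a < b ->
  (\int[mu]_(t in `[a, b]) (gamma_density (s + 1) t)%:E =
   (a `^ s * expR (- a) - b `^ s * expR (- b))%:E +
   s%:E * \int[mu]_(t in `[a, b]) (gamma_density s t)%:E)%E.
Proof.
move=> s0 a0 ab.
pose F (t : R) := t `^ s; pose f (t : R) := s * t `^ (s - 1).
pose G (t : R) := - expR (- t); pose g (t : R) := expR (- t).
have dF (x : R) : 0 < x -> is_derive x 1 F (f x) by move=> x0; exact: is_derive1_powR.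
have dg (x : R) : is_derive x 1 g (- expR (- x)).
  by rewrite -mulrN1; apply: (@is_derive1_comp R expR -%R x _ (-1)).
have dG (x : R) : is_derive x 1 G (g x).
  by rewrite /g -[expR (- x)]opprK; apply: is_deriveN.
have cf : {within `[a, b], continuous f}.
  apply: continuous_in_subspaceT => x; rewrite inE/= in_itv/= => /andP[ax _].
  apply: cvgM; first exact: cvg_cst.
  exact: derivable_continuous_at (is_derive1_powR (s - 1) (lt_le_trans a0 ax)).
have cg : {within `[a, b], continuous g}.
  by apply: continuous_subspaceT => x; exact: derivable_continuous_at (dg x).
have poso (x : R) : x \in `]a, b[ -> 0 < x.
  by rewrite in_itv/= => /andP[ax _]; exact: lt_trans ax.
have Ff : {in `]a, b[, (F^`())%classic =1 f}.
  by move=> x xab; rewrite derive1E; have [_ ->] := dF x (poso x xab).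
have Gg : {in `]a, b[, (G^`())%classic =1 g}.
  by move=> x _; rewrite derive1E; have [_ ->] := dG x.
have := @integration_by_parts R F G f g a b ab cf (derivable_oo_LRcontinuous_pos a0 ab dF) Ff cg
  (derivable_oo_LRcontinuous_pos a0 ab (fun x _ => dG x)) Gg.
have -> : (\int[mu]_(x in `[a, b]) (F x * g x)%:E = \int[mu]_(t in `[a, b]) (gamma_density (s + 1) t)%:E)%E.
  by apply: eq_integral => x _; rewrite /gamma_density addrK.
move=> ->; congr (_ + _)%E.
  by rewrite /F /G !mulrN opprK addrC.
rewrite -ge0_integralZl//; last 3 first.
- by apply/measurable_EFinP; exact: measurable_gamma_density.
- by move=> x _; rewrite lee_fin gamma_density_ge0.
- by rewrite lee_fin ltW.
have -> : (fun x => (f x * G x)%:E)%E = (fun x => - (s * gamma_density s x)%:E)%E.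
  by apply/funext => x; rewrite /f /G /gamma_density mulrN -mulrA EFinN.
rewrite integral_ge0N ?oppeK//.
by move=> x _; rewrite lee_fin mulr_ge0 ?(ltW s0)// gamma_density_ge0.
Qed.

Lemma cvg_powR_expR0 s : 0 < s ->
  ((n.+2%:R `^ s * expR (- n.+2%:R) : R) @[n --> \oo] --> 0) /\
  ((n.+2%:R^-1 `^ s * expR (- n.+2%:R^-1) : R) @[n --> \oo] --> 0).
Proof.
move=> s0; have h : (fun n => n.+2%:R^-1 : R) @ \oo --> 0.
  by rewrite (cvg_shiftS (@harmonic R)); exact: cvg_harmonic.
split.
  pose k := (Num.trunc s).+1.
  have sk : s <= k%:R by have /andP[_ /ltW] := truncn_itv (ltW s0).
  apply: (@squeeze_cvgr _ _ _ _ (fun=> 0) (fun n => (k.+1`!)%:R * n.+2%:R^-1)); last 2 first.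
  - exact: cvg_cst.
  - by rewrite -[X in _ --> X](mulr0 (k.+1`!)%:R); apply: cvgMr.
  near=> n; rewrite mulr_ge0 ?powR_ge0 ?expR_ge0//= expRN ler_pdivrMr ?expR_gt0//.
  have b1 : 1 <= n.+2%:R :> R by rewrite ler1n.
  apply: le_trans (ler_powR b1 sk) _; rewrite powR_mulrn//.
  have := @expR_ge1Dxn R n.+2%:R k (ler0n _ _) => e1.
  have e2 : n.+2%:R ^+ k.+1 / k.+1`!%:R <= expR n.+2%:R :> R by apply: le_trans e1; rewrite lerDr.
  rewrite -(ler_pM2l (_ : 0 < (k.+1`!)%:R^-1 * n.+2%:R)); last by rewrite mulr_gt0// invr_gt0 ltr0n fact_gt0.
  rewrite [leRHS](_ : _ = expR n.+2%:R); last first.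
    have h1 : (k.+1`!)%:R != 0 :> R by rewrite pnatr_eq0 -lt0n fact_gt0.
    by move: b1; set b := n.+2%:R => b1; field; rewrite h1 gt_eqF// (lt_le_trans _ b1).
  by rewrite -mulrA -exprS mulrC.
apply: (@squeeze_cvgr _ _ _ _ (fun=> 0) (fun n => n.+2%:R^-1 `^ s)); last 2 first.
- exact: cvg_cst.
- by apply: ((cvg_at_rightP (fun x : R => x `^ s) 0 0).1 (powR_cvg0 s0)); split.
near=> n; by rewrite mulr_ge0 ?powR_ge0 ?expR_ge0//= ler_piMr ?powR_ge0// expR_le1 oppr_le0.
Unshelve. all: by end_near. Qed.

Lemma GammaD1 s : 0 < s -> Gamma (s + 1) = s * Gamma s.
Proof.
move=> s0.
pose a n : R := n.+2%:R^-1; pose b n : R := n.+2%:R.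
have a0 n : 0 < a n by rewrite invr_gt0.
have ab n : a n < b n.
  rewrite /a /b (@lt_trans _ _ 1)// ?ltr1n// invf_lt1// ltr1n//.
pose A n := `[a n, b n]%classic.
have ndA : nondecreasing_seq A.
  apply/nondecreasing_seqP => n; rewrite subsetEset; apply: subset_itv; rewrite bnd_simp.
    by rewrite /a lef_pV2 ?posrE// ler_nat.
  by rewrite /b ler_nat.
have UA : \bigcup_n A n = Rplus.
  apply/seteqP; split => x.
    by move=> [n _]; rewrite /A /Rplus /= !in_itv/= andbT => /andP[ax _]; exact: lt_le_trans ax.
  rewrite /Rplus /= in_itv/= andbT => x0.
  exists (Num.trunc x + Num.trunc x^-1)%N => //; rewrite /A /= in_itv/=; apply/andP; split.
    rewrite /a -[leRHS]invrK lef_pV2 ?posrE ?invr_gt0//.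
    have xi : 0 <= x^-1 by rewrite invr_ge0 ltW.
    have /andP[_ h] := truncn_itv xi.
    apply: le_trans (ltW h) _; rewrite ler_nat; lia.
  have /andP[_ h] := truncn_itv (ltW x0).
  apply: le_trans (ltW h) _; rewrite ler_nat; lia.
have cG u : (\int[mu]_(t in A n) (gamma_density u t)%:E)%E @[n --> \oo] -->
   (\int[mu]_(t in Rplus) (gamma_density u t)%:E)%E.
  rewrite -UA; apply: ge0_nondecreasing_set_cvg_integral => //.
  - by move=> i; exact: measurable_itv.
  - by move=> i; apply/measurable_EFinP; apply: measurable_gamma_density; exact: measurable_itv.
  - by move=> i x _; rewrite lee_fin gamma_density_ge0.
have L0 : (a n `^ s * expR (- a n) - b n `^ s * expR (- b n)) @[n --> \oo] --> (0 : R).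
  by rewrite -(subr0 0); apply: cvgB; have [] := cvg_powR_expR0 s0.
have := cG (s + 1).
under eq_fun do rewrite (gamma_parts s0 (a0 _) (ab _)).
move=> H.
have H2 : ((a n `^ s * expR (- a n) - b n `^ s * expR (- b n))%:E + s%:E * \int[mu]_(t in A n) (gamma_density s t)%:E)%E @[n --> \oo] -->
  (0%:E + s%:E * \int[mu]_(t in Rplus) (gamma_density s t)%:E)%E.
  apply: cvgeD; first by [].
    by apply: cvg_EFin; [near=> n|].
  by apply: cvgeZl.
have E := cvg_unique (@ereal_hausdorff R) H H2.
rewrite /Gamma -[X in fine X = _]/(\int[mu]_(t in Rplus) (gamma_density (s + 1) t)%:E)%E.
rewrite -[X in _ = _ * fine X]/(\int[mu]_(t in Rplus) (gamma_density s t)%:E)%E.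
rewrite E add0e; set I := (\int[mu]_(_ in _) _)%E.
have : (0 <= I)%E by apply: integral_ge0 => x _; rewrite lee_fin gamma_density_ge0.
(* If the integral is infinite, [fine] makes both sides 0. *)
case: I => [r _||]//=.
by rewrite gt0_muley ?lte_fin//= mulr0.
Unshelve. all: by end_near. Qed.

Lemma Gamma_ge0 s : 0 <= Gamma s.
Proof. by apply: fine_ge0; apply: integral_ge0 => x _; rewrite lee_fin gamma_density_ge0. Qed.

Lemma GammaDn s n : 0 < s -> Gamma (s + n%:R) = poch s n * Gamma s.
Proof.
move=> s0; elim: n => [|n IH]; first by rewrite addr0 poch0 mul1r.
by rewrite -natr1 addrA (GammaD1 (ltr_pwDl s0 (ler0n R n))) IH pochSr mulrA (mulrC (s + _)).
Qed.

End Gamma.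

(** * Comparison of integrals *)

Section IntegralBounds.
Context d (T : measurableType d) (R : realType) (m : {measure set T -> \bar R}).
Local Open Scope ereal_scope.

(* Measurability of the integrands is not needed because the integral of a nonnegative function is a supremum over the simple functions below it. *)
Lemma ge0_le_integral_nomeas (D : set T) (f g : T -> \bar R) :
  (forall x, D x -> 0 <= f x) -> (forall x, D x -> f x <= g x) ->
  \int[m]_(x in D) f x <= \int[m]_(x in D) g x.
Proof.
move=> f0 fg; have g0 x : D x -> 0 <= g x by move=> Dx; apply: le_trans (fg x Dx); exact: f0.
rewrite !ge0_integralE//; apply: ereal_sup_le => _ [h /= hf <-]; exists h => //= x; apply: le_trans (hf x) _; rewrite /patch; case: ifPn => //.
by rewrite inE => /fg.
Qed.

(** The integrals of the positive and negative parts both lie between 0 and that of [g], hence so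
    does the absolute value of their difference. *)
Lemma le_abse_integral_nomeas (D : set T) (f g : T -> \bar R) :
  (forall x, D x -> `|f x| <= g x) ->
  `| \int[m]_(x in D) f x | <= \int[m]_(x in D) g x.
Proof.
move=> fg; rewrite integralE.
have A : \int[m]_(x in D) (f^\+ x) <= \int[m]_(x in D) g x.
  apply: ge0_le_integral_nomeas => // x Dx; apply: le_trans (fg x Dx).
  by rewrite funeposE ge_max abse_ge0 andbT lee_abs.
have B : \int[m]_(x in D) (f^\- x) <= \int[m]_(x in D) g x.
  apply: ge0_le_integral_nomeas => // x Dx; apply: le_trans (fg x Dx).
  by rewrite funenegE ge_max abse_ge0 andbT -abseN lee_abs.
move: A B.
have : 0 <= \int[m]_(x in D) (f^\+ x) by apply: integral_ge0.
have : 0 <= \int[m]_(x in D) (f^\- x) by apply: integral_ge0.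
move: (integral _ _ f^\+) (integral _ _ f^\-) (integral _ _ g) => [a||] [b||] [c||]//=.
- rewrite !lee_fin => b0 a0 ac bc; rewrite ler_norml; apply/andP; split; lra.
- by move=> _ _ _ _; rewrite leey.
Qed.

End IntegralBounds.

(** * Maximal inequalities for a family with bounded overlap *)

Section MaximalFunction.
Context d (T : measurableType d) (R : realType) (m : {measure set T -> \bar R}).
Variables (D : set T) (mD : measurable D) (I : nat -> set T).
Hypothesis mI : forall i, measurable (I i).
Hypothesis cover : forall s : seq nat, exists s' : seq nat,
  [/\ {subset s' <= s}, (forall x, has (fun i => x \in I i) s = has (fun i => x \in I i) s') &
      forall x, (count (fun i => x \in I i) s' <= 2)%N].

Local Notation E g := (\int[m]_(x in D) (g x)%:E)%E.
Implicit Types (f g h rho : T -> R) (s : seq nat) (al : nat -> R).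

Lemma E_ge0 f : (forall x, D x -> 0 <= f x) -> (0 <= E f)%E.
Proof. by move=> f0; apply: integral_ge0 => x Dx; rewrite lee_fin f0. Qed.

Lemma E_le f g : (forall x, D x -> 0 <= f x) -> (forall x, D x -> f x <= g x) -> (E f <= E g)%E.
Proof. by move=> f0 fg; apply: ge0_le_integral_nomeas => x Dx; rewrite lee_fin ?f0 ?fg. Qed.

Lemma E_eq f g : (forall x, D x -> f x = g x) -> E f = E g.
Proof. by move=> fg; apply: eq_integral => x /set_mem Dx; rewrite fg. Qed.

Lemma E_add f g : measurable_fun D f -> measurable_fun D g ->
  (forall x, D x -> 0 <= f x) -> (forall x, D x -> 0 <= g x) ->
  E (fun x => f x + g x) = (E f + E g)%E.
Proof.
move=> mf mg f0 g0; under eq_integral do rewrite EFinD.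
by rewrite ge0_integralD//; exact/measurable_EFinP.
Qed.

Lemma E_scale c f : measurable_fun D f -> (forall x, D x -> 0 <= f x) -> 0 <= c ->
  E (fun x => c * f x) = (c%:E * E f)%E.
Proof.
move=> mf f0 c0; under eq_integral do rewrite EFinM.
by rewrite ge0_integralZl//; exact/measurable_EFinP.
Qed.

Lemma E_sum s (F : nat -> T -> R) : (forall i, measurable_fun D (F i)) ->
  (forall i x, D x -> 0 <= F i x) ->
  E (fun x => \sum_(i <- s) F i x) = (\sum_(i <- s) E (F i))%E.
Proof.
move=> mF F0; elim: s => [|i s IH].
  by rewrite big_nil -[RHS](integral0 m D); apply: E_eq => x _; rewrite big_nil.
rewrite big_cons -IH -E_add//.
- by apply: E_eq => x _; rewrite big_cons.
- by apply: measurable_sum.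
- exact: F0.
- by move=> x Dx; apply: sumr_ge0 => j _; exact: F0.
Qed.

Definition ind i x : R := (x \in I i)%:R.

Definition indU s x : R := (has (fun i => x \in I i) s)%:R.

(** The maximal function of a finite subfamily, the numbers [al i] standing for averages; it is 0
    off the sets. *)
Definition maxf al s x : R := \big[Num.max/0]_(i <- s) (al i * ind i x).

Lemma ind_ge0 i x : 0 <= ind i x. Proof. exact: ler0n. Qed.

Lemma indU_ge0 s x : 0 <= indU s x. Proof. exact: ler0n. Qed.

Lemma measurable_ind i : measurable_fun D (ind i).
Proof.
have -> : ind i = \1_(I i) by apply/funext => x; rewrite indicE.
exact: measurable_indic.
Qed.

Lemma measurable_maxf al s : measurable_fun D (maxf al s).
Proof.
elim: s => [|i s IH].
  by rewrite (_ : maxf al [::] = cst 0)//; apply/funext => x; rewrite /maxf big_nil.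
rewrite (_ : maxf al (i :: s) = (fun x => Num.max (al i * ind i x) (maxf al s x))); last first.
  by apply/funext => x; rewrite /maxf big_cons.
apply: measurable_maxr => //; apply: measurable_funM => //; exact: measurable_ind.
Qed.

Lemma indU_cons i s x : indU (i :: s) x = Num.max (ind i x) (indU s x).
Proof.
rewrite /indU /ind /=; case: (x \in I i); case: has => /=; rewrite ?maxxx//.
  by rewrite max_l.
by rewrite max_r.
Qed.

Lemma measurable_indU s : measurable_fun D (indU s).
Proof.
elim: s => [|i s IH]; first exact: measurable_cst.
rewrite (_ : indU (i :: s) = (fun x => Num.max (ind i x) (indU s x))); last first.
  by apply/funext => x; exact: indU_cons.
by apply: measurable_maxr => //; exact: measurable_ind.
Qed.

Lemma measurable_powR_comp f q : measurable_fun D f -> measurable_fun D (fun x => f x `^ q).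
Proof. by move=> mf; have := measurableT_comp (measurable_powR q) mf. Qed.

Lemma maxf_cons al i s x : maxf al (i :: s) x = Num.max (al i * ind i x) (maxf al s x).
Proof. by rewrite /maxf big_cons. Qed.

Lemma maxf_ge0 al s x : 0 <= maxf al s x.
Proof.
elim: s => [|i s IH]; first by rewrite /maxf big_nil.
by rewrite maxf_cons le_max IH orbT.
Qed.

Lemma le_maxf al s i x : i \in s -> x \in I i -> al i <= maxf al s x.
Proof.
elim: s => [//|j s IH]; rewrite in_cons => /predU1P[->|js] xi; rewrite maxf_cons le_max.
  by rewrite /ind xi mulr1 lexx.
by rewrite IH// orbT.
Qed.

Lemma maxf_le al s x M : 0 <= M -> (forall i, i \in s -> x \in I i -> al i <= M) -> maxf al s x <= M.
Proof.
move=> M0; elim: s => [|j s IH] H; first by rewrite /maxf big_nil.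
rewrite maxf_cons ge_max IH ?andbT; last by move=> i si; apply: H; rewrite in_cons si orbT.
rewrite /ind; case: (boolP (x \in I j)) => xj; rewrite ?mulr0// mulr1.
by apply: H => //; rewrite mem_head.
Qed.

Lemma maxf_eq0 al s x : has (fun i => x \in I i) s = false -> maxf al s x = 0.
Proof.
move=> h; apply/eqP; rewrite eq_le maxf_ge0 andbT; apply: maxf_le => // i si xi.
by move/negbT/hasPn : h => /(_ i si); rewrite xi.
Qed.

(** The subfamily from [cover] meets each point of the union at least once, which bounds the left
    side, and at most twice, which gives the constant 2. *)
Lemma weak_type rho h al s a : measurable_fun D rho -> measurable_fun D h ->
  (forall x, D x -> 0 <= rho x) -> (forall x, D x -> 0 <= h x) -> 0 <= a ->
  (forall i, i \in s -> a <= al i) ->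
  (forall i, i \in s -> ((al i)%:E * E (fun x => ind i x * rho x) <= E (fun x => ind i x * h x))%E) ->
  (a%:E * E (fun x => (indU s x * rho x)%R) <= 2%:E * E (fun x => (indU s x * h x)%R))%E.
Proof.
move=> mrho mh rho0 h0 a0 aal H; have [s' [ss' Us cs']] := cover s.
have mind g i : measurable_fun D g -> measurable_fun D (fun x => ind i x * g x).
  by move=> mg; apply: measurable_funM => //; exact: measurable_ind.
have mindU g : measurable_fun D g -> measurable_fun D (fun x => indU s x * g x).
  by move=> mg; apply: measurable_funM => //; exact: measurable_indU.
apply: (@le_trans _ _ (a%:E * \sum_(i <- s') E (fun x => (ind i x * rho x)%R))%E).
  rewrite lee_wpmul2l ?lee_fin// -E_sum; last 2 first.
  - by move=> i; exact: mind.
  - by move=> i x Dx; rewrite mulr_ge0 ?ind_ge0 ?rho0.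
  apply: E_le => x Dx; first by rewrite mulr_ge0 ?indU_ge0 ?rho0.
  rewrite -mulr_suml ler_wpM2r ?rho0// /indU Us; case: hasP => [[i si xi]|_].
    rewrite (big_rem i)//= /ind xi lerDl; apply: sumr_ge0 => j _; exact: ler0n.
  by apply: sumr_ge0 => j _; exact: ler0n.
apply: (@le_trans _ _ (\sum_(i <- s') E (fun x => (ind i x * h x)%R))%E).
  rewrite ge0_sume_distrr; last by move=> i _; apply: E_ge0 => x Dx; rewrite mulr_ge0 ?ind_ge0 ?rho0.
  rewrite big_seq [leRHS]big_seq; apply: lee_sum => i /ss' si; apply: le_trans (H i si).
  apply: lee_wpmul2r; last by rewrite lee_fin aal.
  by apply: E_ge0 => x Dx; rewrite mulr_ge0 ?ind_ge0 ?rho0.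
rewrite -E_sum; last 2 first.
- by move=> i; exact: mind.
- by move=> i x Dx; rewrite mulr_ge0 ?ind_ge0 ?h0.
rewrite -E_scale//; last 2 first.
- exact: mindU.
- by move=> x Dx; rewrite mulr_ge0 ?indU_ge0 ?h0.
apply: E_le => x Dx; first by apply: sumr_ge0 => i _; rewrite mulr_ge0 ?ind_ge0 ?h0.
rewrite -mulr_suml mulrA ler_wpM2r ?h0//.
have -> : \sum_(i <- s') ind i x = (count (fun i => x \in I i) s')%:R.
  by rewrite -sum1_count natr_sum [in RHS]big_mkcond; apply: eq_bigr => i _; rewrite /ind; case: (x \in I i).
rewrite /indU Us; have := cs' x; rewrite has_count; case: (count _ s') => [|n] n2 /=.
  by rewrite mulr0.
by rewrite mulr1 ler_nat.
Qed.

(** A discrete form of d(u^q) = (q/(q-1)) u d(u^(q-1)), with u taken at the upper end; it comes from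
    Young's inequality for y^(q-1) x. *)
Lemma powRB_le (q x y : R) : 1 < q -> 0 <= y -> y <= x ->
  x `^ q - y `^ q <= q / (q - 1) * (x * (x `^ (q - 1) - y `^ (q - 1))).
Proof.
move=> q1 y0 yx; have x0 : 0 <= x := le_trans y0 yx.
have q0 : 0 < q by lra. have q10 : 0 < q - 1 by lra.
have xq := mulr_powRB1 x0 q0.
have := @conjugate_powR R (y `^ (q - 1)) x (q / (q - 1)) q (powR_ge0 _ _) x0.
rewrite divr_gt0// -powRrM mulrCA mulfV ?gt_eqF// mulr1 => /(_ isT q0) H.
have : y `^ (q - 1) * x <= y `^ q / (q / (q - 1)) + x `^ q / q.
  by apply: H; field; rewrite !gt_eqF.
rewrite mulrBr xq => H2.
have : (q / (q - 1)) * (y `^ (q - 1) * x) <= (q / (q - 1)) * (y `^ q / (q / (q - 1)) + x `^ q / q).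
  by rewrite ler_wpM2l// divr_ge0// ltW.
rewrite (_ : _ * (_ + _) = y `^ q + x `^ q / (q - 1)); last by field; rewrite !gt_eqF.
rewrite (_ : _ * (x `^ q - _) = x `^ q + x `^ q / (q - 1) - q / (q - 1) * (y `^ (q - 1) * x)); first by lra.
by field; rewrite gt_eqF.
Qed.

(** The part of the q-th power above level [a]; the level rises as the smallest coefficients are
    removed. *)
Definition excess al s (q a : R) x : R := (maxf al s x `^ q - a `^ q) * indU s x.

(** The smallest coefficient [al i] matters only at points that no other set contains. *)
Lemma excess_cons al i s q a x : 0 <= al i -> (forall j, j \in s -> al i <= al j) ->
  excess al (i :: s) q a x = excess al s q (al i) x + (al i `^ q - a `^ q) * indU (i :: s) x.
Proof.
move=> i0 ij; rewrite /excess maxf_cons /indU /=.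
case: (boolP (has _ s)) => [/hasP[j js xj]|hs].
  rewrite orbT !mulr1 max_r ?addrNK ?subrK//; first by ring.
  apply: (@le_trans _ _ (al i)).
    by rewrite /ind; case: (_ \in _); rewrite ?mulr1// mulr0.
  by apply: le_trans (ij _ js) _; exact: le_maxf.
rewrite orbF mulr0 add0r maxf_eq0; last exact: negbTE.
rewrite /ind; case: (_ \in _); rewrite ?mulr0// !mulr1.
by rewrite max_l.
Qed.

Lemma excess_ge0 al s q a x : 0 <= q -> 0 <= a -> (forall j, j \in s -> a <= al j) ->
  0 <= excess al s q a x.
Proof.
move=> q0 a0 aj; rewrite /excess /indU; case: hasP => [[j js xj]|_]; last by rewrite mulr0.
rewrite mulr1 subr_ge0 ge0_ler_powR// ?nnegrE ?maxf_ge0//.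
by apply: le_trans (aj _ js) _; exact: le_maxf.
Qed.

Lemma measurable_excess al s q a : measurable_fun D (excess al s q a).
Proof.
apply: measurable_funM; last exact: measurable_indU.
by apply: measurable_funB => //; exact/measurable_powR_comp/measurable_maxf.
Qed.

(* Layer cake: when [s] is sorted by [al], removing its head changes [excess] by a multiple of the indicator of the union, to which the weak type bound applies. *)
Lemma excess_bound rho h al q s a : measurable_fun D rho -> measurable_fun D h ->
  (forall x, D x -> 0 <= rho x) -> (forall x, D x -> 0 <= h x) -> 1 < q -> 0 <= a ->
  sorted (fun i j => al i <= al j) s ->
  (forall i, i \in s -> a <= al i) ->
  (forall i, i \in s -> ((al i)%:E * E (fun x => ind i x * rho x) <= E (fun x => ind i x * h x))%E) ->
  (E (fun x => (excess al s q a x * rho x)%R) <=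
   (2 * (q / (q - 1)))%:E * E (fun x => (excess al s (q - 1) a x * h x)%R))%E.
Proof.
move=> mrho mh rho0 h0 q1; have q10 : 0 <= q - 1 by lra.
have q0 : 0 <= q by lra.
have k0 : 0 <= 2 * (q / (q - 1)) by rewrite mulr_ge0// divr_ge0.
have mM g k s' b : measurable_fun D g -> measurable_fun D (fun x => excess al s' k b x * g x).
  by move=> mg; apply: measurable_funM => //; exact: measurable_excess.
have mU g s' : measurable_fun D g -> measurable_fun D (fun x => indU s' x * g x).
  by move=> mg; apply: measurable_funM => //; exact: measurable_indU.
elim: s a => [|i s IH] a a0 ss aal H.
  rewrite -E_scale//; last 2 first.
  - exact: mM.
  - by move=> x Dx; rewrite mulr_ge0 ?h0// excess_ge0.
  by apply: E_le => x Dx; rewrite /excess /indU /= !mulr0 !mul0r ?mulr0.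
have ai : a <= al i by apply: aal; rewrite mem_head.
have i0 : 0 <= al i := le_trans a0 ai.
have ij j : j \in s -> al i <= al j.
  move: ss; rewrite /= path_sortedE; last by move=> u v w; exact: le_trans.
  by move=> /andP[/allP + _]; apply.
have ss' : sorted (fun i j => al i <= al j) s by move: ss => /path_sorted.
have Hs j : j \in s -> ((al j)%:E * E (fun x => ind j x * rho x) <= E (fun x => ind j x * h x))%E.
  by move=> js; apply: H; rewrite in_cons js orbT.
have {Hs}IH := IH _ i0 ss' ij Hs.
have dec k g x : excess al (i :: s) k a x * g x =
    excess al s k (al i) x * g x + (al i `^ k - a `^ k) * (indU (i :: s) x * g x).
  by rewrite excess_cons// mulrDl mulrA.
have d0 k : 0 <= k -> 0 <= al i `^ k - a `^ k.
  by move=> k0'; rewrite subr_ge0 ge0_ler_powR// nnegrE.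
rewrite (E_eq (fun x _ => dec q rho x)) (E_eq (fun x _ => dec (q - 1) h x)).
have split k g : 0 <= k -> measurable_fun D g -> (forall x, D x -> 0 <= g x) ->
   E (fun x => excess al s k (al i) x * g x + (al i `^ k - a `^ k) * (indU (i :: s) x * g x)) =
   (E (fun x => (excess al s k (al i) x * g x)%R) + (al i `^ k - a `^ k)%:E * E (fun x => (indU (i :: s) x * g x)%R))%E.
  move=> k0' mg g0; rewrite E_add; last 4 first.
  - exact: mM.
  - by apply: measurable_funM => //; exact: mU.
  - by move=> x Dx; rewrite mulr_ge0 ?g0// excess_ge0.
  - by move=> x Dx; rewrite mulr_ge0 ?d0// mulr_ge0 ?g0 ?indU_ge0.
  congr (_ + _)%E; rewrite E_scale//; first exact: mU.
    by move=> x Dx; rewrite mulr_ge0 ?g0 ?indU_ge0.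
  exact: d0.
rewrite (split q rho q0 mrho rho0) (split (q - 1) h q10 mh h0) [X in (_ <= X)%E]ge0_muleDr; last 2 first.
- by apply: E_ge0 => x Dx; rewrite mulr_ge0 ?h0// excess_ge0.
- by rewrite mule_ge0 ?lee_fin ?d0//; apply: E_ge0 => x Dx; rewrite mulr_ge0 ?h0 ?indU_ge0.
apply: leeD; first exact: IH.
have iaj j : j \in i :: s -> al i <= al j by rewrite in_cons => /predU1P[->//|]; exact: ij.
have W := weak_type mrho mh rho0 h0 i0 iaj H.
have EU g : (forall x, D x -> 0 <= g x) -> (0 <= E (fun x => (indU (i :: s) x * g x)%R))%E.
  by move=> g0; apply: E_ge0 => x Dx; rewrite mulr_ge0 ?g0 ?indU_ge0.
(* The increment for exponent q is traded for the one for q - 1 and a factor [al i], which the weak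
   type bound consumes. *)
apply: (@le_trans _ _ ((q / (q - 1) * (al i * (al i `^ (q - 1) - a `^ (q - 1))))%:E * E (fun x => (indU (i :: s) x * rho x)%R))%E).
  by apply: lee_wpmul2r; [exact: EU|rewrite lee_fin powRB_le].
rewrite (_ : q / (q - 1) * _ = (q / (q - 1) * (al i `^ (q - 1) - a `^ (q - 1))) * al i); last by ring.
rewrite EFinM -muleA.
apply: le_trans (lee_wpmul2l _ W) _.
  by rewrite lee_fin mulr_ge0 ?d0// divr_ge0.
by rewrite !muleA -!EFinM; apply: lee_wpmul2r; [exact: EU|rewrite lee_fin le_eqVlt; apply/orP; left; apply/eqP; ring].
Qed.

Lemma maxf_sort al s x (le : rel nat) : maxf al (sort le s) x = maxf al s x.
Proof.
by apply/eqP; rewrite eq_le; apply/andP; split; apply: maxf_le => [|i si xi];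
  rewrite ?maxf_ge0// le_maxf//; move: si; rewrite mem_sort.
Qed.

(** The layer cake bound has constant k; Young's inequality with e = 1/(2k) lets half of the left
    side be absorbed, which leaves 2 k e^(1-q). *)
Definition strong_const (q : R) : R :=
  let k := 2 * (q / (q - 1)) in 2 * k * (2 * k)^-1 `^ (1 - q).

Lemma strong_const_ge0 q : 1 < q -> 0 <= strong_const q.
Proof.
by move=> q1; rewrite /strong_const mulr_ge0 ?powR_ge0// !mulr_ge0// ?invr_ge0 ?subr_ge0 ?ltW// (lt_trans _ q1).
Qed.

(** Supplies the finiteness that the absorption in [strong_type] requires, by bounding the maximum
    by the sum of the [al i]. *)
Lemma maxf_finite rho al q s : measurable_fun D rho -> (forall x, D x -> 0 <= rho x) -> 1 < q ->
  (forall i, 0 <= al i) -> (forall i, i \in s -> (E (fun x => (ind i x * rho x)%R) < +oo)%E) ->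
  (E (fun x => (maxf al s x `^ q * rho x)%R) < +oo)%E.
Proof.
move=> mrho rho0 q1 al0 fin.
have mind i : measurable_fun D (fun x => ind i x * rho x).
  by apply: measurable_funM => //; exact: measurable_ind.
have ind0 i x : D x -> 0 <= ind i x * rho x by move=> Dx; rewrite mulr_ge0 ?ind_ge0 ?rho0.
pose K := \sum_(i <- s) al i.
have K0 : 0 <= K by apply: sumr_ge0.
apply: (@le_lt_trans _ _ ((K `^ q)%:E * \sum_(i <- s) E (fun x => (ind i x * rho x)%R))%E).
  rewrite -E_sum// -E_scale//; last 3 first.
  - by apply: measurable_sum.
  - by move=> x Dx; apply: sumr_ge0 => i _; exact: ind0.
  - exact: powR_ge0.
  apply: E_le => x Dx; first by rewrite mulr_ge0 ?powR_ge0 ?rho0.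
  rewrite -mulr_suml mulrA ler_wpM2r ?rho0//.
  case: (boolP (has (fun i => x \in I i) s)) => [/hasP[i si xi]|/negbTE h]; last first.
    by rewrite maxf_eq0// powR0 ?mulr_ge0 ?powR_ge0 ?sumr_ge0 ?gt_eqF// (lt_trans _ q1).
  apply: (@le_trans _ _ (K `^ q)).
    apply: ge0_ler_powR; rewrite ?nnegrE ?maxf_ge0// ?(le_trans _ (ltW q1))//.
    apply: maxf_le => // j sj xj; rewrite /K (big_rem j)//= lerDl; exact: sumr_ge0.
  rewrite ler_peMr ?powR_ge0// (big_rem i)//= {1}/ind xi lerDl.
  by apply: sumr_ge0 => j _; exact: ind_ge0.
rewrite lte_mul_pinfty ?lee_fin ?powR_ge0//.
rewrite big_seq; apply: lte_sum_pinfty => i si; exact: fin.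
Qed.

(** If h <= e M r, the first term on the right dominates; otherwise M <= h / (e r), and the second
    does. *)
Lemma maxf_young (M h r q e : R) : 0 <= M -> 0 <= h -> 0 < r -> 1 < q -> 0 < e ->
  M `^ (q - 1) * h <= e * (M `^ q * r) + e `^ (1 - q) * (h `^ q * r `^ (1 - q)).
Proof.
move=> M0 h0 r0 q1 e0.
have q0 : 0 < q by lra.
case: (leP h (e * (M * r))) => [le1|/ltW lt1].
  rewrite -[leLHS]addr0 lerD ?mulr_ge0 ?powR_ge0//.
  apply: le_trans (ler_wpM2l (powR_ge0 _ _) le1) _.
  by rewrite -(mulr_powRB1 M0 q0) le_eqVlt; apply/orP; left; apply/eqP; ring.
rewrite -[leLHS]add0r lerD ?mulr_ge0 ?powR_ge0 ?(ltW e0) ?(ltW r0)//.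
have Mh : M <= h * (e^-1 * r^-1).
  by rewrite -invfM ler_pdivlMr ?mulr_gt0// mulrC -mulrA [r * M]mulrC.
have er (u : R) : 0 < u -> u^-1 `^ (q - 1) = u `^ (1 - q).
  by move=> u0; rewrite -powR_inv1 ?(ltW u0)// -powRrM; congr (_ `^ _); ring.
apply: (@le_trans _ _ ((h * (e^-1 * r^-1)) `^ (q - 1) * h)).
  rewrite ler_wpM2r// ge0_ler_powR ?nnegrE//; last 2 first.
  - by lra.
  - by rewrite !mulr_ge0// invr_ge0 ltW.
rewrite !powRM ?mulr_ge0 ?invr_ge0 ?(ltW e0) ?(ltW r0)// !er// -(mulr_powRB1 h0 q0).
by rewrite le_eqVlt; apply/orP; left; apply/eqP; ring.
Qed.

Lemma strong_type rho h al q s : measurable_fun D rho -> measurable_fun D h ->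
  (forall x, D x -> 0 < rho x) -> (forall x, D x -> 0 <= h x) -> 1 < q ->
  (forall i, 0 <= al i) ->
  (forall i, i \in s -> (E (fun x => (ind i x * rho x)%R) < +oo)%E) ->
  (forall i, i \in s -> ((al i)%:E * E (fun x => ind i x * rho x) <= E (fun x => ind i x * h x))%E) ->
  (E (fun x => (maxf al s x `^ q * rho x)%R) <=
   (strong_const q)%:E * E (fun x => (h x `^ q * rho x `^ (1 - q))%R))%E.
Proof.
move=> mrho mh rho0 h0 q1 al0 fin H.
have rho0' x : D x -> 0 <= rho x by move=> Dx; exact/ltW/rho0.
have q10 : 0 < q - 1 by lra. have q0 : 0 < q by lra.
set k := 2 * (q / (q - 1)).
have k0 : 0 < k by rewrite !mulr_gt0// invr_gt0.
pose le := [rel i j | al i <= al j].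
have le_total : total le by move=> i j; exact: le_total.
have S := excess_bound mrho mh rho0' h0 q1 (lexx 0) (sort_sorted le_total s).
have Hs i : i \in sort le s -> ((al i)%:E * E (fun x => ind i x * rho x) <= E (fun x => ind i x * h x))%E.
  by rewrite mem_sort; exact: H.
have {Hs}S := S (fun i _ => al0 i) Hs.
have exE r x : 0 < r -> excess al (sort le s) r 0 x = maxf al s x `^ r.
  move=> r0; rewrite /excess maxf_sort powR0 ?gt_eqF// subr0 /indU.
  case: (boolP (has _ _)) => hs; first by rewrite mulr1.
  rewrite maxf_eq0 ?powR0 ?gt_eqF ?mul0r//.
  apply/negbTE; apply: contra hs => /hasP[i si xi]; apply/hasP; exists i => //.
  by rewrite mem_sort.
have {S} : (E (fun x => (maxf al s x `^ q * rho x)%R) <= k%:E * E (fun x => (maxf al s x `^ (q - 1) * h x)%R))%E.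
  move: S; rewrite (E_eq (fun x _ => congr1 (fun z => z * rho x) (exE q x q0))).
  by rewrite (E_eq (fun x _ => congr1 (fun z => z * h x) (exE (q - 1) x q10))).
set A := E (fun x => maxf al s x `^ q * rho x)%R; set B := E (fun x => h x `^ q * rho x `^ (1 - q)).
set e := (2 * k)^-1.
have e0 : 0 < e by rewrite invr_gt0 mulr_gt0.
have Afin : (A < +oo)%E by exact: maxf_finite.
have mA : measurable_fun D (fun x => maxf al s x `^ q * rho x).
  by apply: measurable_funM => //; exact/measurable_powR_comp/measurable_maxf.
have mB : measurable_fun D (fun x => h x `^ q * rho x `^ (1 - q)).
  by apply: measurable_funM; exact: measurable_powR_comp.
have A0 : (0 <= A)%E by apply: E_ge0 => x Dx; rewrite mulr_ge0 ?powR_ge0 ?rho0'.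
have B0 : (0 <= B)%E by apply: E_ge0 => x Dx; rewrite mulr_ge0 ?powR_ge0.
have : (E (fun x => (maxf al s x `^ (q - 1) * h x)%R) <= e%:E * A + (e `^ (1 - q))%:E * B)%E.
  rewrite -!E_scale ?powR_ge0 ?(ltW e0)//; last 2 first.
  - by move=> x Dx; rewrite mulr_ge0 ?powR_ge0.
  - by move=> x Dx; rewrite mulr_ge0 ?powR_ge0 ?rho0'.
  rewrite -E_add; last 4 first.
  - exact: measurable_funM.
  - exact: measurable_funM.
  - by move=> x Dx; rewrite !mulr_ge0 ?powR_ge0 ?(ltW e0) ?rho0'.
  - by move=> x Dx; rewrite !mulr_ge0 ?powR_ge0.
  apply: E_le => x Dx; first by rewrite mulr_ge0 ?powR_ge0 ?h0.
  by apply: maxf_young; rewrite ?maxf_ge0 ?h0 ?rho0.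
rewrite /strong_const -/k -/e => Y X.
have {Y}X := le_trans X (lee_wpmul2l _ Y).
have C0 : 0 < 2 * k * e `^ (1 - q) by rewrite mulr_gt0 ?powR_gt0// mulr_gt0.
move: A A0 Afin B B0 X {mA mB} => [a||]//= A0 _ [b||]//= B0; last by move=> _; rewrite gt0_muley ?lte_fin// leey.
move=> X; have {}X : a <= k * (e * a + e `^ (1 - q) * b) by rewrite -lee_fin; apply: X; rewrite lee_fin ltW.
rewrite -EFinM lee_fin.
have ke : k * e = 2^-1 by rewrite /e; field; rewrite gt_eqF.
clearbody e k; move: (e `^ _) X => c X.
have {}X : a <= 2^-1 * a + k * c * b by apply: le_trans X _; rewrite -ke mulrDr !mulrA.
rewrite (_ : 2 * k * c * b = 2 * (k * c * b)); last by ring.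
by move: X; move: (k * _ * b) => z; lra.
Qed.

(* Lerner's argument: with [N] the maximal function for the measure of density [S], [(H i / dd i) `^ (p - 1)] is at most the mean over [I i], for the measure of density [V], of [K * N `^ (p - 1) * W / V]; the strong type bound is then used for [V] and for [S]. *)
Lemma two_weight (p K : R) (V S W h : T -> R) (dd v sg H : nat -> R) s :
  1 < p -> 0 <= K ->
  measurable_fun D V -> measurable_fun D S -> measurable_fun D W -> measurable_fun D h ->
  (forall x, D x -> [/\ 0 < V x, 0 < S x, 0 < W x & 0 <= h x]) ->
  (forall x, D x -> V x * S x `^ (p - 1) = W x `^ p) ->
  (forall i, [/\ 0 < dd i, 0 < v i, 0 < sg i & 0 <= H i]) ->
  (forall i, [/\ (dd i)%:E <= E (fun x => (ind i x * W x)%R), E (fun x => (ind i x * V x)%R) = (v i)%:E,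
     E (fun x => (ind i x * S x)%R) = (sg i)%:E & E (fun x => (ind i x * h x)%R) = (H i)%:E])%E ->
  (forall i, v i * sg i `^ (p - 1) <= K * dd i `^ p) ->
  (E (fun x => (maxf (fun i => (H i / dd i)%R) s x `^ p * V x)%R) <=
   (strong_const (p / (p - 1)) * (K `^ (p / (p - 1)) * strong_const p))%:E *
      E (fun x => (h x `^ p * S x `^ (1 - p))%R))%E.
Proof.
move=> p1 K0 mV mS mW mh pos VSW ipos iE iK.
have p10 : 0 < p - 1 by lra.
have p0 : 0 < p by lra.
set p' := p / (p - 1).
have p'1 : 1 < p' by rewrite /p' ltr_pdivlMr//; lra.
have p'E : p' = 1 + (p - 1)^-1 by rewrite /p'; field; rewrite gt_eqF.
have al0 i : 0 <= H i / sg i by have [_ _ s0 h0] := ipos i; rewrite divr_ge0// ltW.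
pose N := maxf (fun i => H i / sg i) s.
have N0 x : 0 <= N x by exact: maxf_ge0.
have mN : measurable_fun D N by exact: measurable_maxf.
have S1 : (E (fun x => (N x `^ p * S x)%R) <= (strong_const p)%:E * E (fun x => (h x `^ p * S x `^ (1 - p))%R))%E.
  apply: strong_type => //.
  - by move=> x /pos[].
  - by move=> x /pos[].
  - by move=> i _; have [_ _ -> _] := iE i; rewrite ltry.
  - move=> i _; have [_ _ -> ->] := iE i; have [_ _ s0 _] := ipos i.
    by rewrite -EFinM mulfVK ?gt_eqF.
pose h2 x := K * (N x `^ (p - 1) * W x).
have mNW : measurable_fun D (fun x => N x `^ (p - 1) * W x).
  by apply: measurable_funM => //; exact: measurable_powR_comp.
have h20 x : D x -> 0 <= h2 x.
  by move=> /pos[_ _ w0 _]; rewrite !mulr_ge0 ?powR_ge0 ?(ltW w0).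
pose be i := (H i / dd i) `^ (p - 1).
have S2 : (E (fun x => (maxf be s x `^ p' * V x)%R) <= (strong_const p')%:E * E (fun x => (h2 x `^ p' * V x `^ (1 - p'))%R))%E.
  apply: strong_type => //.
  - exact: measurable_funM.
  - by move=> x /pos[].
  - by move=> i; exact: powR_ge0.
  - by move=> i _; have [_ -> _ _] := iE i; rewrite ltry.
  move=> i si; have [dW -> _ _] := iE i; have [d0 v0 s0 h0] := ipos i.
  (* Writing H/dd = (H/sg)(sg/dd), hypothesis [iK] gives be v <= K (H/sg)^(p-1) dd. Here dd is at
     most the mass of [W] on [I i], and H/sg is at most [N] there. *)
  rewrite -EFinM; apply: (@le_trans _ _ ((K * (H i / sg i) `^ (p - 1))%:E * (dd i)%:E)%E).
    rewrite -EFinM lee_fin.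
    have -> : be i * v i = (H i / sg i) `^ (p - 1) * ((v i * sg i `^ (p - 1)) * (dd i)^-1 `^ (p - 1)).
      rewrite /be (_ : H i / dd i = H i / sg i * (sg i * (dd i)^-1)); last first.
        by field; rewrite !gt_eqF.
      rewrite powRM ?mulr_ge0 ?invr_ge0 ?(ltW s0) ?(ltW d0)// [(sg i * _) `^ _]powRM ?invr_ge0 ?(ltW s0) ?(ltW d0)//.
      by ring.
    rewrite [leRHS](_ : _ = (H i / sg i) `^ (p - 1) * (K * dd i)); last by ring.
    rewrite ler_wpM2l ?powR_ge0//.
    apply: le_trans (ler_wpM2r (powR_ge0 _ _) (iK i)) _.
    rewrite -mulrA ler_wpM2l// -powR_inv1 ?(ltW d0)// -powRrM -powRD ?(gt_eqF d0) ?implybT//.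
    by rewrite (_ : p + -1 * (p - 1) = 1) ?powRr1 ?(ltW d0)//; ring.
  have c0 : 0 <= K * (H i / sg i) `^ (p - 1) by rewrite mulr_ge0 ?powR_ge0.
  apply: le_trans (lee_wpmul2l _ dW) _; first by rewrite lee_fin.
  rewrite -E_scale//; last 2 first.
  - by apply: measurable_funM => //; exact: measurable_ind.
  - by move=> x /pos[_ _ w0 _]; rewrite mulr_ge0 ?ind_ge0 ?(ltW w0).
  apply: E_le => x Dx; have [_ _ w0 _] := pos x Dx.
    by rewrite !mulr_ge0 ?powR_ge0 ?ind_ge0 ?(ltW w0).
  rewrite /h2 /ind; case: (boolP (x \in I i)) => xi; last by rewrite !mul0r mulr0.
  rewrite !mul1r -mulrA ler_wpM2l// ler_wpM2r ?(ltW w0)//.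
  by rewrite ge0_ler_powR ?nnegrE ?(ltW p10)//; exact: le_maxf.
apply: le_trans (_ : (_ <= E (fun x => (maxf be s x `^ p' * V x)%R))%E) _.
  apply: E_le => x Dx; have [v0 _ _ _] := pos x Dx.
    by rewrite mulr_ge0 ?powR_ge0 ?(ltW v0).
  rewrite ler_wpM2r ?(ltW v0)//.
  have -> : maxf be s x `^ p' = (maxf be s x `^ (p - 1)^-1) `^ p.
    by rewrite -powRrM /p' mulrC.
  rewrite ge0_ler_powR ?nnegrE ?powR_ge0 ?maxf_ge0 ?(ltW p0)//.
  apply: maxf_le => [|i si xi]; first exact: powR_ge0.
  have [d0 _ _ h0] := ipos i.
  have -> : H i / dd i = be i `^ (p - 1)^-1.
    by rewrite /be -powRrM mulfV ?gt_eqF// powRr1// divr_ge0// ltW.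
  by rewrite ge0_ler_powR ?nnegrE ?powR_ge0 ?maxf_ge0 ?invr_ge0 ?(ltW p10)//; exact: le_maxf.
apply: (le_trans S2).
(* The relation between the densities gives W^(p') = V^(p'-1) S, which leads back to the measure of
   density [S] and to [S1]. *)
have -> : E (fun x => (h2 x `^ p' * V x `^ (1 - p'))%R) = ((K `^ p')%:E * E (fun x => (N x `^ p * S x)%R))%E.
  rewrite -E_scale ?powR_ge0//; last 2 first.
  - by apply: measurable_funM => //; exact: measurable_powR_comp.
  - by move=> x /pos[_ s0 _ _]; rewrite mulr_ge0 ?powR_ge0 ?(ltW s0).
  apply: E_eq => x Dx; have [v0 s0 w0 _] := pos x Dx.
  rewrite /h2 powRM ?mulr_ge0 ?powR_ge0 ?(ltW w0)// -mulrA; congr (_ * _).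
  rewrite powRM ?powR_ge0 ?(ltW w0)// -powRrM (_ : (p - 1) * p' = p); last first.
    by rewrite /p'; field; rewrite gt_eqF.
  rewrite -mulrA; congr (_ * _).
  have -> : W x `^ p' = V x `^ (p - 1)^-1 * S x.
    rewrite /p' powRrM -VSW// powRM ?powR_ge0 ?(ltW v0)// -powRrM mulfV ?gt_eqF// powRr1// ltW//.
  rewrite mulrAC -powRD ?(gt_eqF v0) ?implybT// p'E.
  by rewrite (_ : _ + _ = 0) ?powRr0 ?mul1r//; ring.
rewrite [X in (_ <= X * _)%E]EFinM -[X in (_ <= X)%E]muleA; apply: lee_wpmul2l; first by rewrite lee_fin strong_const_ge0.
by rewrite [X in (_ <= X * _)%E]EFinM -[X in (_ <= X)%E]muleA; apply: lee_wpmul2l S1; rewrite lee_fin powR_ge0.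
Qed.

End MaximalFunction.

(** * A covering lemma for intervals *)

Section IntervalCover.
Context {R : realType}.
Variables (la rb : nat -> R).
Let I i : set R := `]la i, rb i[%classic.

Lemma mem_itvoo_setE i x : (x \in I i) = (la i < x < rb i).
Proof. by apply/idP/idP; rewrite inE /I /= in_itv. Qed.

(** One that reaches farthest to the left and one that reaches farthest to the right cover the
    remaining one, because all contain x. *)
Lemma three_intervals i j k (x : R) : x \in I i -> x \in I j -> x \in I k ->
  exists i' j', [/\ i' \in [:: i; j; k], j' \in [:: i; j; k] &
    forall y, has (fun l => y \in I l) [:: i; j; k] = has (fun l => y \in I l) [:: i'; j']].
Proof.
have two u v w : x \in I u -> x \in I v -> x \in I w -> Num.min (la u) (la v) <= la w ->
    rb w <= Num.max (rb u) (rb v) -> forall y, y \in I w -> (y \in I u) || (y \in I v).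
  rewrite !mem_itvoo_setE => /andP[u1 u2] /andP[v1 v2] /andP[w1 w2] mn mx y.
  rewrite !mem_itvoo_setE => /andP[y1 y2].
  case: (leP y x) => yx.
    move: mn; rewrite ge_min => /orP[h|h]; apply/orP; [left|right]; apply/andP; split; lra.
  move: mx; rewrite le_max => /orP[h|h]; apply/orP; [left|right]; apply/andP; split; lra.
move=> xi xj xk.
have [h|[h|h]] : (Num.min (la i) (la j) <= la k /\ rb k <= Num.max (rb i) (rb j)) \/
  ((Num.min (la i) (la k) <= la j /\ rb j <= Num.max (rb i) (rb k)) \/
   (Num.min (la j) (la k) <= la i /\ rb i <= Num.max (rb j) (rb k))).
  have amin (u v w : R) : (u <= v /\ u <= w) \/ ((v <= u /\ v <= w) \/ (w <= u /\ w <= v)).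
    case: (leP u v) => h1; case: (leP u w) => h2; case: (leP v w) => h3; try (by left; split; lra);
      try (by right; left; split; lra); by right; right; split; lra.
  have : (rb j <= rb i /\ rb k <= rb i) \/ ((rb i <= rb j /\ rb k <= rb j) \/ (rb i <= rb k /\ rb j <= rb k)).
    have [[h1 h2]|[[h1 h2]|[h1 h2]]] := amin (- rb i) (- rb j) (- rb k); rewrite !lerN2 in h1 h2.
    - by left.
    - by right; left.
    - by right; right.
  have := amin (la i) (la j) (la k); rewrite !ge_min !le_max.
  move=> [[h1 h2]|[[h1 h2]|[h1 h2]]] [[g1 g2]|[[g1 g2]|[g1 g2]]]; rewrite ?h1 ?h2 ?g1 ?g2 ?orbT;
    first [by left | by right; left | by right; right].
- exists i, j; rewrite !inE !eqxx ?orbT; split=> // y; rewrite /= !orbF.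
  by have := two _ _ _ xi xj xk h.1 h.2 y; case: (y \in I i); case: (y \in I j); case: (y \in I k) => //= /(_ isT).
- exists i, k; rewrite !inE !eqxx ?orbT; split=> // y; rewrite /= !orbF.
  by have := two _ _ _ xi xk xj h.1 h.2 y; case: (y \in I i); case: (y \in I j); case: (y \in I k) => //= /(_ isT).
- exists j, k; rewrite !inE !eqxx ?orbT; split=> // y; rewrite /= !orbF.
  by have := two _ _ _ xj xk xi h.1 h.2 y; case: (y \in I i); case: (y \in I j); case: (y \in I k) => //= /(_ isT).
Qed.

Lemma interval_cover (s : seq nat) : exists s' : seq nat,
  [/\ {subset s' <= s}, (forall x, has (fun i => x \in I i) s = has (fun i => x \in I i) s') &
      forall x, (count (fun i => x \in I i) s' <= 2)%N].
Proof.
have [n] := ubnP (size s); elim: n s => // n IH s sn.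
have [[x xs]|H] := pselect (exists x, (2 < count (fun i => x \in I i) s)%N); last first.
  exists s; split=> // x; rewrite leqNgt; apply/negP => h; apply: H; by exists x.
pose P i := x \in I i.
case E : (seq.filter P s) => [|i [|j [|k t]]]; try by move: xs; rewrite -size_filter -/P E.
have allP : forall l, l \in [:: i; j; k] -> (l \in s) && (x \in I l).
  move=> l lijk; have : l \in seq.filter P s by rewrite E; move: lijk; rewrite !inE => /or3P[] ->; rewrite ?orbT.
  by rewrite mem_filter andbC.
have mem3 : [/\ i \in [:: i; j; k], j \in [:: i; j; k] & k \in [:: i; j; k]] by rewrite !inE !eqxx !orbT.
have [mi mj mk] := mem3.
have [/andP[si xi] /andP[sj xj] /andP[sk xk]] := And3 (allP i mi) (allP j mj) (allP k mk).
have [i' [j' [mi' mj' U]]] := three_intervals xi xj xk.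
pose s1 := [:: i', j' & t ++ seq.filter (predC P) s].
have ps : perm_eq s ([:: i; j; k] ++ (t ++ seq.filter (predC P) s)).
  by rewrite catA (_ : [:: i; j; k] ++ t = seq.filter P s) // perm_sym; apply: permEl; exact: perm_filterC.
have hs y : has (fun i => y \in I i) s = has (fun i => y \in I i) s1.
  by rewrite (perm_has _ ps) has_cat U /s1 /= orbF orbA.
have sz : (size s1 < n)%N.
  by move: sn; rewrite (perm_size ps) /s1 /= !ltnS.
have [s' [ss' U' c']] := IH _ sz.
exists s'; split=> // [l /ss'|y]; last by rewrite hs U'.
rewrite /s1 !inE mem_cat => /or3P[/eqP->|/eqP->|].
- by have /andP[] := allP _ mi'.
- by have /andP[] := allP _ mj'.
rewrite (perm_mem ps) mem_cat => h; apply/orP; right; by rewrite mem_cat.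
Qed.

End IntervalCover.

(** * Integrals over intervals *)

Section IntervalIntegral.
Context {R : realType}.
Local Notation mu := (@lebesgue_measure R).
Local Notation J g a b := (\int[mu]_(x in `]a%R, b%R[) (g x)%:E)%E.
Implicit Types (f g : R -> R) (a b c t : R).

Lemma subset_itv_Rplus a b : 0 <= a -> `]a, b[%classic `<=` @Rplus R.
Proof.
move=> a0 x; rewrite /Rplus /= !in_itv/= andbT => /andP[ax _]; exact: le_lt_trans ax.
Qed.

Lemma measurable_itvoo_Rplus f a b : 0 <= a -> measurable_fun (@Rplus R) f ->
  measurable_fun `]a, b[%classic f.
Proof.
by move=> a0 mf; apply: measurable_funS mf; [exact: measurable_itv|exact: subset_itv_Rplus].
Qed.

Lemma itvoo_length a b : a < b -> mu `]a, b[%classic = (b - a)%:E.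
Proof. by move=> ab; rewrite lebesgue_measure_itv /= lte_fin ab EFinB. Qed.

Lemma J_gt0 g a b : a < b -> measurable_fun `]a, b[%classic g ->
  (forall x, a < x < b -> 0 < g x) -> (0 < J g a b)%E.
Proof.
move=> ab mg g0; rewrite lt_neqAle; apply/andP; split; last first.
  by apply: integral_ge0 => x /=; rewrite in_itv/= => /g0 h; rewrite lee_fin ltW.
apply/eqP => J0; have mD : measurable (`]a, b[%classic : set R) by exact: measurable_itv.
have : (\int[mu]_(x in `]a, b[) `|(g x)%:E|)%E = 0%E.
  rewrite J0; apply: eq_integral => x; rewrite inE/= in_itv/= => /g0 h.
  by rewrite /= ger0_norm// ltW.
move/(ae_eq_integral_abs mu mD ((measurable_EFinP _ _).2 mg)).1.
move=> [N [mN N0 DN]].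
have : (mu `]a, b[%classic <= mu N)%E.
  apply: le_measure; rewrite ?inE// => x /= xab; apply: DN => /= /(_ xab) /eqP.
  by move: xab; rewrite in_itv/= => /g0 h; rewrite eqe gt_eqF.
by rewrite N0 itvoo_length// lee_fin subr_le0 leNgt ab.
Qed.

Lemma J_split g a c b : a < c -> c < b -> measurable_fun `]a, b[%classic g ->
  (forall x, a < x < b -> 0 <= g x) -> J g a b = (J g a c + J g c b)%E.
Proof.
move=> ac cb mg g0.
have -> : `]a, b[%classic = `]a, c[%classic `|` `[c, b[%classic.
  by rewrite -itv_bndbnd_setU// bnd_simp ltW.
have sub1 : `[c, b[%classic `<=` `]a, b[%classic by apply: subset_itv; rewrite bnd_simp.
have sub2 : `]a, c[%classic `<=` `]a, b[%classic by apply: subset_itv; rewrite bnd_simp// ltW.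
rewrite ge0_integral_setU//=.
- congr (_ + _)%E; rewrite integral_itv_obnd_cbnd//.
  apply/measurable_EFinP; apply: measurable_funS mg; first exact: measurable_itv.
  by apply: subset_itv; rewrite bnd_simp// ltW.
- rewrite -itv_bndbnd_setU ?bnd_simp ?ltW//; exact/measurable_EFinP.
- move=> x [/sub2|/sub1] /=; rewrite in_itv/= => xab; by rewrite lee_fin g0.
- apply/disj_setPS => x [] /=; rewrite !in_itv/= => /andP[_ xc] /andP[cx _].
  by move: (lt_le_trans xc cx); rewrite ltxx.
Qed.

(** Hoelder's inequality with exponents 1/(1 - t) and 1/t, from the weighted arithmetic-geometric
    inequality for f/F and g/G; this form includes t = 0 and t = 1. *)
Lemma J_hoelder f g a b t (F G : R) : 0 <= t <= 1 -> 0 < F -> 0 < G ->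
  measurable_fun `]a, b[%classic f -> measurable_fun `]a, b[%classic g ->
  (forall x, a < x < b -> 0 <= f x) -> (forall x, a < x < b -> 0 <= g x) ->
  J f a b = F%:E -> J g a b = G%:E ->
  (J (fun x => f x `^ (1 - t) * g x `^ t)%R a b <= (F `^ (1 - t) * G `^ t)%:E)%E.
Proof.
move=> /[dup] t01 /andP[t0 t1] F0 G0 mf mg f0 g0 JF JG.
have mD : measurable (`]a, b[%classic : set R) by exact: measurable_itv.
have t1' : 0 <= 1 - t by rewrite subr_ge0.
set c := F `^ (1 - t) * G `^ t.
have c0 : 0 <= c by rewrite mulr_ge0 ?powR_ge0.
have F0' := ltW F0; have G0' := ltW G0.
have k1 : 0 <= c * ((1 - t) / F) by rewrite mulr_ge0// divr_ge0.
have k2 : 0 <= c * (t / G) by rewrite mulr_ge0// divr_ge0.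
apply: (@le_trans _ _ (J (fun x => c * ((1 - t) / F) * f x + c * (t / G) * g x)%R a b)).
  apply: E_le => x /=; rewrite in_itv/= => xab; first by rewrite mulr_ge0 ?powR_ge0.
  have := @weighted_amgm R t (f x / F) (g x / G) t01 (divr_ge0 (f0 x xab) F0') (divr_ge0 (g0 x xab) G0').
  move=> /(ler_wpM2l c0); rewrite !powRM ?invr_ge0 ?f0 ?g0//.
  have iv (u s : R) : 0 < u -> u^-1 `^ s = (u `^ s)^-1.
    by move=> u0; rewrite -powR_inv1 ?(ltW u0)// -powRrM mulN1r powRN.
  rewrite !iv//; have pF : 0 < F `^ (1 - t) by exact: powR_gt0.
  have pG : 0 < G `^ t by exact: powR_gt0.
  rewrite (_ : c * (f x `^ (1 - t) / F `^ (1 - t) * (g x `^ t / G `^ t)) = f x `^ (1 - t) * g x `^ t); last first.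
    by rewrite /c; field; rewrite !gt_eqF.
  by move=> h; apply: le_trans h _; rewrite le_eqVlt; apply/orP; left; apply/eqP; ring.
rewrite E_add//; last 4 first.
- exact: measurable_funM.
- exact: measurable_funM.
- by move=> x /=; rewrite in_itv/= => xab; rewrite mulr_ge0 ?f0.
- by move=> x /=; rewrite in_itv/= => xab; rewrite mulr_ge0 ?g0.
rewrite !E_scale//.
rewrite JF JG -!EFinM -EFinD lee_fin le_eqVlt; apply/orP; left; apply/eqP.
by field; rewrite !gt_eqF.
Qed.

Lemma J_le f g a b : (forall x, a < x < b -> 0 <= f x) -> (forall x, a < x < b -> f x <= g x) ->
  (J f a b <= J g a b)%E.
Proof. by move=> f0 fg; apply: E_le => x /=; rewrite in_itv/=; [exact: f0|exact: fg]. Qed.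

Lemma J_subset g a b c d : measurable_fun `]c, d[%classic g -> (forall x, c < x < d -> 0 <= g x) ->
  c <= a -> b <= d -> (J g a b <= J g c d)%E.
Proof.
move=> mg g0 ca bd; apply: ge0_subset_integral.
- exact: measurable_itv.
- exact: measurable_itv.
- exact/measurable_EFinP.
- by move=> x /=; rewrite in_itv/= => xcd; rewrite lee_fin g0.
- by apply: subset_itv; rewrite bnd_simp.
Qed.

Lemma J_cst1 a b : a < b -> J (fun=> 1) a b = (b - a)%:E.
Proof. by move=> ab; have := itvoo_length ab; rewrite integral_cst ?mul1e//; exact: measurable_itv. Qed.

(** The singular factor is at most a^(-be), and Hoelder's inequality against the constant 1 handles
    the power of g. *)
Lemma J_away g a b (be G : R) : 0 < a -> a < b -> 0 <= be <= 1 -> measurable_fun `]a, b[%classic g ->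
  (forall x, a < x < b -> 0 < g x) -> J g a b = G%:E ->
  (J (fun x => g x `^ (1 - be) * x `^ (- be))%R a b <= (a `^ (- be) * (G `^ (1 - be) * (b - a) `^ be))%:E)%E.
Proof.
move=> a0 ab /[dup] be01 /andP[be0 be1] mg g0 JG.
have G0 : 0 < G by rewrite -lte_fin -JG; exact: J_gt0.
have g0' x : a < x < b -> 0 <= g x by move=> /g0/ltW.
have := @J_hoelder g (fun=> 1) a b be G (b - a) be01 G0.
rewrite subr_gt0 => /(_ ab mg (measurable_cst _) g0' (fun _ _ => ler01) JG (J_cst1 ab)) H.
rewrite EFinM; apply: le_trans (lee_wpmul2l _ H); last by rewrite lee_fin powR_ge0.
have mD : measurable (`]a, b[%classic : set R) by exact: measurable_itv.
rewrite -E_scale//; last 3 first.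
- by apply: measurable_funM; apply: measurable_powR_comp => //; exact: measurable_cst.
- by move=> x _; rewrite mulr_ge0 ?powR_ge0.
- exact: powR_ge0.
apply: J_le => x xab; first by rewrite mulr_ge0 ?powR_ge0.
rewrite powR1 mulr1 mulrC ler_wpM2r ?powR_ge0// !powRN lef_pV2 ?posrE ?powR_gt0//.
  by apply: ge0_ler_powR => //; rewrite ?nnegrE ?(ltW a0)//; move: xab => /andP[ax _]; rewrite ltW// (lt_trans a0).
by move: xab => /andP[ax _]; exact: lt_trans ax.
Qed.

(** * Singular factors under geometric decay of the mass at 0 *)

Section Decay.
Variables (g : R -> R) (G : R -> R) (eta be : R).
Hypothesis mg : measurable_fun (@Rplus R) g.
Hypothesis g0 : forall x : R, 0 < x -> 0 < g x.
Hypothesis JG : forall T : R, 0 < T -> J g 0 T = (G T)%:E.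
Hypothesis eta01 : 0 <= eta < 1.
Hypothesis be01 : 0 <= be < 1.
Hypothesis decay : forall T : R, 0 < T -> G (T / 2) <= eta * G T.

Let h x := g x `^ (1 - be) * x `^ (- be).

Lemma G_gt0 T : 0 < T -> 0 < G T.
Proof.
move=> T0; rewrite -lte_fin -JG//; apply: J_gt0 => //.
  exact: measurable_itvoo_Rplus.
by move=> x /andP[x0 _]; exact: g0.
Qed.

Lemma measurable_decay_weight : measurable_fun (@Rplus R) h.
Proof.
apply: measurable_funM; first exact: measurable_powR_comp.
by apply: (@measurable_powR_comp _ R R Rplus (fun x => x)) => //; exact: measurable_id.
Qed.

Lemma h_ge0 x : 0 <= h x.
Proof. by rewrite mulr_ge0 ?powR_ge0. Qed.

(** The sum of the geometric series of ratio eta^(1-be), which dominates the dyadic pieces. *)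
Definition decay_const : R := (1 - eta `^ (1 - be))^-1.

Lemma decay_den_gt0 : 0 < 1 - eta `^ (1 - be).
Proof.
move: eta01 be01 => /andP[e0 e1] /andP[b0 b1].
rewrite subr_gt0 [X in _ < X](_ : 1 = 1 `^ (1 - be)); last by rewrite powR1.
by apply: gt0_ltr_powR; rewrite ?nnegrE ?subr_gt0.
Qed.

(** The singular factor costs (T/2)^(-be), and Hoelder's inequality gains the length T/2 to the
    power be, so no power of T remains. *)
Lemma decay_piece T : 0 < T -> (J h (T / 2) T <= (G T `^ (1 - be))%:E)%E.
Proof.
move=> T0; have T2 : 0 < T / 2 by rewrite divr_gt0.
have TT : T / 2 < T by rewrite ltr_pdivrMr// ltr_pMr// ltr1n.
move: (be01) => /andP[b0 b1].
have mg2 : measurable_fun `]T / 2, T[%classic g by apply: measurable_itvoo_Rplus => //; exact: ltW.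
have g02 x : T / 2 < x < T -> 0 < g x by move=> /andP[x0 _]; apply: g0; exact: lt_trans x0.
have le1 : (J g (T / 2) T <= (G T)%:E)%E.
  rewrite -JG//; apply: J_subset => //; [exact: measurable_itvoo_Rplus| |exact: ltW].
  by move=> x /andP[x0 _]; apply/ltW/g0.
have : J g (T / 2) T \is a fin_num.
  by rewrite ge0_fin_numE ?(le_lt_trans le1) ?ltry// ltW// J_gt0.
have be01' : 0 <= be <= 1 by rewrite b0 ltW.
move=> /fineK E; have H := J_away T2 TT be01' mg2 g02 (esym E).
apply: le_trans H _; rewrite lee_fin (_ : T - T / 2 = T / 2); last by field.
rewrite mulrCA -powRD ?(gt_eqF T2) ?implybT// addNr powRr0 mulr1.
apply: ge0_ler_powR; rewrite ?nnegrE ?subr_ge0 ?(ltW b1)//.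
- by apply: fine_ge0; rewrite ltW// J_gt0.
- by rewrite ltW// G_gt0.
- by rewrite -lee_fin E.
Qed.

(** The constant solves c = 1 + c eta^(1-be): one piece next to T, and the bound already known for
    T/2. *)
Lemma decay_iter N T : 0 < T -> (J h (T / 2 ^+ N) T <= (decay_const * G T `^ (1 - be))%:E)%E.
Proof.
move: (eta01) (be01) => /andP[e0 e1] /andP[b0 b1].
have C0 : 0 <= decay_const by rewrite invr_ge0 ltW// decay_den_gt0.
elim: N T => [|N IH] T T0.
  rewrite expr0 divr1 set_itvoo0 integral_set0 lee_fin mulr_ge0 ?powR_ge0//.
have T2 : 0 < T / 2 by rewrite divr_gt0.
have TT : T / 2 < T by rewrite ltr_pdivrMr// ltr_pMr// ltr1n.
have E : T / 2 ^+ N.+1 = T / 2 / 2 ^+ N by rewrite exprS invfM mulrA.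
have piece := decay_piece T0.
have step : (J h (T / 2) T + (decay_const * G (T / 2) `^ (1 - be))%:E <= (decay_const * G T `^ (1 - be))%:E)%E.
  apply: le_trans (leeD2r _ piece) _; rewrite -EFinD lee_fin.
  have : G (T / 2) `^ (1 - be) <= eta `^ (1 - be) * G T `^ (1 - be).
    rewrite -powRM ?(ltW (G_gt0 T0))//; apply: ge0_ler_powR; rewrite ?nnegrE ?subr_ge0 ?(ltW b1) ?mulr_ge0 ?(ltW (G_gt0 _))//.
    exact: decay.
  move=> /(ler_wpM2l C0) X; apply: le_trans (lerD (lexx _) X) _.
  have := decay_den_gt0; rewrite /decay_const => den0.
  by rewrite le_eqVlt; apply/orP; left; apply/eqP; field; rewrite gt_eqF.
(* The second case is N = 0, where the integral is the piece next to T alone. *)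
case: (ltP (T / 2 ^+ N.+1) (T / 2)) => [lt1|ge1].
  rewrite (J_split lt1 TT); last 2 first.
  - apply: measurable_itvoo_Rplus; last exact: measurable_decay_weight.
    by rewrite ltW// divr_gt0// exprn_gt0.
  - by move=> x _; exact: h_ge0.
  by rewrite addeC; apply: le_trans step; rewrite leeD2l// E IH.
apply: le_trans step; apply: le_trans (_ : (_ <= J h (T / 2) T)%E) _.
  apply: J_subset => //; first by apply: measurable_itvoo_Rplus measurable_decay_weight; exact: ltW.
  by move=> x _; exact: h_ge0.
by rewrite leeDl// lee_fin mulr_ge0 ?powR_ge0.
Qed.

Lemma decay_integral T : 0 < T -> (J h 0 T <= (decay_const * G T `^ (1 - be))%:E)%E.
Proof.
move=> T0; pose A N := `]T / 2 ^+ N, T[%classic.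
have ndA : nondecreasing_seq A.
  apply/nondecreasing_seqP => N; rewrite subsetEset; apply: subset_itv; rewrite bnd_simp//.
  by rewrite ler_pM2l// lef_pV2 ?posrE ?exprn_gt0// exprS ler_peMl ?exprn_ge0// ler1n.
have UA : \bigcup_N A N = `]0, T[%classic.
  apply/seteqP; split => x.
    move=> [N _]; rewrite /A /= !in_itv/= => /andP[h1 ->]; rewrite andbT.
    by apply: lt_trans h1; rewrite divr_gt0// exprn_gt0.
  rewrite /= in_itv/= => /andP[x0 xT].
  have Tx : 0 <= T / x by rewrite divr_ge0// ltW.
  exists (Num.trunc (T / x)).+1 => //; rewrite /A /= in_itv/= xT andbT.
  rewrite ltr_pdivrMr ?exprn_gt0// mulrC -ltr_pdivrMr//.
  have /andP[_ /lt_trans] := truncn_itv Tx; apply.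
  by rewrite -natrX ltr_nat ltn_expl.
have : (J h (T / 2 ^+ N) T) @[N --> \oo] --> J h 0 T.
  rewrite -UA; apply: ge0_nondecreasing_set_cvg_integral => //.
  - move=> N; apply/measurable_EFinP; apply: measurable_itvoo_Rplus; last exact: measurable_decay_weight.
    by rewrite ltW// divr_gt0// exprn_gt0.
  - by move=> N x _; rewrite lee_fin h_ge0.
move=> cv; rewrite -(cvg_lim _ cv)//; apply: lime_le; first by apply/cvg_ex; eexists; exact: cv.
by near=> N; exact: decay_iter.
Unshelve. all: by end_near. Qed.

End Decay.

(** * The two-weight condition *)

Section WeightCondition.
Variables (p be K0 : R) (v sg : R -> R) (vv ss : R -> R -> R).
Hypothesis p1 : 1 < p.
Hypothesis be01 : 0 <= be < 1.
Hypothesis bep : be < p - 1.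
Hypothesis mv : measurable_fun (@Rplus R) v.
Hypothesis msg : measurable_fun (@Rplus R) sg.
Hypothesis v0 : forall x : R, 0 < x -> 0 < v x.
Hypothesis sg0 : forall x : R, 0 < x -> 0 < sg x.
(** With Q = (p - 2 be)/(1 - be) this says sg = v^(-1/(Q-1)), and [joint] is the A_Q condition for
    [v] raised to the power 1 - be. *)
Hypothesis dual : forall x : R, 0 < x ->
  sg x `^ (1 - (1 - be) / (p - 2 * be)) * v x `^ ((1 - be) / (p - 2 * be)) = 1.
Hypothesis Jv : forall a b : R, 0 <= a -> a < b -> J v a b = (vv a b)%:E.
Hypothesis Js : forall a b : R, 0 <= a -> a < b -> J sg a b = (ss a b)%:E.
Hypothesis joint : forall a b : R, 0 <= a -> a < b ->
  vv a b `^ (1 - be) * ss a b `^ (p - 1 - be) <= K0 * (b - a) `^ (p - 2 * be).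

Lemma itv_integral_gt0 (g : R -> R) (gg : R -> R -> R) a b : measurable_fun (@Rplus R) g ->
  (forall x : R, 0 < x -> 0 < g x) -> (forall a b : R, 0 <= a -> a < b -> J g a b = (gg a b)%:E) ->
  0 <= a -> a < b -> 0 < gg a b.
Proof.
move=> mg g0 Jg a0 ab; rewrite -lte_fin -Jg//; apply: J_gt0 => //.
  exact: measurable_itvoo_Rplus.
by move=> x /andP[ax _]; apply: g0; exact: le_lt_trans ax.
Qed.

Let vv0 a b := itv_integral_gt0 (a := a) (b := b) mv v0 Jv.
Let ss0 a b := itv_integral_gt0 (a := a) (b := b) msg sg0 Js.

Lemma itv_integral_split (g : R -> R) (gg : R -> R -> R) T : measurable_fun (@Rplus R) g ->
  (forall x : R, 0 < x -> 0 < g x) -> (forall a b : R, 0 <= a -> a < b -> J g a b = (gg a b)%:E) ->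
  0 < T -> gg 0 T = gg 0 (T / 2) + gg (T / 2) T.
Proof.
move=> mg g0 Jg T0; have T2 : 0 < T / 2 by rewrite divr_gt0.
have TT : T / 2 < T by rewrite ltr_pdivrMr// ltr_pMr// ltr1n.
apply: EFin_inj; rewrite EFinD -!Jg// ?(ltW T2)//; apply: J_split => //.
  exact: measurable_itvoo_Rplus.
by move=> x /andP[x0 _]; apply/ltW/g0.
Qed.

Let P := p - 2 * be.

Let P0 : 0 < P. Proof. by move: be01 bep => /andP[b0 b1] bp; rewrite /P; lra. Qed.

(** By [dual], Hoelder's inequality on (T/2, T) gives the reverse of [joint] there, so the product
    of the masses over (0, T) is controlled by the one over the right half. *)
Lemma joint_half T : 0 < T ->
  vv 0 T `^ (1 - be) * ss 0 T `^ (p - 1 - be) <=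
  K0 * 2 `^ P * (vv (T / 2) T `^ (1 - be) * ss (T / 2) T `^ (p - 1 - be)).
Proof.
move: (be01) => /andP[b0 b1] T0; have T2 : 0 < T / 2 by rewrite divr_gt0.
have TT : T / 2 < T by rewrite ltr_pdivrMr// ltr_pMr// ltr1n.
set t := (1 - be) / P.
have t01 : 0 <= t <= 1.
  rewrite divr_ge0 ?(ltW P0) ?subr_ge0 ?(ltW b1)//= ler_pdivrMr// mul1r /P; have := bep; lra.
have s1 := ss0 (ltW T2) TT; have v1 := vv0 (ltW T2) TT.
have pos x : T / 2 < x < T -> 0 < x by move=> /andP[h _]; exact: lt_trans h.
have := J_hoelder t01 s1 v1 (measurable_itvoo_Rplus (ltW T2) msg) (measurable_itvoo_Rplus (ltW T2) mv)
  (fun x h => ltW (sg0 (pos x h))) (fun x h => ltW (v0 (pos x h))) (Js (ltW T2) TT) (Jv (ltW T2) TT).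
have -> : (\int[mu]_(x in `](T / 2)%R, T%R[) (sg x `^ (1 - t) * v x `^ t)%:E = J (fun=> 1%R) (T / 2)%R T)%E.
  by apply: eq_integral => x; rewrite inE/= in_itv/= => /pos xp; rewrite dual.
rewrite J_cst1// lee_fin => H.
have {}H : (T / 2) `^ P <= ss (T / 2) T `^ (p - 1 - be) * vv (T / 2) T `^ (1 - be).
  have TE : T - T / 2 = T / 2 by field.
  rewrite TE in H.
  have := ge0_ler_powR (ltW P0) _ _ H; rewrite !nnegrE (ltW T2) mulr_ge0 ?powR_ge0// => /(_ isT isT) {}H.
  apply: le_trans H _; rewrite powRM ?powR_ge0// -!powRrM.
  have -> : t * P = 1 - be by rewrite /t mulfVK// gt_eqF.
  have -> : (1 - t) * P = p - 1 - be by rewrite mulrBl mul1r /t mulfVK ?gt_eqF// /P; ring.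
  by [].
have K00 : 0 <= K0.
  have h := joint (lexx 0) T0; rewrite subr0 in h.
  have : 0 < K0 * T `^ P by apply: lt_le_trans h; rewrite mulr_gt0// powR_gt0// ?vv0 ?ss0.
  by rewrite pmulr_lgt0 ?powR_gt0// => /ltW.
have := joint (lexx 0) T0; rewrite subr0 => h; apply: le_trans h _.
rewrite -mulrA ler_wpM2l// -[T in T `^ _](_ : 2 * (T / 2) = T); last by field.
rewrite powRM ?(ltW T2)// ler_wpM2l ?powR_ge0//.
by rewrite [leRHS]mulrC.
Qed.

(** [A1] is at least the fraction 1/M of [A], so at most (1 - 1/M) A is left. The maximum with 1
    keeps this factor nonnegative. *)
Lemma half_decay (e A A1 K1 : R) : 0 < e -> 0 < A1 -> 0 < A -> A `^ e <= K1 * A1 `^ e ->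
  0 < Num.max 1 (K1 `^ e^-1) /\ A - A1 <= (1 - (Num.max 1 (K1 `^ e^-1))^-1) * A.
Proof.
move=> e0 A10 A0 H; set M := Num.max _ _.
have M1 : 1 <= M by rewrite le_max lexx.
have M0 : 0 < M by apply: lt_le_trans M1.
have K10 : 0 < K1.
  by rewrite -(pmulr_lgt0 _ (powR_gt0 e A10)); apply: lt_le_trans H; rewrite powR_gt0.
split=> //; rewrite mulrBl mul1r lerD2l lerN2 mulrC ler_pdivrMr//.
have : (A `^ e) `^ e^-1 <= (K1 * A1 `^ e) `^ e^-1.
  by apply: ge0_ler_powR; rewrite ?nnegrE ?invr_ge0 ?mulr_ge0 ?powR_ge0// ltW.
rewrite powRM ?powR_ge0 ?(ltW K10)// -!powRrM mulfV ?gt_eqF// !powRr1 ?(ltW A0) ?(ltW A10)//.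
move=> h; apply: le_trans h _; rewrite mulrC ler_wpM2l ?(ltW A10)//.
by rewrite le_max lexx orbT.
Qed.

Lemma decay_eta : exists2 eta, 0 <= eta < 1 &
  forall T, 0 < T -> vv 0 (T / 2) <= eta * vv 0 T /\ ss 0 (T / 2) <= eta * ss 0 T.
Proof.
move: (be01) => /andP[b0 b1]; set K1 := K0 * 2 `^ P.
have e1 : 0 < 1 - be by lra.
have e2 : 0 < p - 1 - be by have := bep; lra.
pose M1 := Num.max 1 (K1 `^ (1 - be)^-1); pose M2 := Num.max 1 (K1 `^ (p - 1 - be)^-1).
pose M := Num.max M1 M2.
have M11 : 1 <= M1 by rewrite le_max lexx.
have M21 : 1 <= M2 by rewrite le_max lexx.
have MM1 : M1 <= M by rewrite le_max lexx.
have MM2 : M2 <= M by rewrite le_max lexx orbT.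
have M1' : 1 <= M by exact: le_trans MM1.
have M0 : 0 < M by exact: lt_le_trans M1'.
exists (1 - M^-1).
  by rewrite subr_ge0 invf_le1// M1' ltrBlDr ltrDl invr_gt0.
move=> T T0; have T2 : 0 < T / 2 by rewrite divr_gt0.
have TT : T / 2 < T by rewrite ltr_pdivrMr// ltr_pMr// ltr1n.
have H := joint_half T0; rewrite -/K1 in H.
have vs := itv_integral_split mv v0 Jv T0; have sS := itv_integral_split msg sg0 Js T0.
have A0 := vv0 (lexx 0) T0; have A1 := vv0 (ltW T2) TT; have A2 := vv0 (lexx 0) T2.
have B0 := ss0 (lexx 0) T0; have B1 := ss0 (ltW T2) TT; have B2 := ss0 (lexx 0) T2.
have K10 : 0 < K1.
  rewrite -(pmulr_lgt0 _ (mulr_gt0 (powR_gt0 (1 - be) A1) (powR_gt0 (p - 1 - be) B1))).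
  by apply: lt_le_trans H; rewrite mulr_gt0// powR_gt0.
(* Enlarging the mass of [sg] on the right half to that on (0, T) makes it cancel in [joint_half];
   [HB] exchanges the roles. *)
have HA : vv 0 T `^ (1 - be) <= K1 * vv (T / 2) T `^ (1 - be).
  rewrite -(ler_pM2r (powR_gt0 (p - 1 - be) B0)); apply: le_trans H _.
  rewrite mulrA; apply: (ler_wpM2l (mulr_ge0 (ltW K10) (powR_ge0 _ _))).
  by apply: ge0_ler_powR; rewrite ?nnegrE ?(ltW e2) ?(ltW B0) ?(ltW B1)// sS lerDr ltW.
have HB : ss 0 T `^ (p - 1 - be) <= K1 * ss (T / 2) T `^ (p - 1 - be).
  rewrite -(ler_pM2l (powR_gt0 (1 - be) A0)); apply: le_trans H _.
  rewrite [leRHS]mulrCA; apply: (ler_wpM2l (ltW K10)); rewrite ler_wpM2r ?powR_ge0//.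
  by apply: ge0_ler_powR; rewrite ?nnegrE ?(ltW e1) ?(ltW A0) ?(ltW A1)// vs lerDr ltW.
have [M10 hA] := half_decay e1 A1 A0 HA; have [M20 hB] := half_decay e2 B1 B0 HB.
rewrite -/M1 in M10 hA; rewrite -/M2 in M20 hB; split.
  have -> : vv 0 (T / 2) = vv 0 T - vv (T / 2) T by rewrite vs addrK.
  by apply: le_trans hA _; rewrite ler_wpM2r ?(ltW A0)// lerD2l lerN2 lef_pV2 ?posrE.
have -> : ss 0 (T / 2) = ss 0 T - ss (T / 2) T by rewrite sS addrK.
by apply: le_trans hB _; rewrite ler_wpM2r ?(ltW B0)// lerD2l lerN2 lef_pV2 ?posrE.
Qed.

Lemma J_real (g : R -> R) a b (M : R) : a < b -> measurable_fun `]a, b[%classic g ->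
  (forall x, a < x < b -> 0 < g x) -> (J g a b <= M%:E)%E ->
  exists r, [/\ 0 < r, r <= M & J g a b = r%:E].
Proof.
move=> ab mg g0 JM; have J0 := J_gt0 ab mg g0.
have fJ : J g a b \is a fin_num by rewrite ge0_fin_numE ?(le_lt_trans JM) ?ltry// ltW.
exists (fine (J g a b)); rewrite fineK//; split => //.
  by rewrite -lte_fin fineK.
by rewrite -lee_fin fineK.
Qed.

Let be' := be / (p - 1).

Let vh x := v x `^ (1 - be) * x `^ (- be).
Let sh x := sg x `^ (1 - be') * x `^ (- be').

(** An interval with a < b/2 is enlarged to (0, b), which at most doubles its length, and the decay
    absorbs the singularity; for a >= b/2 the singular factor is nearly constant. *)
Lemma weight_condition : exists2 K, 0 <= K & forall a b, 0 <= a -> a < b ->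
  exists V S, [/\ 0 < V, 0 < S, J vh a b = V%:E, J sh a b = S%:E &
    V * S `^ (p - 1) <= K * (b `^ (- (2 * be / p)) * (b - a)) `^ p].
Proof.
move: (be01) => /andP[b0 b1]; have p10 : 0 < p - 1 by have := p1; lra.
have p0 : 0 < p by have := p1; lra.
have be'01 : 0 <= be' < 1.
  by rewrite divr_ge0 ?(ltW p10)//= ltr_pdivrMr// mul1r.
have [be'0 be'1] : 0 <= be' /\ be' < 1 by move: be'01 => /andP[].
have bep' : be' * (p - 1) = be by rewrite mulfVK// gt_eqF.
have [eta eta01 dec] := decay_eta.
have K00 : 0 <= K0.
  have h := joint (lexx 0) ltr01; rewrite subr0 powR1 mulr1 in h.
  by apply: le_trans h; rewrite mulr_ge0 ?powR_ge0.
pose Cv := decay_const eta be; pose Cs := decay_const eta be'.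
have Cv0 : 0 <= Cv by rewrite invr_ge0 ltW// decay_den_gt0.
have Cs0 : 0 <= Cs by rewrite invr_ge0 ltW// decay_den_gt0.
have mvh : measurable_fun (@Rplus R) vh by exact: measurable_decay_weight.
have msh : measurable_fun (@Rplus R) sh by exact: measurable_decay_weight.
have vh0 (x : R) : 0 < x -> 0 < vh x by move=> x0; rewrite mulr_gt0// powR_gt0// v0.
have sh0 (x : R) : 0 < x -> 0 < sh x by move=> x0; rewrite mulr_gt0// powR_gt0// sg0.
(* [Ka] serves a < b/2, where 2^p comes from b <= 2 (b - a); [Kb] serves a >= b/2, which gives
   a^(-2be) <= 4^be b^(-2be). *)
pose Ka := Cv * Cs `^ (p - 1) * K0 * 2 `^ p; pose Kb := 4 `^ be * K0.
have Ka0 : 0 <= Ka by rewrite !mulr_ge0// powR_ge0.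
have Kb0 : 0 <= Kb by rewrite mulr_ge0// powR_ge0.
exists (Ka + Kb); first exact: addr_ge0.
move=> a b a0 ab; have bpos : 0 < b := le_lt_trans a0 ab.
have ba0 : 0 < b - a by rewrite subr_gt0.
have posab x : a < x < b -> 0 < x by move=> /andP[ax _]; exact: le_lt_trans ax.
have mvab := measurable_itvoo_Rplus (b := b) a0 mvh.
have msab := measurable_itvoo_Rplus (b := b) a0 msh.
set dd := (_ `^ p).
have dd0 : 0 <= dd by exact: powR_ge0.
have ddE : dd = b `^ (- (2 * be)) * (b - a) `^ p.
  rewrite /dd powRM ?powR_ge0 ?(ltW ba0)// -powRrM; congr (_ `^ _ * _).
  by rewrite mulNr mulfVK// gt_eqF.
have key (A B k : R) : (J vh a b <= A%:E)%E -> (J sh a b <= B%:E)%E -> 0 <= A -> 0 <= B ->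
    A * B `^ (p - 1) <= k * dd -> k <= Ka + Kb ->
    exists V S, [/\ 0 < V, 0 < S, J vh a b = V%:E, J sh a b = S%:E & V * S `^ (p - 1) <= (Ka + Kb) * dd].
  move=> hA hB A0 B0 AB kK.
  have [V [V0 VA JV]] := J_real ab mvab (fun x h => vh0 x (posab x h)) hA.
  have [S [S0 SB JS]] := J_real ab msab (fun x h => sh0 x (posab x h)) hB.
  exists V, S; split => //; apply: le_trans (_ : A * B `^ (p - 1) <= _).
    by apply: ler_pM => //; rewrite ?powR_ge0 ?(ltW V0)//; apply: ge0_ler_powR; rewrite ?nnegrE ?(ltW p10) ?(ltW S0).
  by apply: le_trans AB _; rewrite ler_wpM2r.
case: (ltP a (b / 2)) => [small|large].
  have GA := vv0 (lexx 0) bpos; have GB := ss0 (lexx 0) bpos.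
  apply: (key (Cv * vv 0 b `^ (1 - be)) (Cs * ss 0 b `^ (1 - be')) Ka).
  - apply: le_trans (decay_integral mv v0 (fun T => Jv (lexx 0)) eta01 be01 (fun T T0 => (dec T T0).1) bpos).
    apply: J_subset => //; first exact: measurable_itvoo_Rplus.
    by move=> x /andP[x0 _]; apply/ltW/vh0.
  - apply: le_trans (decay_integral msg sg0 (fun T => Js (lexx 0)) eta01 be'01 (fun T T0 => (dec T T0).2) bpos).
    apply: J_subset => //; first exact: measurable_itvoo_Rplus.
    by move=> x /andP[x0 _]; apply/ltW/sh0.
  - by rewrite mulr_ge0 ?powR_ge0.
  - by rewrite mulr_ge0 ?powR_ge0.
  - rewrite powRM ?powR_ge0// -powRrM (_ : (1 - be') * (p - 1) = p - 1 - be); last by rewrite mulrBl bep' mul1r.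
    rewrite (_ : Cv * _ * _ = Cv * Cs `^ (p - 1) * (vv 0 b `^ (1 - be) * ss 0 b `^ (p - 1 - be))); last by ring.
    rewrite (_ : Ka * dd = Cv * Cs `^ (p - 1) * (K0 * (2 `^ p * dd))); last by rewrite /Ka; ring.
    rewrite ler_wpM2l ?mulr_ge0 ?powR_ge0//.
    have := joint (lexx 0) bpos; rewrite subr0 => h; apply: le_trans h _.
    rewrite ler_wpM2l// ddE mulrCA -powRM ?(ltW ba0)//.
    rewrite (_ : p - 2 * be = - (2 * be) + p); last by ring.
    rewrite powRD ?(gt_eqF bpos) ?implybT// ler_wpM2l ?powR_ge0//.
    apply: ge0_ler_powR; rewrite ?nnegrE ?mulr_ge0 ?(ltW p0) ?(ltW bpos) ?(ltW ba0)//; lra.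
  - by rewrite lerDl.
have b2 : 0 < b / 2 by rewrite divr_gt0.
have apos : 0 < a by exact: lt_le_trans large.
have be01c : 0 <= be <= 1 by rewrite b0 ltW.
have be'01c : 0 <= be' <= 1 by rewrite be'0 ltW.
apply: (key (a `^ (- be) * (vv a b `^ (1 - be) * (b - a) `^ be)) (a `^ (- be') * (ss a b `^ (1 - be') * (b - a) `^ be')) Kb).
- by apply: J_away (Jv a0 ab) => //; [exact: measurable_itvoo_Rplus|move=> x /posab/v0].
- by apply: J_away (Js a0 ab) => //; [exact: measurable_itvoo_Rplus|move=> x /posab/sg0].
- by rewrite !mulr_ge0 ?powR_ge0.
- by rewrite !mulr_ge0 ?powR_ge0.
- rewrite !powRM ?mulr_ge0 ?powR_ge0// -!powRrM mulNr bep' (_ : (1 - be') * (p - 1) = p - 1 - be); last by rewrite mulrBl bep' mul1r.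
  rewrite (_ : _ * _ = a `^ (- be) * a `^ (- be) * ((b - a) `^ be * (b - a) `^ be) * (vv a b `^ (1 - be) * ss a b `^ (p - 1 - be))); last by ring.
  rewrite -!powRD ?(gt_eqF apos) ?(gt_eqF ba0) ?implybT//.
  apply: le_trans (ler_wpM2l _ (joint a0 ab)) _; first by rewrite mulr_ge0 ?powR_ge0.
  rewrite ddE /Kb.
  rewrite (_ : _ * _ * (K0 * _) = K0 * (a `^ (- be + - be) * ((b - a) `^ (be + be) * (b - a) `^ (p - 2 * be)))); last by ring.
  rewrite -powRD ?(gt_eqF ba0) ?implybT// (_ : be + be + (p - 2 * be) = p); last by ring.
  rewrite (_ : 4 `^ be * K0 * _ = K0 * (4 `^ be * b `^ (- (2 * be)) * (b - a) `^ p)); last by ring.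
  rewrite ler_wpM2l// ler_wpM2r ?powR_ge0//.
  have -> : 4 `^ be = (2^-1) `^ (- (2 * be)) :> R.
    rewrite -powR_inv1// -powRrM mulN1r opprK powRrM powR_mulrn//.
    by congr (_ `^ _); ring.
  rewrite -powRM ?invr_ge0 ?(ltW bpos)// (_ : - be + - be = - (2 * be)); last by ring.
  rewrite !powRN lef_pV2 ?posrE ?powR_gt0 ?mulr_gt0 ?invr_gt0//.
  apply: ge0_ler_powR; rewrite ?nnegrE ?mulr_ge0 ?invr_ge0 ?(ltW apos) ?(ltW bpos)//; lra.
- by rewrite lerDr.
Qed.

End WeightCondition.
End IntervalIntegral.

(** * The heat kernel *)

Section KernelBound.
Context {R : realType}.
Implicit Types (nu t x y : R).

Lemma laguerre_lagP nu k x : laguerre nu k x = (lagP nu k.+1).[x].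
Proof.
rewrite /laguerre horner_poly; apply: eq_bigr => j _.
rewrite /lag_coef ltn_ord /= /gbinom.
have jk : (j <= k)%N by rewrite -ltnS ltn_ord.
have -> : \prod_(j.+1 <= i < k.+1) (nu + i%:R) = poch (nu + j.+1%:R) (k - j).
  rewrite -{1}[j.+1]add0n big_addn subSS big_mkord /poch; apply: eq_bigr => i _.
  by rewrite natrD addrA addrAC.
by ring.
Qed.

Definition kernel_const nu : R := 2 * Gamma 1 / Gamma (nu + 1).

(** In the product the square roots disappear, and the functional equation of [Gamma] turns the
    dependence on k into k! / (nu + 1)_k, as in the Hille-Hardy formula. *)
Lemma laguerre_fnM nu k x y : -1 < nu -> 0 < x -> 0 < y ->
  laguerre_fn nu k x * laguerre_fn nu k y =
  kernel_const nu * (x * y) `^ (nu + 2^-1) * expR (- ((x ^+ 2 + y ^+ 2) / 2)) *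
  ((k`!)%:R / poch (nu + 1) k * (lagP nu k.+1).[x ^+ 2] * (lagP nu k.+1).[y ^+ 2]).
Proof.
move=> nu1 x0 y0; have nu0 : 0 < nu + 1 by lra.
rewrite /laguerre_fn !laguerre_lagP.
have GA : Gamma (k%:R + 1) = (k`!)%:R * Gamma 1 :> R by rewrite addrC (GammaDn k ltr01) poch1.
have GB : Gamma (k%:R + nu + 1) = poch (nu + 1) k * Gamma (nu + 1).
  by rewrite -addrA addrC (GammaDn k nu0).
rewrite GA GB; set c := 2 * _ / _.
have cE : c = kernel_const nu * ((k`!)%:R / poch (nu + 1) k).
  by rewrite /c /kernel_const invfM; ring.
have c0 : 0 <= c.
  by rewrite divr_ge0 ?mulr_ge0 ?Gamma_ge0// ltW// poch_gt0.
set s := Num.sqrt c.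
have ss : s * s = c by rewrite -expr2 sqr_sqrtr.
rewrite powRM ?(ltW x0) ?(ltW y0)//.
have -> : expR (- ((x ^+ 2 + y ^+ 2) / 2)) = expR (- (x ^+ 2) / 2) * expR (- (y ^+ 2) / 2).
  by rewrite -expRD; congr expR; ring.
transitivity (s * s * ((lagP nu k.+1).[x ^+ 2] * (lagP nu k.+1).[y ^+ 2]) * (x `^ (nu + 2^-1) * y `^ (nu + 2^-1)) *
  (expR (- (x ^+ 2) / 2) * expR (- (y ^+ 2) / 2))); first by ring.
by rewrite ss cE; ring.
Qed.

Lemma heat_kernel_eq nu t x y : -1 < nu -> 0 < t -> 0 < x -> 0 < y ->
  let r := expR (- (4 * t)) in
  heat_kernel nu t x y =
  expR (- (t * (2 * nu + 2))) * (kernel_const nu * (x * y) `^ (nu + 2^-1) * expR (- ((x ^+ 2 + y ^+ 2) / 2))) *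
  (bin_series (nu + 1) r * expR (- ((x ^+ 2 + y ^+ 2) * r / (1 - r))) *
   bessel nu (x ^+ 2 * y ^+ 2 * r / (1 - r) ^+ 2)).
Proof.
move=> nu1 t0 x0 y0 r.
have r01 : 0 <= r < 1 by rewrite expR_ge0 expR_lt1 oppr_lt0 mulr_gt0.
have H := hille_hardy nu1 r01 (exprn_ge0 2 (ltW x0)) (exprn_ge0 2 (ltW y0)).
set A := expR (- (t * _)) * _.
have {}H := cvgMr (a := A) H.
rewrite /heat_kernel; apply: cvg_lim => //.
have -> : (fun n => \sum_(k < n) expR (- (t * (4 * k%:R + 2 * nu + 2))) * laguerre_fn nu k x * laguerre_fn nu k y) =
  (fun n => A * \sum_(k < n) r ^+ k * ((k`!)%:R / poch (nu + 1) k * (lagP nu k.+1).[x ^+ 2] * (lagP nu k.+1).[y ^+ 2])); last exact: H.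
apply/funext => n; rewrite mulr_sumr; apply: eq_bigr => k _.
rewrite -mulrA laguerre_fnM//.
have -> : expR (- (t * (4 * k%:R + 2 * nu + 2))) = expR (- (t * (2 * nu + 2))) * r ^+ k.
  by rewrite /r -expRM_natl -expRD; congr expR; ring.
by rewrite /A; ring.
Qed.

Lemma heat_kernel_bound nu : -1 < nu -> exists2 C, 0 <= C &
  forall t, 0 < t -> exists2 T, 0 < T & forall x y, 0 < x -> 0 < y ->
    `|heat_kernel nu t x y| <= C * (T `^ (- 2^-1) * (1 + T / (2 * (x * y))) `^ gamma_nu nu * expR (- ((x - y) ^+ 2 / T))).
Proof.
move=> nu1; have nu0 : 0 < nu + 1 by lra.
have [C0 C00 HC] := bessel_bound nu1.
have kc0 : 0 <= kernel_const nu by rewrite divr_ge0 ?mulr_ge0 ?Gamma_ge0.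
exists (kernel_const nu * 2 `^ (- (nu + 2^-1)) * C0); first by apply: mulr_ge0 => //; apply: mulr_ge0 => //; exact: powR_ge0.
move=> t t0.
set s := expR (- (2 * t)); have s0 : 0 < s by exact: expR_gt0.
have s1 : s < 1 by rewrite expR_lt1 oppr_lt0 mulr_gt0.
have rE : expR (- (4 * t)) = s ^+ 2.
  by rewrite /s expr2 -expRD; congr expR; ring.
have s21 : 0 < 1 - s ^+ 2 by rewrite subr_gt0 expr_lt1// ltW.
(* [T = 2 sinh (2 t)] *)
pose T := (1 - s ^+ 2) / s; have T0 : 0 < T by rewrite divr_gt0.
exists T => // x y x0 y0.
have r01 : 0 <= s ^+ 2 < 1 by rewrite exprn_ge0 ?(ltW s0)//= -subr_gt0.
have xy0 : 0 < x * y by exact: mulr_gt0.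
(* With this [z] the argument of the Bessel series is z^2 / 4. *)
pose z := 2 * (x * y) / T; have z0 : 0 < z by rewrite divr_gt0// mulr_gt0.
have qE : x ^+ 2 * y ^+ 2 * s ^+ 2 / (1 - s ^+ 2) ^+ 2 = z ^+ 2 / 4.
  by rewrite /z /T; field; rewrite !gt_eqF.
have B0 := bin_series_ge0 nu0 r01; have B1 := bin_series_le nu0 r01.
have J0 : 0 <= bessel nu (z ^+ 2 / 4) by apply: bessel_ge0 => //; rewrite divr_ge0// exprn_ge0// ltW.
rewrite heat_kernel_eq// rE qE; move: (kernel_const nu) kc0 => kc kc0; rewrite ger0_norm; last first.
  have A0 : 0 <= (x * y) `^ (nu + 2^-1) by exact: powR_ge0.
  by rewrite !mulr_ge0 ?expR_ge0.
set c := expR (- (t * _)).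
(* The prefactor is s^(nu+1), and the binomial series is at most (1 - s^2)^(-(nu+1)). *)
have cB : c * bin_series (nu + 1) (s ^+ 2) <= T `^ (- (nu + 1)).
  have cE : c = s `^ (nu + 1).
    by rewrite /c /s /powR gt_eqF ?expR_gt0// expRK; congr expR; ring.
  apply: le_trans (ler_wpM2l (expR_ge0 _ : 0 <= c) B1) _; rewrite cE.
  rewrite /T powRM ?invr_ge0 ?(ltW s0) ?(ltW s21)// [leRHS]mulrC.
  rewrite -[s^-1]powR_inv1 ?(ltW s0)// -powRrM.
  by rewrite (_ : -1 * - (nu + 1) = nu + 1)//; ring.
(* Since (x - y)^2 / T = (x^2 + y^2) / T - z, it remains to compare 1/T with 1/2 + s^2/(1 - s^2),
   which exceeds it by (1 - s)^2 / (2 (1 - s^2)). *)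
have eE : expR (- ((x ^+ 2 + y ^+ 2) / 2)) * expR (- ((x ^+ 2 + y ^+ 2) * s ^+ 2 / (1 - s ^+ 2))) * expR z <= expR (- ((x - y) ^+ 2 / T)).
  rewrite -!expRD ler_expR.
  have -> : - ((x - y) ^+ 2 / T) = z - (x ^+ 2 + y ^+ 2) * (s / (1 - s ^+ 2)).
    by rewrite /z /T; field; rewrite !gt_eqF.
  rewrite addrC lerD2l -opprD lerN2 -mulrA -mulrDr ler_wpM2l//.
    by rewrite addr_ge0// exprn_ge0// ltW.
  rewrite (_ : 2^-1 + s ^+ 2 / (1 - s ^+ 2) = s / (1 - s ^+ 2) + (1 - s) ^+ 2 / (2 * (1 - s ^+ 2))); last first.
    by field; rewrite gt_eqF.
  by rewrite lerDl divr_ge0// ?sqr_ge0// mulr_ge0// ltW.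
have JE := HC z z0.
have zE : (x * y) `^ (nu + 2^-1) * T `^ (- (nu + 1)) = T `^ (- 2^-1) * (2 `^ (- (nu + 2^-1)) * z `^ (nu + 2^-1)).
  have -> : x * y = 2^-1 * (z * T) by rewrite /z; field; rewrite gt_eqF.
  have h2 : 0 <= 2^-1 :> R by rewrite invr_ge0.
  rewrite (powRM _ h2 (mulr_ge0 (ltW z0) (ltW T0))) (powRM _ (ltW z0) (ltW T0)).
  have -> : T `^ (- 2^-1) = T `^ (nu + 2^-1) * T `^ (- (nu + 1)).
    by rewrite -powRD ?(gt_eqF T0) ?implybT//; congr (_ `^ _); lra.
  have -> : 2 `^ (- (nu + 2^-1)) = 2^-1 `^ (nu + 2^-1) :> R.
    by rewrite -mulN1r powRrM powR_inv1.
  by ring.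
have zi : z^-1 = T / (2 * (x * y)) by rewrite /z invf_div.
rewrite -zi.
set b := bin_series _ _ in B0 B1 cB *; set J := bessel _ _ in J0 JE *.
set e1 := expR (- (_ / 2)) in eE *; set e2 := expR (- (_ / (1 - _))) in eE *.
have e10 : 0 <= e1 by exact: expR_ge0. have e20 : 0 <= e2 by exact: expR_ge0.
rewrite (_ : c * _ * _ = kc * ((x * y) `^ (nu + 2^-1) * (c * b) * (e1 * e2 * J))); last by ring.
set E := expR (- (_ / T)) in eE *; set G := (1 + z^-1) `^ _ in JE *.
rewrite [leRHS](_ : _ = kc * (2 `^ (- (nu + 2^-1)) * (C0 * T `^ (- 2^-1) * G * E))); last by ring.
rewrite ler_wpM2l//.
apply: (@le_trans _ _ ((x * y) `^ (nu + 2^-1) * T `^ (- (nu + 1)) * (e1 * e2 * J))).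
  by apply: ler_wpM2r; [rewrite !mulr_ge0|rewrite ler_wpM2l ?powR_ge0].
rewrite zE [leLHS](_ : _ = 2 `^ (- (nu + 2^-1)) * (T `^ (- 2^-1) * (e1 * e2) * (z `^ (nu + 2^-1) * J))); last by ring.
rewrite ler_wpM2l ?powR_ge0//.
apply: le_trans (ler_wpM2l _ JE) _; first by rewrite !mulr_ge0 ?powR_ge0.
rewrite [leLHS](_ : _ = C0 * T `^ (- 2^-1) * G * (e1 * e2 * expR z)); last by ring.
by rewrite ler_wpM2l ?mulr_ge0 ?powR_ge0.
Qed.

End KernelBound.

(** * Intervals with rational endpoints *)

Section RationalIntervals.
Context {R : realType}.
Implicit Types (a b : R) (n : nat).

(** An index that codes no interval of the half line stands for (0, 1), so every index gives a
    nonempty interval. *)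
Definition rat_itv n : R * R :=
  if @unpickle (rat * rat)%type n is Some ab then
    if 0 <= ab.1 < ab.2 then (ratr ab.1, ratr ab.2) else (0, 1)
  else (0, 1).

Definition la n : R := (rat_itv n).1.
Definition rb n : R := (rat_itv n).2.

Lemma rat_itv_lt n : 0 <= la n /\ la n < rb n.
Proof.
rewrite /la /rb /rat_itv; case: unpickle => [[a b]|] /=; last by rewrite lexx ltr01.
case: ifP => /= [/andP[a0 ab]|_]; last by rewrite lexx ltr01.
by rewrite ler0q ltr_rat.
Qed.

Lemma rat_itv_cover a b : 0 <= a -> a < b ->
  exists n, [/\ la n <= a, b <= rb n & rb n - la n <= 2 * (b - a)].
Proof.
move=> a0 ab; have h0 : 0 < (b - a) / 2 by rewrite divr_gt0// subr_gt0.
have [q2] := @rat_in_itvoo R b (b + (b - a) / 2) (ltr_pwDr h0 (lexx b)).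
rewrite in_itv/= => /andP[b1 b2].
(* Left ends must be nonnegative, so for a = 0 the only choice is 0. *)
have [q1 [q10 q1a q1b]] : exists q1 : rat, [/\ 0 <= q1, ratr q1 <= a & a - (b - a) / 2 <= ratr q1].
  move: a0; rewrite le_eqVlt => /predU1P[a0|a0].
    subst a; exists 0; rewrite rmorph0 lexx; split => //.
    by rewrite sub0r oppr_le0 ltW.
  have ha : Num.max 0 (a - (b - a) / 2) < a by rewrite gt_max a0 ltrBlDr ltrDl.
  have [q] := rat_in_itvoo ha.
  rewrite in_itv/= gt_max => /andP[/andP[h1 h2] h3].
  by exists q; split; [rewrite -(ler0q R) ltW|exact: ltW|exact: ltW].
have q12 : q1 < q2 by rewrite -(ltr_rat R); lra.
exists (pickle (q1, q2)); rewrite /la /rb /rat_itv pickleK /= q10 q12 /=.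
by split; [|exact: ltW|lra].
Qed.

End RationalIntervals.

(** * From the hypotheses on the weight to the joint bound *)

Section WeightTranslation.
Context {R : realType}.
Local Notation mu := (@lebesgue_measure R).
Local Notation J g a b := (\int[mu]_(x in `]a%R, b%R[) (g x)%:E)%E.

(** The conjugate of 1/be is 1/(1 - be), also for be = 0, where +oo has conjugate 1. *)
Lemma conj_recip (be : R) : 0 <= be < 1 ->
  exists r, [/\ conj_exp (recip be) = r%:E, 0 < r & r * (1 - be) = 1].
Proof.
move=> /andP[be0 be1]; rewrite /recip; case: eqVneq => [->|bn].
  by exists 1; rewrite subr0 mulr1.
have b0 : 0 < be by rewrite lt_neqAle eq_sym bn.
have b1 : 0 < 1 - be by rewrite subr_gt0.
exists (1 - be)^-1; rewrite /= invr_gt0 b1 mulVf ?gt_eqF//; split => //.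
by congr (_%:E); field; rewrite bn /= gt_eqF.
Qed.

Lemma is_ballRp_itv (a b : R) : 0 <= a -> a < b -> is_ballRp `]a, b[%classic.
Proof.
move=> a0 ab; exists ((a + b) / 2), ((b - a) / 2).
split; first by rewrite divr_gt0//; lra.
split; first by rewrite divr_gt0// subr_gt0.
apply/seteqP; split => x; rewrite /ballRp /= in_itv/= ltr_norml.
  by move=> /andP[h1 h2]; split; [exact: le_lt_trans h1|apply/andP; split; lra].
by move=> [_ /andP[h1 h2]]; apply/andP; split; lra.
Qed.

Lemma avg_itv (a b : R) (g : R -> R) : a < b ->
  avg `]a, b[%classic g = ((b - a)^-1%:E * J g a b)%E.
Proof. by move=> ab; rewrite /avg itvoo_length. Qed.

Lemma measurable_weight_powR (w : R -> R) s : measurable_fun (@Rplus R) w ->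
  measurable_fun (@Rplus R) (fun x => w x `^ s).
Proof. exact: measurable_powR_comp. Qed.

(** As 1/r = 1 - be, the reverse Hoelder inequality bounds a power of the mean of w^r by the mean of
    w, and the Muckenhoupt condition bounds the mean of w times a power of the dual mean; chained,
    they eliminate the mean of w. *)
Lemma weight_joint (p be r : R) (w : R -> R) : 1 < p -> 0 <= be < 1 -> be < p - 1 ->
  0 < r -> r * (1 - be) = 1 ->
  is_weight w -> Ap_weight (p - be) w -> RH_weight r%:E w ->
  exists K0, forall a b, 0 <= a -> a < b -> exists v s,
   [/\ J (fun x => w x `^ r) a b = v%:E, J (fun x => w x `^ (- (p - 1 - be)^-1)) a b = s%:E &
     v `^ (1 - be) * s `^ (p - 1 - be) <= K0 * (b - a) `^ (p - 2 * be)].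
Proof.
move=> p1 /andP[be0 be1] bep r0 rbe [mw w0] [C1 HC1] [C2 HC2].
have q10 : 0 < p - 1 - be by lra.
have b10 : 0 < 1 - be by lra.
have rE : r^-1 = 1 - be by apply: (mulfI (lt0r_neq0 r0)); rewrite mulfV ?gt_eqF.
exists (C2 * C1) => a b a0 ab.
have L0 : 0 < b - a by rewrite subr_gt0.
have wp s : (0 < J (fun x => w x `^ s)%R a b)%E.
  apply: J_gt0 => //; first by apply: measurable_itvoo_Rplus => //; exact: measurable_powR_comp.
  by move=> x /andP[ax _]; rewrite powR_gt0// w0// (le_lt_trans a0).
have wp1 : (0 < J w a b)%E.
  apply: J_gt0 => //; first by apply: measurable_itvoo_Rplus.
  by move=> x /andP[ax _]; rewrite w0// (le_lt_trans a0).
have := HC1 _ (is_ballRp_itv a0 ab); have := HC2 _ (is_ballRp_itv a0 ab).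
rewrite !avg_itv// rE (_ : p - be - 1 = p - 1 - be); last by ring.
move: (wp r) (wp (- (p - 1 - be)^-1)) wp1.
have Li : 0 < (b - a)^-1 by rewrite invr_gt0.
(* All three integrals are positive, so an infinite one would violate one of the two conditions. *)
case: (J (fun x => w x `^ (- (p - 1 - be)^-1)) a b)%E => [s||]//; last first.
  move=> _ _; case: (J w a b) => [A||]// A0 _; rewrite ?(gt0_muley _ Li) ?gt0_muley ?lte_fin//.
    rewrite /= gt_eqF// => h; exfalso; move: h.
    by rewrite gt0_muley ?lte_fin ?mulr_gt0// leNgt ltry.
  by rewrite /= gt_eqF// gt0_muley// leNgt ltry.
case: (J w a b)%E => [A||]//; last first.
  move=> _ s0 _ _; rewrite gt0_muley ?lte_fin// gt0_mulye; first by rewrite leNgt ltry.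
  by rewrite -EFinM poweR_EFin lte_fin powR_gt0// mulr_gt0.
case: (J (fun x => w x `^ r) a b)%E => [v||]//; last first.
  move=> _ s0 A0; rewrite gt0_muley ?lte_fin// /= gt_eqF//.
rewrite !lte_fin => v0 s0 A0 H2 H1.
have {}H2 : ((b - a)^-1 * v) `^ (1 - be) <= C2 * ((b - a)^-1 * A) by rewrite -lee_fin; exact: H2.
have {}H1 : (b - a)^-1 * A * ((b - a)^-1 * s) `^ (p - 1 - be) <= C1 by rewrite -lee_fin; exact: H1.
exists v, s; split => //.
set L := b - a.
have vE : v `^ (1 - be) = L `^ (1 - be) * (L^-1 * v) `^ (1 - be).
  by rewrite -powRM ?mulr_ge0 ?invr_ge0 ?(ltW L0) ?(ltW v0)// mulrA mulfV ?gt_eqF// mul1r.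
have sE : s `^ (p - 1 - be) = L `^ (p - 1 - be) * (L^-1 * s) `^ (p - 1 - be).
  by rewrite -powRM ?mulr_ge0 ?invr_ge0 ?(ltW L0) ?(ltW s0)// mulrA mulfV ?gt_eqF// mul1r.
have C20 : 0 <= C2.
  have h : 0 < C2 * (L^-1 * A) by apply: lt_le_trans H2; rewrite powR_gt0// mulr_gt0.
  by move: h; rewrite pmulr_lgt0 ?mulr_gt0// => /ltW.
rewrite vE sE mulrACA -powRD ?(gt_eqF L0) ?implybT// (_ : 1 - be + (p - 1 - be) = p - 2 * be); last by ring.
rewrite mulrC ler_wpM2r ?powR_ge0//.
apply: le_trans (ler_wpM2r (powR_ge0 _ _) H2) _.
by rewrite -!mulrA ler_wpM2l// mulrA.
Qed.

End WeightTranslation.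

(** * The kernel at dyadic scales *)

Section Pointwise.
Context {R : realType}.
Local Notation mu := (@lebesgue_measure R).
Local Notation J g a b := (\int[mu]_(x in `]a%R, b%R[) (g x)%:E)%E.
Implicit Types (x y t : R).

(** A lower bound for the mass of the interval under x^(-2g), as x < [rb n] there. *)
Definition itv_size (g : R) n : R := rb n `^ (- (2 * g)) * (rb n - la n).

Lemma itv_size_gt0 g n : 0 < itv_size g n.
Proof.
have [a0 ab] := @rat_itv_lt R n.
by rewrite mulr_gt0 ?powR_gt0 ?subr_gt0// (le_lt_trans a0).
Qed.

Lemma gamma_nu_ge0 (nu : R) : 0 <= gamma_nu nu.
Proof. by rewrite /gamma_nu; case: ifP => // h; lra. Qed.

(** For the least j with u < 4^j, either j = 0 or 4^(j-1) <= u <= e^u. *)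
Lemma gaussian_scale (u : R) : 0 <= u -> exists2 j : nat, u < 4 ^+ j & expR (- u) <= 4 * 4 ^- j.
Proof.
move=> u0; have ex : exists j : nat, u < 4 ^+ j.
  exists (Num.trunc u).+1; have /andP[_ h] := truncn_itv u0; apply: lt_trans h _.
  by rewrite -natrX ltr_nat ltn_expl.
case: (ex_minnP ex) => -[|j] uj jmin.
  exists 0%N; rewrite // expr0 invr1 mulr1 (le_trans (_ : _ <= 1))// ?expR_le1 ?oppr_le0//; lra.
exists j.+1 => //; rewrite exprS invfM mulrA mulfV// mul1r expRN lef_pV2 ?posrE ?expR_gt0 ?exprn_gt0//.
have : 4 ^+ j <= u by rewrite leNgt; apply/negP => /jmin; rewrite ltnn.
by move=> h; apply: le_trans h _; apply: le_trans (expR_ge1Dx u); rewrite lerDr.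
Qed.

(** With r = 2^j T^(1/2) and b = x + r, the time factor is 2^j / r, and the singular factor is at
    most (2 b^2 / (x y))^g because T and x y are at most b^2. The constant 16 is 4 from the Gaussian
    times 4 from the length of the rational interval, at most 4 r. *)
Lemma kernel_scale (g T x : R) (j : nat) : 0 <= g -> 0 < T -> 0 < x ->
  exists n, la n < x < rb n /\ forall y, 0 < y -> (x - y) ^+ 2 < 4 ^+ j * T ->
    la n < y < rb n /\
    T `^ (- 2^-1) * (1 + T / (2 * (x * y))) `^ g * (4 * 4 ^- j) <=
    16 * 2 `^ g * 2 ^- j * x `^ (- g) / itv_size g n * y `^ (- g).
Proof.
move=> g0 T0 x0; pose r := 2 ^+ j * T `^ 2^-1.
have r0 : 0 < r by rewrite mulr_gt0 ?exprn_gt0 ?powR_gt0.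
have r2 : r ^+ 2 = 4 ^+ j * T.
  rewrite /r exprMn -exprM mulnC exprM (_ : 2 ^+ 2 = 4); last by ring.
  by rewrite -[_ ^+ 2]powR_mulrn ?powR_ge0// -powRrM mulVf ?powRr1 ?(ltW T0).
pose a := Num.max 0 (x - r); pose b := x + r.
have a0 : 0 <= a by rewrite le_max lexx.
have ax : a < x by rewrite gt_max x0 ltrBlDr ltrDl.
have xb : x < b by rewrite ltrDl.
have ab := lt_trans ax xb; have b0 := lt_trans x0 xb.
have bar : b - a <= 2 * r.
  have : x - r <= a by rewrite le_max lexx orbT.
  by rewrite /b; lra.
have [n [na nb nab]] := rat_itv_cover a0 ab.
exists n; split; first by rewrite (le_lt_trans na ax) (lt_le_trans xb nb).
move=> y y0 xyr.
have yr : `|x - y| < r.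
  rewrite -(ltr_pXn2r (n := 2)) ?nnegrE ?(ltW r0)// real_normK ?num_real//.
  by rewrite r2.
move: yr; rewrite ltr_norml => /andP[y1 y2].
have ya : a < y by rewrite gt_max y0; lra.
have yb : y < b by rewrite /b; lra.
split; first by rewrite (le_lt_trans na ya) (lt_le_trans yb nb).
have xy0 : 0 < x * y by exact: mulr_gt0.
have dn0 := itv_size_gt0 g n.
have rbn0 : 0 < rb n :> R by exact: lt_le_trans b0 nb.
have K1 : (1 + T / (2 * (x * y))) `^ g <= 2 `^ g * b `^ (2 * g) * (x `^ (- g) * y `^ (- g)).
  have -> : 2 `^ g * b `^ (2 * g) * (x `^ (- g) * y `^ (- g)) = (2 * b ^+ 2 / (x * y)) `^ g.
    rewrite !powRM ?mulr_ge0 ?exprn_ge0 ?invr_ge0 ?mulr_ge0 ?(ltW x0) ?(ltW y0) ?(ltW b0)//.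
    have -> : b `^ (2 * g) = (b ^+ 2) `^ g by rewrite powRrM powR_mulrn// ltW.
    rewrite -[(x * y)^-1]powR_inv1 ?(ltW xy0)// -powRrM mulN1r powRM ?(ltW x0) ?(ltW y0)//.
    rewrite expr2 powRM ?(ltW b0)//.
  apply: ge0_ler_powR; rewrite ?nnegrE//.
  - by rewrite addr_ge0// divr_ge0 ?mulr_ge0 ?(ltW T0) ?(ltW x0) ?(ltW y0).
  - by rewrite divr_ge0 ?mulr_ge0 ?exprn_ge0 ?(ltW x0) ?(ltW y0) ?(ltW b0).
  rewrite ler_pdivlMr// mulrDl mul1r.
  have -> : T / (2 * (x * y)) * (x * y) = T / 2 by field; rewrite !gt_eqF.
  have Tr : T <= r ^+ 2 by rewrite r2 ler_peMl ?(ltW T0)// exprn_ege1// ler1n.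
  have rb2 : r ^+ 2 <= b ^+ 2 by rewrite ler_pXn2r ?nnegrE ?(ltW r0) ?(ltW b0)// /b lerDr ltW.
  have xyb : x * y <= b ^+ 2 by rewrite expr2; apply: ler_pM; rewrite ?(ltW x0) ?(ltW y0) ?(ltW xb) ?(ltW yb).
  by have := ltW T0; lra.
have K2 : T `^ (- 2^-1) = 2 ^+ j / r.
  rewrite /r powRN; field; rewrite !gt_eqF ?powR_gt0 ?exprn_gt0//.
have K3 : b `^ (2 * g) / r <= 4 / itv_size g n.
  rewrite ler_pdivrMr// mulrAC ler_pdivlMr//.
  have : itv_size g n <= b `^ (- (2 * g)) * (2 * (2 * r)).
    apply: ler_pM; rewrite ?powR_ge0//.
    - by rewrite subr_ge0 ltW//; have [] := @rat_itv_lt R n.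
    - rewrite !powRN lef_pV2 ?posrE ?powR_gt0//; apply: ge0_ler_powR; rewrite ?nnegrE ?mulr_ge0 ?(ltW b0) ?(ltW rbn0)//.
    - by apply: le_trans nab _; rewrite ler_pM2l.
  move=> /(ler_wpM2l (powR_ge0 b (2 * g))) h; apply: le_trans h _.
  rewrite [leLHS]mulrA -powRD ?(gt_eqF b0) ?implybT// subrr powRr0 mul1r.
  by rewrite le_eqVlt; apply/orP; left; apply/eqP; ring.
rewrite K2; have E4 : 4 ^- j = 2 ^- j * 2 ^- j :> R.
  by rewrite -invfM -exprMn; congr ((_ ^+ _)^-1); ring.
apply: (@le_trans _ _ (2 ^+ j / r * (2 `^ g * b `^ (2 * g) * (x `^ (- g) * y `^ (- g))) * (4 * 4 ^- j))).
  rewrite ler_wpM2r ?mulr_ge0 ?invr_ge0 ?exprn_ge0// ler_wpM2l//.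
  by rewrite divr_ge0 ?exprn_ge0 ?(ltW r0).
rewrite E4 [leLHS](_ : _ = (4 * 2 `^ g * 2 ^- j * x `^ (- g) * y `^ (- g)) * (b `^ (2 * g) / r)); last first.
  by field; rewrite !gt_eqF ?exprn_gt0.
apply: le_trans (ler_wpM2l _ K3) _.
  by rewrite !mulr_ge0 ?powR_ge0 ?invr_ge0 ?exprn_ge0.
by rewrite le_eqVlt; apply/orP; left; apply/eqP; ring.
Qed.

End Pointwise.

(** * Pointwise domination of the heat maximal function *)

Section HeatPointwise.
Context {R : realType}.
Local Notation mu := (@lebesgue_measure R).
Local Notation J g a b := (\int[mu]_(x in `]a%R, b%R[) (g x)%:E)%E.
Local Notation E g := (\int[mu]_(x in Rplus) (g x)%:E)%E.
Local Notation I := (fun n : nat => `]la n, rb n[%classic : set R).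
Implicit Types (f g h w : R -> R) (n : nat).

Lemma Rplus_gt0 (x : R) : Rplus x <-> 0 < x.
Proof. by rewrite /Rplus /= in_itv/= andbT. Qed.

Lemma integral_ind g n : E (fun x => ind R I n x * g x) = J g (la n) (rb n).
Proof.
have [a0 _] := @rat_itv_lt R n.
rewrite -(setIidr (@subset_itv_Rplus R (la n) (rb n) a0)) integral_mkcondr; apply: eq_integral => x _.
by rewrite /patch /ind; case: (x \in _); rewrite ?mul1r ?mul0r.
Qed.

Lemma sum_half_le n : \sum_(j < n) 2 ^- j <= 2 :> R.
Proof.
suff -> : \sum_(j < n) 2 ^- j = 2 - 2 * 2 ^- n :> R.
  by rewrite gerBl mulr_ge0 ?invr_ge0 ?exprn_ge0.
elim: n => [|n IH]; first by rewrite big_ord0 expr0 invr1 mulr1 subrr.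
by rewrite big_ord_recr /= IH exprS; field; rewrite gt_eqF ?exprn_gt0.
Qed.

(* The Gaussian is at most 4 times the sum of 4^-j over the j with |x - y|^2 < 4^j T, and each of these regions is an interval around x. *)
Lemma heat_pointwise (nu : R) : -1 < nu -> exists2 C, 0 < C &
  forall f x B, measurable_fun (@Rplus R) f -> 0 < x -> 0 <= B ->
    (forall n, la n < x < rb n ->
      (J (fun y => `|f y| * y `^ (- gamma_nu nu))%R (la n) (rb n) <= (B * itv_size (gamma_nu nu) n)%:E)%E) ->
    (heat_max nu f x <= (C * (x `^ (- gamma_nu nu) * B))%:E)%E.
Proof.
move=> nu1; have [C C0 HC] := heat_kernel_bound nu1.
set g := gamma_nu nu in HC *; have g0 : 0 <= g by exact: gamma_nu_ge0.
pose A := C * (16 * 2 `^ g); have A0 : 0 <= A by rewrite !mulr_ge0 ?powR_ge0.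
(* The factor 2 is the sum of the 2^(-j); the summand 1 makes the constant positive, as
   [heat_max_strong] divides by it. *)
exists (A * 2 + 1); first by rewrite ltr_wpDl// mulr_ge0.
move=> f x B mf x0 B0 HB.
set h := (fun y => `|f y| * y `^ (- g)) in HB.
have h0 y : 0 <= h y by rewrite mulr_ge0 ?powR_ge0.
have mh : measurable_fun (@Rplus R) h.
  apply: measurable_funM; first by apply: measurableT_comp.
  by apply: (@measurable_powR_comp _ R R Rplus (fun x => x)) => //; exact: measurable_id.
apply: ge_ereal_sup => _ [t /Rplus_gt0 t0 <-].
have [T T0 HT] := HC t t0.
have [nn Hn] := choice (fun j => kernel_scale j g0 T0 x0).
pose D j := A * 2 ^- j * x `^ (- g) / itv_size g (nn j).
have D0 j : 0 <= D j.
  by rewrite /D divr_ge0 ?(ltW (itv_size_gt0 _ _))// !mulr_ge0 ?invr_ge0 ?exprn_ge0 ?powR_ge0.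
pose F j y := D j * (ind R I (nn j) y * h y).
have F0 j y : 0 <= F j y by rewrite mulr_ge0// mulr_ge0// ind_ge0.
have mF j : measurable_fun (@Rplus R) (F j).
  apply: measurable_funM => //; apply: measurable_funM => //.
  by apply: measurable_ind => i; exact: measurable_itv.
apply: (@le_trans _ _ (\int[mu]_(y in Rplus) \sum_(0 <= j <oo) (F j y)%:E)%E).
  apply: le_abse_integral_nomeas => y /Rplus_gt0 y0.
  (* At each y one scale j suffices, and its term is at most the whole nonnegative series. *)
  have [j uj ej] := gaussian_scale (divr_ge0 (sqr_ge0 (x - y)) (ltW T0)).
  have [xn yn] := Hn j.
  have xyT : (x - y) ^+ 2 < 4 ^+ j * T by rewrite -ltr_pdivrMr.
  have [yI kj] := yn y y0 xyT.
  apply: (@le_trans _ _ (F j y)%:E); last first.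
    apply: le_trans (nneseries_lim_ge (j.+1) _); last by move=> i _ _; rewrite lee_fin.
    by rewrite big_nat_recr//= leeDr// sume_ge0// => i _; rewrite lee_fin.
  rewrite lee_fin normrM /F /ind (_ : y \in _); last by rewrite mem_itvoo_setE.
  rewrite mul1r /h mulrCA mulrC ler_wpM2l//.
  apply: le_trans (HT x y x0 y0) _.
  rewrite (_ : D j * _ = C * (16 * 2 `^ g / 2 ^+ j * x `^ (- g) / itv_size g (nn j) * y `^ (- g))); last first.
    by rewrite /D /A; ring.
  rewrite ler_wpM2l//; apply: le_trans kj; rewrite ler_wpM2l//.
  by rewrite mulr_ge0 ?powR_ge0.
have mR : measurable (@Rplus R) by exact: measurable_itv.
have mFE j : measurable_fun (@Rplus R) (fun y => (F j y)%:E) by exact/measurable_EFinP.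
have F0E j y : Rplus y -> (0 <= (F j y)%:E)%E by move=> _; rewrite lee_fin.
rewrite (integral_nneseries mu mR mFE F0E).
apply: lime_le.
  by apply: is_cvg_nneseries => j _ _; apply: integral_ge0 => y _; rewrite lee_fin.
apply: nearW => k.
apply: (@le_trans _ _ (\sum_(0 <= j < k) (A * x `^ (- g) * B * 2 ^- j)%:E)%E).
  apply: lee_sum => j _; have [xn _] := Hn j.
  have -> : E (F j) = ((D j)%:E * J h (la (nn j)) (rb (nn j)))%E.
    rewrite E_scale//; last 2 first.
    - by apply: measurable_funM => //; apply: measurable_ind => i; exact: measurable_itv.
    - by move=> y _; rewrite mulr_ge0// ind_ge0.
    by rewrite integral_ind.
  apply: le_trans (lee_wpmul2l _ (HB _ xn)) _; first by rewrite lee_fin.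
  rewrite -EFinM lee_fin le_eqVlt; apply/orP; left; apply/eqP.
  by rewrite /D; field; rewrite !gt_eqF ?exprn_gt0 ?itv_size_gt0.
rewrite sumEFin lee_fin big_mkord -mulr_sumr.
apply: le_trans (ler_wpM2l _ (sum_half_le k)) _; first by rewrite !mulr_ge0 ?powR_ge0.
rewrite (_ : A * _ * _ * 2 = A * 2 * (x `^ (- g) * B)); last by ring.
by rewrite ler_wpM2r ?lerDl// mulr_ge0 ?powR_ge0.
Qed.

End HeatPointwise.

(** * The weighted inequality for finitely many intervals *)

Section WeightedNorm.
Context {R : realType}.
Local Notation mu := (@lebesgue_measure R).
Local Notation J g a b := (\int[mu]_(x in `]a%R, b%R[) (g x)%:E)%E.
Local Notation E g := (\int[mu]_(x in Rplus) (g x)%:E)%E.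
Local Notation I := (fun n : nat => `]la n, rb n[%classic : set R).
Variables (p g : R) (w : R -> R).
Hypothesis p1 : 1 < p.
Hypothesis g0 : 0 <= g.
Hypothesis pg1 : p * g < 1.
Hypothesis pg2 : 1 < p * (1 - g).
Hypothesis ww : is_weight w.
Hypothesis Aw : Ap_weight (p * (1 - g)) w.
Hypothesis RHw : RH_weight (conj_exp (recip (p * g))) w.

Let V (x : R) : R := w x * x `^ (- (p * g)).
Let S (x : R) : R := w x `^ (- (p - 1)^-1) * x `^ (- (p * g / (p - 1))).

(** [weight_condition] is used with v = w^r and sg = w^(-1/(p-1-be)); its densities are then [V] and
    [S], because r (1 - be) = 1 and (1 - be/(p-1)) / (p-1-be) = 1/(p-1). *)
Lemma weight_pair : exists2 K, 0 <= K & forall n, exists v s,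
  [/\ 0 < v, 0 < s, J V (la n) (rb n) = v%:E, J S (la n) (rb n) = s%:E &
    v * s `^ (p - 1) <= K * itv_size g n `^ p].
Proof.
have [mw w0] := ww.
have be01 : 0 <= p * g < 1 by rewrite pg1 andbT mulr_ge0//; have := p1; lra.
have [r [rE r0 rb1]] := conj_recip be01.
have RHw' : RH_weight r%:E w by rewrite -rE.
set be := p * g in be01 rb1 *.
have bep : be < p - 1 by rewrite /be; have := pg2; lra.
have [be0 be1] := andP be01.
have Aw' : Ap_weight (p - be) w by rewrite (_ : p - be = p * (1 - g))//; rewrite /be; ring.
have [K0 HK] := weight_joint p1 be01 bep r0 rb1 ww Aw' RHw'.
pose v x := w x `^ r; pose sg x := w x `^ (- (p - 1 - be)^-1).
have d0 : p - 1 - be != 0 by rewrite gt_eqF//; lra.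
have d1 : p - 2 * be != 0 by rewrite gt_eqF//; lra.
have d2 : p - 1 != 0 by rewrite gt_eqF//; have := p1; lra.
have dual x : 0 < x -> sg x `^ (1 - (1 - be) / (p - 2 * be)) * v x `^ ((1 - be) / (p - 2 * be)) = 1.
  move=> x0; have wx := w0 x x0.
  rewrite /v /sg -!powRrM -powRD ?(gt_eqF wx) ?implybT//.
  have -> : - (p - 1 - be)^-1 * (1 - (1 - be) / (p - 2 * be)) + r * ((1 - be) / (p - 2 * be)) = 0.
    rewrite (mulrA r) rb1 mul1r; field; by rewrite d0 d1.
  by rewrite powRr0.
have Jv a b : 0 <= a -> a < b -> J v a b = (fine (J v a b))%:E.
  by move=> a0 ab; have [? [? [-> _ _]]] := HK _ _ a0 ab.
have Jsg a b : 0 <= a -> a < b -> J sg a b = (fine (J sg a b))%:E.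
  by move=> a0 ab; have [? [? [_ -> _]]] := HK _ _ a0 ab.
have joint a b : 0 <= a -> a < b ->
    fine (J v a b) `^ (1 - be) * fine (J sg a b) `^ (p - 1 - be) <= K0 * (b - a) `^ (p - 2 * be).
  by move=> a0 ab; have [v' [s' [E1 E2 jK]]] := HK _ _ a0 ab; rewrite /v /sg E1 E2.
have [K K0' H] := weight_condition p1 be01 bep (measurable_powR_comp r mw) (measurable_powR_comp _ mw)
  (fun x x0 => powR_gt0 _ (w0 x x0)) (fun x x0 => powR_gt0 _ (w0 x x0)) dual Jv Jsg joint.
exists K => // n; have [a0 ab] := @rat_itv_lt R n.
have [v' [s' [v'0 s'0 E1 E2 jK]]] := H _ _ a0 ab.
exists v', s'; split; [exact: v'0|exact: s'0| | |].
- rewrite -E1; apply: eq_integral => x; rewrite inE /= in_itv/= => /andP[ax _].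
  have x0 : 0 < x by exact: le_lt_trans a0 ax.
  by rewrite -powRrM rb1 powRr1// ltW// w0.
- rewrite -E2; apply: eq_integral => x; rewrite inE /= in_itv/= => /andP[ax _].
  rewrite -powRrM; congr ((_ `^ _ * _)%:E); field.
  by rewrite d0 d2.
- by move: jK; rewrite /itv_size (_ : 2 * be / p = 2 * g)// /be; field; rewrite gt_eqF//; have := p1; lra.
Qed.

Let h (f : R -> R) (x : R) : R := `|f x| * x `^ (- g).

(** Identifies the right side of [two_weight] with the weighted norm of f. *)
Lemma dual_density (f : R -> R) x : 0 < x -> h f x `^ p * S x `^ (1 - p) = `|f x| `^ p * w x.
Proof.
move=> x0; have [_ w0] := ww; have wx := w0 x x0.
have p10 : p - 1 != 0 by rewrite gt_eqF//; have := p1; lra.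
rewrite /h /S !powRM ?powR_ge0// -!powRrM.
have -> : - (p - 1)^-1 * (1 - p) = 1 by field.
have -> : - (p * g / (p - 1)) * (1 - p) = g * p by field.
rewrite powRr1 ?(ltW wx)// mulrACA -[x `^ _ * _]powRD ?(gt_eqF x0) ?implybT//.
by rewrite mulNr addNr powRr0 mulr1.
Qed.

Lemma measurable_Rplus_powR s : measurable_fun (@Rplus R) (fun x => x `^ s).
Proof. by apply: (@measurable_powR_comp _ R R Rplus (fun x => x)) => //; exact: measurable_id. Qed.

(** Where h > S, h = h^p h^(1-p) <= h^p S^(1-p) = |f|^p w. Hence h <= S + |f|^p w everywhere, and
    both terms are integrable on the interval. *)
Lemma local_integral (f : R -> R) n : measurable_fun (@Rplus R) f ->
  (E (fun x => `|f x| `^ p * w x)%R < +oo)%E ->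
  exists2 H, 0 <= H & J (h f) (la n) (rb n) = H%:E.
Proof.
move=> mf fin; have [K _ /(_ n)[v [s [_ _ _ Js _]]]] := weight_pair.
have [a0 ab] := @rat_itv_lt R n; have [mw w0] := ww.
have p10 : 0 < p - 1 by have := p1; lra.
have mh : measurable_fun (@Rplus R) (h f).
  by apply: measurable_funM; [exact: measurableT_comp|exact: measurable_Rplus_powR].
have h0 x : 0 <= h f x by rewrite mulr_ge0 ?powR_ge0.
have J0 : (0 <= J (h f) (la n) (rb n))%E by apply: integral_ge0 => x _; rewrite lee_fin.
have mS : measurable_fun (@Rplus R) S.
  by apply: measurable_funM; [exact: measurable_powR_comp|exact: measurable_Rplus_powR].
have mfw : measurable_fun (@Rplus R) (fun x => `|f x| `^ p * w x).
  by apply: measurable_funM => //; apply: measurable_powR_comp; exact: measurableT_comp.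
suff Jfin : (J (h f) (la n) (rb n) < +oo)%E.
  exists (fine (J (h f) (la n) (rb n))); first by rewrite fine_ge0.
  by rewrite fineK// ge0_fin_numE.
apply: (@le_lt_trans _ _ (J (fun x => S x + `|f x| `^ p * w x)%R (la n) (rb n))).
  apply: J_le => // x /andP[ax xb]; have x0 : 0 < x by exact: le_lt_trans a0 ax.
  have S0 : 0 < S x by rewrite mulr_gt0 ?powR_gt0 ?w0.
  have [hS|Sh] := leP (h f x) (S x).
    by apply: le_trans hS _; rewrite lerDl mulr_ge0 ?powR_ge0// ltW// w0.
  apply: (@le_trans _ _ (`|f x| `^ p * w x)); last by rewrite lerDr ltW.
  rewrite -dual_density//.
  have h'0 : 0 < h f x by exact: lt_trans Sh.
  rewrite -opprB powRN ler_pdivlMr ?powR_gt0//.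
  have -> : h f x `^ p = h f x * h f x `^ (p - 1).
    by rewrite -{2}[h f x]powRr1 ?(ltW h'0)// -powRD ?(gt_eqF h'0) ?implybT// addrC subrK.
  by apply: (ler_wpM2l (ltW h'0)); exact: (ge0_ler_powR (ltW p10) (ltW S0) (ltW h'0) (ltW Sh)).
rewrite E_add; last 5 first.
- exact: measurable_itv.
- exact: measurable_itvoo_Rplus.
- exact: measurable_itvoo_Rplus.
- by move=> x _; rewrite mulr_ge0 ?powR_ge0.
- by move=> x /(subset_itv_Rplus a0) /Rplus_gt0 x0; rewrite mulr_ge0 ?powR_ge0// ltW// w0.
rewrite Js; apply: lte_add_pinfty; first exact: ltry.
apply: le_lt_trans fin; apply: ge0_subset_integral.
- exact: measurable_itv.
- exact: measurable_itv.
- exact/measurable_EFinP.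
- by move=> x /Rplus_gt0 x0; rewrite lee_fin mulr_ge0 ?powR_ge0// ltW// w0.
- exact: subset_itv_Rplus.
Qed.

Lemma maxf_two_weight : exists2 K, 0 <= K & forall (f : R -> R) (H : nat -> R), measurable_fun (@Rplus R) f ->
  (forall n, 0 <= H n /\ J (h f) (la n) (rb n) = (H n)%:E) ->
  forall s, (E (fun x => maxf I (fun n => H n / itv_size g n) s x `^ p * V x)%R <=
    K%:E * E (fun x => `|f x| `^ p * w x)%R)%E.
Proof.
have [K K0 HK] := weight_pair.
have p10 : 0 < p - 1 by have := p1; lra.
have p'1 : 1 < p / (p - 1) by rewrite ltr_pdivlMr//; lra.
exists (strong_const (p / (p - 1)) * (K `^ (p / (p - 1)) * strong_const p)).
  by apply: mulr_ge0; [exact: strong_const_ge0|apply: mulr_ge0; [exact: powR_ge0|exact: strong_const_ge0]].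
have [vv /choice[ss Hvs]] := choice HK.
move=> f H mf HH s; have [mw w0] := ww.
have -> : E (fun x => `|f x| `^ p * w x) = E (fun x => h f x `^ p * S x `^ (1 - p)).
  by apply: E_eq => x /Rplus_gt0 x0; rewrite dual_density.
apply: (@two_weight _ _ R mu (@Rplus R) _ I _ _ p K V S (fun x => x `^ (- (2 * g))) (h f) (itv_size g) vv ss H s).
- exact: measurable_itv.
- by move=> i; exact: measurable_itv.
- exact: interval_cover.
- exact: p1.
- exact: K0.
- by apply: measurable_funM => //; exact: measurable_Rplus_powR.
- by apply: measurable_funM; [exact: measurable_powR_comp|exact: measurable_Rplus_powR].
- exact: measurable_Rplus_powR.
- by apply: measurable_funM; [exact: measurableT_comp|exact: measurable_Rplus_powR].
- move=> x /Rplus_gt0 x0; have wx := w0 x x0.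
  by split; rewrite ?mulr_gt0 ?powR_gt0// mulr_ge0 ?powR_ge0.
- move=> x /Rplus_gt0 x0; have wx := w0 x x0.
  rewrite /V /S powRM ?powR_ge0// -!powRrM mulrACA.
  have -> : - (p - 1)^-1 * (p - 1) = -1 by rewrite mulNr mulVf ?gt_eqF.
  rewrite powR_inv1 ?(ltW wx)// mulfV ?gt_eqF// mul1r -powRD ?(gt_eqF x0) ?implybT//.
  by congr (_ `^ _); field; rewrite gt_eqF.
- move=> n; have [v0 s0 _ _ _] := Hvs n; have [H0 _] := HH n.
  by split => //; exact: itv_size_gt0.
- move=> n; have [v0 s0 Jv Js _] := Hvs n; have [H0 JH] := HH n.
  rewrite !integral_ind; split => //.
  have [a0 ab] := @rat_itv_lt R n; have b0 : 0 < rb n :> R by exact: le_lt_trans ab.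
  rewrite /itv_size EFinM -itvoo_length// -(integral_cst mu (measurable_itv `]la n, rb n[)).
  apply: J_le => x /andP[ax xb]; first exact: powR_ge0.
  have x0 : 0 < x by exact: le_lt_trans a0 ax.
  rewrite !powRN lef_pV2 ?posrE ?powR_gt0//; apply: ge0_ler_powR; rewrite ?nnegrE ?mulr_ge0 ?(ltW x0) ?(ltW b0)//.
  exact: ltW.
- by move=> n; have [_ _ _ _] := Hvs n.
Qed.

End WeightedNorm.

(** * Passage to all intervals *)

Section Strong.
Context {R : realType}.
Local Notation mu := (@lebesgue_measure R).
Local Notation J g a b := (\int[mu]_(x in `]a%R, b%R[) (g x)%:E)%E.
Local Notation E g := (\int[mu]_(x in Rplus) (g x)%:E)%E.
Local Notation I := (fun n : nat => `]la n, rb n[%classic : set R).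

Lemma maxf_iota_nondecreasing (al : nat -> R) x :
  {homo (fun n => maxf I al (iota 0 n) x) : m n / (m <= n)%N >-> m <= n}.
Proof.
move=> m n mn; apply: maxf_le => [|i]; first exact: maxf_ge0.
rewrite mem_iota add0n => /andP[_ im] xi; apply: le_maxf => //.
by rewrite mem_iota add0n (leq_trans im).
Qed.

Lemma heat_max_ge0 nu (f : R -> R) x : (0 <= heat_max nu f x)%E.
Proof.
apply: (@le_trans _ _ `|heat nu 1 f x|%E); first exact: abse_ge0.
by apply: ereal_sup_ubound; exists 1 => //; exact/Rplus_gt0.
Qed.

Lemma heat_max_strong (nu p : R) (w : R -> R) : -1 < nu -> 1 < p ->
  p * gamma_nu nu < 1 -> 1 < p * (1 - gamma_nu nu) ->
  is_weight w -> Ap_weight (p * (1 - gamma_nu nu)) w ->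
  RH_weight (conj_exp (recip (p * gamma_nu nu))) w ->
  exists2 K, 0 <= K & forall f : R -> R, measurable_fun (@Rplus R) f ->
    (E (fun x => `|f x| `^ p * w x)%R < +oo)%E ->
    (\int[mu]_(x in Rplus) (poweR `|heat_max nu f x| p * (w x)%:E) <=
     K%:E * E (fun x => `|f x| `^ p * w x)%R)%E.
Proof.
move=> nu1 p1; have g0 := gamma_nu_ge0 nu.
have [C C0 HC] := heat_pointwise nu1.
set g := gamma_nu nu in g0 HC * => pg1 pg2 ww Aw RHw.
have p0 : 0 < p by lra.
have [K K0 HK] := maxf_two_weight p1 g0 pg1 pg2 ww Aw RHw.
have [mw w0] := ww.
exists (C `^ p * K); first by rewrite mulr_ge0 ?powR_ge0.
move=> f mf fin.
have /choice[H HH] n : exists H, 0 <= H /\ J (fun y => `|f y| * y `^ (- g)) (la n) (rb n) = H%:E.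
  by have [H H0 JH] := local_integral p1 g0 pg1 pg2 ww Aw RHw n mf fin; exists H.
have HKf := HK f H mf HH.
pose V x := w x * x `^ (- (p * g)).
pose M n x := maxf I (fun n => H n / itv_size g n) (iota 0 n) x.
have M0 n x : 0 <= M n x by exact: maxf_ge0.
have V0 x : 0 < x -> 0 < V x by move=> x0; rewrite mulr_gt0 ?powR_gt0 ?w0.
pose F n x : R := C `^ p * (M n x `^ p * V x).
have mMV n : measurable_fun (@Rplus R) (fun x => M n x `^ p * V x).
  apply: measurable_funM; last by apply: measurable_funM => //; exact: measurable_Rplus_powR.
  by apply: measurable_powR_comp; apply: measurable_maxf => i; exact: measurable_itv.
have MV0 n x : Rplus x -> 0 <= M n x `^ p * V x.
  by move=> /Rplus_gt0 x0; rewrite mulr_ge0 ?powR_ge0// ltW// V0.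
have F0 n x : Rplus x -> (0 <= (F n x)%:E)%E.
  by move=> Dx; rewrite lee_fin; apply: mulr_ge0; [exact: powR_ge0|exact: MV0].
have mF n : measurable_fun (@Rplus R) (fun x => (F n x)%:E).
  by apply/measurable_EFinP; apply: measurable_funM.
have F_nd x : Rplus x -> {homo (fun n => (F n x)%:E) : m n / (m <= n)%N >-> (m <= n)%E}.
  move=> /Rplus_gt0 x0 m n mn; rewrite lee_fin; apply: ler_wpM2l; first exact: powR_ge0.
  apply: ler_wpM2r; first by rewrite ltW// V0.
  by apply: (ge0_ler_powR (ltW p0) (M0 m x) (M0 n x)); exact: maxf_iota_nondecreasing.
have mR : measurable (@Rplus R) by exact: measurable_itv.
(* [F n] uses the first n intervals; its limit dominates the integrand on the left pointwise. *)
apply: (@le_trans _ _ (\int[mu]_(x in Rplus) limn (fun n => (F n x)%:E))%E); last first.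
  rewrite (monotone_convergence mu mR mF F0 F_nd).
  apply: lime_le.
    apply: ereal_nondecreasing_is_cvgn => m n mn.
    by apply: ge0_le_integral_nomeas => x Dx; [exact: F0|exact: F_nd].
  apply: nearW => n.
  rewrite (E_scale mu mR (mMV n) (MV0 n) (powR_ge0 _ _)) EFinM -muleA.
  by apply: lee_wpmul2l; [rewrite lee_fin powR_ge0|exact: HKf].
apply: ge0_le_integral_nomeas => x Dx; have x0 := (Rplus_gt0 x).1 Dx.
  by apply: mule_ge0; [exact: poweR_ge0|rewrite lee_fin ltW// w0].
have Fl n : ((F n x)%:E <= limn (fun n => (F n x)%:E))%E.
  rewrite (cvg_lim _ (ereal_nondecreasing_cvgn (F_nd x Dx)))//.
  by apply: ereal_sup_ubound; exists n.
move: (limn _) Fl => [L||] Fl; last first.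
- by have := Fl 0%N; rewrite leNgt ltNyr.
- by rewrite leey.
have L0 : 0 <= L by rewrite -lee_fin; apply: le_trans (Fl 0%N); exact: F0.
(* The solution of C^p B^p V = L: it bounds every finite maximum at x, hence every average that
   [heat_pointwise] asks for. *)
pose B := (L / V x) `^ p^-1 / C.
have B0 : 0 <= B by rewrite divr_ge0 ?powR_ge0// ltW.
have MB n : M n x <= B.
  rewrite /B ler_pdivlMr// mulrC.
  have -> : C * M n x = ((C * M n x) `^ p) `^ p^-1.
    by rewrite -powRrM mulfV ?gt_eqF// powRr1// mulr_ge0// ltW.
  apply: ge0_ler_powR; rewrite ?nnegrE ?invr_ge0 ?powR_ge0 ?(ltW p0)//.
    by rewrite divr_ge0// ltW// V0.
  by rewrite ler_pdivlMr ?V0// powRM ?(ltW C0)// -mulrA -lee_fin; exact: Fl.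
have hB : (heat_max nu f x <= (C * (x `^ (- g) * B))%:E)%E.
  apply: HC => // n xn; have [H0 ->] := HH n; rewrite lee_fin -ler_pdivrMr ?itv_size_gt0//.
  apply: le_trans (MB n.+1); apply: (le_maxf (fun n => H n / itv_size g n)).
    by rewrite mem_iota add0n ltnSn.
  by rewrite mem_itvoo_setE.
rewrite gee0_abs ?heat_max_ge0//.
have hp : (poweR (heat_max nu f x) p <= ((C * (x `^ (- g) * B)) `^ p)%:E)%E.
  rewrite -poweR_EFin; apply: gt0_ler_poweR => //; rewrite ?ltW// in_itv/= leey andbT.
    exact: heat_max_ge0.
  exact: le_trans (heat_max_ge0 nu f x) hB.
apply: le_trans (lee_wpmul2r _ hp) _; first by rewrite lee_fin ltW// w0.
rewrite -EFinM lee_fin le_eqVlt; apply/orP; left; apply/eqP.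
have -> : C * (x `^ (- g) * B) = x `^ (- g) * (L / V x) `^ p^-1.
  by rewrite /B mulrCA [C * _]mulrC divfK// gt_eqF.
rewrite powRM ?powR_ge0// -!powRrM mulVf ?gt_eqF//.
rewrite powRr1; last by rewrite divr_ge0// ltW// V0.
have V1 : V x != 0 by rewrite gt_eqF// V0.
rewrite (_ : - g * p = - (p * g)); last by ring.
rewrite mulrAC mulrC [x `^ _ * _]mulrC -/(V x).
by rewrite divfK.
Qed.

End Strong.

Theorem theorem1p1 (R : realType) (nu p : R) (w : R -> R) :
  -1 < nu ->
  (conj_exp (recip (gamma_nu nu)) < p%:E)%E ->
  (p%:E < recip (gamma_nu nu))%E ->
  is_weight w ->
  Ap_weight (p * (1 - gamma_nu nu)) w ->
  RH_weight (conj_exp (recip (p * gamma_nu nu))) w ->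
  exists C : R, 0 < C /\
    forall f : R -> R, measurable_fun Rplus f ->
      (Lpw_norm p w (fun x => (f x)%:E) < +oo)%E ->
      (Lpw_norm p w (heat_max nu f) <= C%:E * Lpw_norm p w (fun x => (f x)%:E))%E.
Proof.
move=> nu1 cp pc ww Aw RHw; have g0 := gamma_nu_ge0 nu.
have g1 : gamma_nu nu < 1 by rewrite /gamma_nu; case: ifP => _ //; lra.
have g01 : 0 <= gamma_nu nu < 1 by rewrite g0.
have [r [rE r0 rg]] := conj_recip g01.
(* Here r = 1/(1 - g) with g = [gamma_nu nu], so the lower bound on p amounts to 1 < p (1 - g). *)
have rp : r < p by rewrite -lte_fin -rE.
have r1 : 1 <= r by rewrite -rg ler_piMr ?(ltW r0)// lerBlDr lerDl.
have p1 : 1 < p by exact: le_lt_trans rp.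
have p0 : 0 < p by lra.
have pg2 : 1 < p * (1 - gamma_nu nu) by rewrite -[ltLHS]rg ltr_pM2r// subr_gt0.
have pg1 : p * gamma_nu nu < 1.
  move: pc; rewrite /recip; case: eqVneq => [->|gn]; first by rewrite mulr0.
  by rewrite lte_fin -ltr_pdivlMr ?div1r// lt_neqAle eq_sym gn.
have [K K0 HK] := heat_max_strong nu1 p1 pg1 pg2 ww Aw RHw.
(* [K] may be 0, so 1 is added to obtain a positive constant. *)
exists ((K + 1) `^ p^-1); split; first by rewrite powR_gt0// ltr_wpDl.
move=> f mf; rewrite /Lpw_norm.
have -> : (\int[lebesgue_measure]_(x in Rplus) (poweR `|(f x)%:E| p * (w x)%:E) =
    \int[lebesgue_measure]_(x in Rplus) (`|f x| `^ p * w x)%:E)%E.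
  by apply: eq_integral => x _.
set N := (\int[_]_(x in _) _%:E)%E => fin.
have N0 : (0 <= N)%E.
  by apply: integral_ge0 => x /Rplus_gt0 x0; rewrite lee_fin mulr_ge0 ?powR_ge0// ltW// ww.2.
have Nfin : (N < +oo)%E.
  rewrite ltey; apply: contraTneq fin => ->.
  by rewrite /= gt_eqF ?invr_gt0// ltxx.
rewrite -poweR_EFin -poweRM ?lee_fin ?addr_ge0//.
have h0 : (0 <= \int[lebesgue_measure]_(x in Rplus) (poweR `|heat_max nu f x| p * (w x)%:E))%E.
  by apply: integral_ge0 => x /Rplus_gt0 x0; apply: mule_ge0; [exact: poweR_ge0|rewrite lee_fin ltW// ww.2].
apply: gt0_ler_poweR; rewrite ?invr_ge0 ?(ltW p0)// ?in_itv/= ?leey ?andbT//.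
  by rewrite mule_ge0// lee_fin addr_ge0.
apply: le_trans (HK f mf Nfin) _; apply: lee_wpmul2r => //.
by rewrite lee_fin lerDl.
Qed.
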